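(* There are absolute constants $c$, $\alpha>0$ and $t_0$ such that for every integer $t\ge t_0$ the following holds. Let $\mathcal{R}_t$ be a set of $t$-boundaried planar graphs such that every equivalence class of $\equiv_{\mathrm{IS},t}$ that contains a planar graph of pathwidth at most $t+c$ contains some graph of $\mathcal{R}_t$. Then $\mathcal{R}_t$ contains a graph with at least $\alpha\log_2 M(t)$ vertices; moreover $\log_2 M(t)\ge 2^t/\sqrt{4t}$, so this is $\Omega(2^t/\sqrt{4t})$.
   Context: $M(t)$ is the $t$-th Dedekind number (number of monotone Boolean functions of $t$ variables). A $t$-boundaried graph is a finite simple undirected graph with an injective labeling of $t$ distinct boundary vertices by $1,\dots,t$; the gluing $G\oplus F$ is obtained from the disjoint union by identifying equally labeled boundary vertices and removing parallel edges. $\mathrm{opt}_{\mathrm{IS}}$ is the maximum size of an independent set. $G\equiv_{\mathrm{IS},t}H$ means there is $\Delta\in\mathbb{Z}$ with $\mathrm{opt}_{\mathrm{IS}}(G\oplus F)=\mathrm{opt}_{\mathrm{IS}}(H\oplus F)+\Delta$ for every $t$-boundaried graph $F$. The paper phrases the pathwidth bound as $t+\mathcal{O}(1)$ and the conclusion as ''a graph with $\Omega(\log M(t))\ge\Omega(2^t/\sqrt{4t})$ vertices''. *)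

(* Defs.v *)
From HB Require Import structures.
From mathcomp Require Import all_boot all_order all_algebra.
From mathcomp Require Import generic_quotient.
From mathcomp Require Import all_classical all_reals all_analysis.
Import Order.TTheory GRing.Theory Num.Theory.
Import numFieldNormedType.Exports.

Set Implicit Arguments.
Unset Strict Implicit.
Unset Printing Implicit Defensive.

Local Open Scope quotient_scope.

Record sgraph := SGraph {
  svertex :> finType;
  sedge : rel svertex;
  sedge_sym : symmetric sedge;
  sedge_irrefl : irreflexive sedge
}.

(* Boundary labels are 0, ..., t-1 instead of 1, ..., t. *)
Record bgraph (t : nat) := BGraph {
  bgraph_sgraph :> sgraph;
  bd : 'I_t -> bgraph_sgraph;
  bd_inj : injective bd
}.

Section Glue.
Variables (t : nat) (G F : bgraph t).

Definition glue_rel (x y : G + F) : bool :=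
  match x, y with
  | inl a, inl b => a == b
  | inr a, inr b => a == b
  | inl a, inr b => [exists i, (a == bd G i) && (b == bd F i)]
  | inr b, inl a => [exists i, (a == bd G i) && (b == bd F i)]
  end.

Lemma glue_rel_refl : reflexive glue_rel.
Proof. by case=> x /=. Qed.

Lemma glue_rel_sym : symmetric glue_rel.
Proof. by move=> [x|x] [y|y] //=; rewrite eq_sym. Qed.

Lemma glue_rel_trans : transitive glue_rel.
Proof.
move=> [y|y] [x|x] [z|z] /=.
- by move=> /eqP->.
- by move=> /eqP->.
- by move=> xy /eqP<-.
- move=> /existsP[i /andP[/eqP yi /eqP->]] /existsP[j /andP[/eqP yj /eqP->]].
  by move: yj; rewrite yi => /(@bd_inj _ G) ->.
- move=> /existsP[i /andP[/eqP-> /eqP yi]] /existsP[j /andP[/eqP-> /eqP yj]].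
  by move: yj; rewrite yi => /(@bd_inj _ F) ->.
- by move=> xy /eqP<-.
- by move=> /eqP->.
- by move=> /eqP->.
Qed.

Canonical glue_equiv :=
  EquivRel glue_rel glue_rel_refl glue_rel_sym glue_rel_trans.

Definition glue_vertex := {eq_quot glue_equiv}.

HB.instance Definition _ := Choice.on glue_vertex.
HB.instance Definition _ := EqQuotient.on glue_vertex.
HB.instance Definition _ :=
  Countable.copy glue_vertex (can_type (@reprK _ glue_vertex)).
HB.instance Definition _ := fintype.isFinite.Build glue_vertex
  (pcan_enumP (can_pcan (@reprK _ glue_vertex))).

Definition dunion_edge (x y : G + F) : bool :=
  match x, y with
  | inl a, inl b => sedge a b
  | inr a, inr b => sedge a b
  | _, _ => false
  end.

Definition glue_edge (u v : glue_vertex) : bool :=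
  [exists x, exists y,
    [&& \pi_glue_vertex x == u, \pi_glue_vertex y == v & dunion_edge x y]].

Lemma glue_edge_sym : symmetric glue_edge.
Proof.
have dsym x y : dunion_edge x y = dunion_edge y x.
  by move: x y => [x|x] [y|y] //=; rewrite sedge_sym.
move=> u v; apply/existsP/existsP => -[x /existsP[y /and3P[xu yv xy]]];
  by exists y; apply/existsP; exists x; rewrite xu yv dsym.
Qed.

Lemma glue_edge_irrefl : irreflexive glue_edge.
Proof.
move=> u; apply/existsP => -[x /existsP[y /and3P[/eqP xu /eqP yu]]].
have /eqmodP : x = y %[mod glue_vertex] by rewrite xu yu.
by move: x y {xu yu} => [x|x] [y|y] //= /eqP->; rewrite sedge_irrefl.
Qed.

Definition gluing : sgraph := SGraph glue_edge_sym glue_edge_irrefl.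

End Glue.

Definition independent (G : sgraph) (S : {set G}) : bool :=
  [forall u in S, forall v in S, ~~ sedge u v].

Definition opt_IS (G : sgraph) : nat :=
  \max_(S : {set G} | independent S) #|S|.

Definition equiv_IS (t : nat) (G H : bgraph t) : Prop :=
  exists Delta : int, forall F : bgraph t,
    ((opt_IS (gluing G F))%:Z = (opt_IS (gluing H F))%:Z + Delta)%R.

(* Sets of t-boundaried graphs are plain predicates: the universe constraints of
   MathComp-Analysis exclude [set (bgraph t)]. *)
Definition is_equiv_IS_class (t : nat) (C : bgraph t -> Prop) : Prop :=
  exists G : bgraph t, forall H : bgraph t, C H <-> equiv_IS G H.

Definition is_path_decomposition (G : sgraph) (X : seq {set G}) : Prop :=
  [/\ forall v : G, exists2 B, B \in X & v \in B,
      forall u v : G, sedge u v -> exists2 B, B \in X & (u \in B) && (v \in B)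
    & forall i j k : nat, i <= j -> j <= k -> k < size X ->
        nth finset.set0 X i :&: nth finset.set0 X k \subset nth finset.set0 X j].

(* Truncated: the decompositions with empty bags only have width 0, not -1;
   this matters for the graph without vertices alone. *)
Definition decomposition_width (G : sgraph) (X : seq {set G}) : nat :=
  (\max_(B <- X) #|B|).-1.

Definition has_path_decomposition (G : sgraph) (w : nat) : bool :=
  `[< exists2 X : seq {set G},
        is_path_decomposition X & decomposition_width X = w >].

Lemma pathwidth_exists (G : sgraph) : exists w, has_path_decomposition G w.
Proof.
exists (decomposition_width [:: [set: G]]%SET).
apply/asboolP; exists [:: [set: G]%SET] => //; split.
- by move=> v; exists [set: G]%SET; rewrite !inE.
- by move=> u v _; exists [set: G]%SET; rewrite !inE.
- move=> i j k ij jk; rewrite ltnS leqn0 => /eqP k0.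
  by move: jk ij; rewrite k0 leqn0 => /eqP-> _; exact: finset.subsetT.
Qed.

Definition pathwidth (G : sgraph) : nat := ex_minn (pathwidth_exists G).

Section Planarity.
Local Open Scope classical_set_scope.
Local Open Scope ring_scope.
Variable R : realType.

Definition is_arc (a b : R * R) (A : set (R * R)) : Prop :=
  exists gamma : R -> R * R,
    [/\ {within `[0, 1], continuous gamma},
        {in `[0, 1] &, injective gamma},
        gamma 0 = a, gamma 1 = b & A = gamma @` `[0, 1]].

(* Topological drawing without crossings: vertices are distinct points of the
   plane, the edge {u, v} is an arc between the points u and v, and the interior
   of an edge contains no vertex and no point of any other edge.  The family
   [arc] is indexed by the edge as an unordered pair of vertices; its values
   at other sets of vertices are irrelevant. *)
Definition planar (G : sgraph) : Prop :=
  exists (pt : G -> R * R) (arc : {set G} -> set (R * R)),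
    [/\ injective pt,
        forall u v : G, sedge u v -> is_arc (pt u) (pt v) (arc [set u; v]%SET),
        forall u v w : G, sedge u v ->
          ~ (arc [set u; v]%SET `\` [set pt u; pt v]) (pt w)
      & forall u v x y : G, sedge u v -> sedge x y ->
          [set u; v]%SET != [set x; y]%SET ->
          (arc [set u; v]%SET `\` [set pt u; pt v]) `&` arc [set x; y]%SET
            = set0].

End Planarity.

Definition monotone_bf (t : nat) (f : {ffun {ffun 'I_t -> bool} -> bool}) :
    bool :=
  [forall x : {ffun 'I_t -> bool}, forall y : {ffun 'I_t -> bool},
    [forall i, x i ==> y i] ==> (f x ==> f y)].

Definition dedekind (t : nat) : nat :=
  #|[set f : {ffun {ffun 'I_t -> bool} -> bool} | monotone_bf f]%SET|.

Definition log2 (R : realType) (x : R) : R := (ln x / ln 2)%R.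

(* Main.v *)
From Stdlib Require Import ZArith.
Require Import Defs.
From mathcomp Require Import generic_quotient.
From mathcomp Require Import all_boot all_order all_algebra.
From mathcomp Require Import all_classical all_reals all_analysis.
From mathcomp Require Import zify ring lra ssrZ.
Import Order.TTheory GRing.Theory Num.Theory.
Import numFieldNormedType.Exports.

Set Implicit Arguments.
Unset Strict Implicit.
Unset Printing Implicit Defensive.

(* An upset [phi] of subsets of the boundary, not containing the empty set, is encoded
   in a planar clause graph of pathwidth [t + O(1)]: a grid of crossing gadgets with one
   row per boundary vertex and one column per set, where for [phi T] the column
   of [T] carries the clause excluding the sets that contain [T].  The maximum size of
   an independent set whose boundary part lies in [S] is [const + #|S|] if [phi S] fails
   and smaller otherwise.  Such clause graphs are pairwise inequivalent, so each of these
   [M(t) - 1] upsets needs its own planar representative.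

   Planar graphs with [n] vertices are [2 ^ O(n)] in number up to isomorphism.
   Subdividing finely the arcs of a drawing and rounding to the lattice exhibits the
   graph as a minor of a square grid.  In the grid every cycle bounds modulo 2, and
   counting dimensions over F_2 yields Euler's bound of [3 n] on the number of edges.
   Sparsity then lets one halve the graph repeatedly: either contract a large matching
   or merge the many vertices with equal small neighbourhoods, at a cost of [O(n)]
   bits that is summable along the halving.  With [N] bounding the sizes of the
   representatives, this gives [M(t) <= N * 2 ^ (K * N) * N ^ t + 1]. *)

(** * Minors of the square grid *)

Definition minor_model (K : eqType) (r : rel K) (G : sgraph)
    (m : K -> option G) : Prop :=
  [/\ forall u, exists x, m x = Some u,
      forall u x y, m x = Some u -> m y = Some u ->
        exists p, [/\ path r x p, last x p = y & all (fun z => m z == Some u) p]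
    & forall u v, sedge u v ->
        exists x y, [/\ m x = Some u, m y = Some v & r x y]].

Lemma minor_model_trans (K : eqType) (r : rel K) (G H : sgraph)
    (m : K -> option G) (m' : G -> option H) :
  minor_model r m -> minor_model (@sedge G) m' ->
  minor_model r (fun x => obind m' (m x)).
Proof.
move=> [ne con edg] [ne' con' edg']; split.
- move=> u; have [g gu] := ne' u; have [x xg] := ne g.
  by exists x; rewrite xg.
- move=> u x y; case mx: (m x) => [g|//] /= gu; case my: (m y) => [h|//] /= hu.
  have [p [pp lp ap]] := con' _ _ _ gu hu.
  elim: p g x mx gu pp lp ap => [|k p IH] g x mx gu /=.
    move=> _ gh _; rewrite -{}gh in my.
    have [q [pq lq aq]] := con _ _ _ mx my; exists q; split=> //.
    by apply/allP => z /(allP aq) /eqP -> /=; apply/eqP.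
  move=> /andP[gk pp] lp /andP[/eqP ku ap].
  have [x' [y' [mx' my' xy']]] := edg _ _ gk.
  have [q [pq lq aq]] := con _ _ _ mx mx'.
  have [s [ps ls as_]] := IH k y' my' ku pp lp ap.
  exists (q ++ y' :: s); rewrite cat_path pq lq /= xy' ps last_cat /= ls.
  split=> //; rewrite all_cat /= my' /= ku eqxx as_ /= andbT.
  by apply/allP => z /(allP aq) /eqP -> /=; apply/eqP.
- move=> u v /edg' [g [h [gu hv gh]]].
  have [x [y [xg yh xy]]] := edg _ _ gh.
  by exists x, y; rewrite xg yh.
Qed.

Definition grid4 (p q : nat * nat) : bool :=
  (p.1 == q.1) && ((p.2 == q.2.+1) || (q.2 == p.2.+1))
  || (p.2 == q.2) && ((p.1 == q.1.+1) || (q.1 == p.1.+1)).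

Definition grid_minor (G : sgraph) : Prop :=
  exists m : nat * nat -> option G, exists N : nat,
    minor_model grid4 m /\
    forall p, m p -> (0 < p.1 < N) && (0 < p.2 < N).

Lemma grid_minor_trans (G H : sgraph) (m : G -> option H) :
  grid_minor G -> minor_model (@sedge G) m -> grid_minor H.
Proof.
move=> [f [N [fm fN]]] mm; exists (fun x => obind m (f x)), N; split.
  exact: minor_model_trans.
by move=> p; case fp: (f p) => // _; apply: fN; rewrite fp.
Qed.

Lemma walk_crossing (T : Type) (A B : pred T) (x : T) (s : seq T) :
  A x -> B (last x s) -> ~~ B x ->
  (forall y, A y -> ~~ B y) ->
  exists s1 a q b s2, [/\ x :: s = s1 ++ a :: q ++ b :: s2, A a, B b
    & all (fun y => ~~ A y && ~~ B y) q].
Proof.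
move=> + + + AB; have [n] := ubnP (size s); elim: n s x => // n IH s x.
rewrite ltnS => sn Ax Bl nBx.
have [hA|nA] := boolP (has A s).
  move: sn Bl; case/split_find: hA => z s1 s2 Az _ sn.
  rewrite last_cat last_rcons => Bl.
  have s2n : size s2 < n.
    by apply: leq_trans sn; rewrite size_cat size_rcons addSn ltnS leq_addl.
  have [s1' [a [q [b [s2' [E Aa Bb aq]]]]]] := IH s2 z s2n Az Bl (AB _ Az).
  exists (x :: s1 ++ s1'), a, q, b, s2'; split=> //.
  by rewrite /= -catA -E cat_rcons.
have hB : has B s.
  case: (s) Bl => [|y s'] /= Bl; first by rewrite Bl in nBx.
  by apply/orP; elim: s' y Bl => [|z s' IHs] y /=; [left|move/IHs => /orP]; auto.
move: nA {sn Bl}; case/split_find: hB => b q s2 Bb nB nA.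
exists [::], x, q, b, s2; split=> //; first by rewrite cat_rcons.
move: nA nB; rewrite has_cat has_rcons negb_or negb_or -!all_predC => /andP[/andP[_ +] _].
elim: q => //= y q IHq /andP[-> aA] /andP[-> aB] /=; exact: IHq.
Qed.

Lemma path_unstutter (T : eqType) (r : rel T) (a : pred T) (x : T) (s : seq T) :
  path (fun p q => r p q || (p == q)) x s -> all a s ->
  exists q, [/\ path r x q, last x q = last x s & all a q].
Proof.
elim: s x => [|y s IH] x /=; first by exists [::].
move=> /andP[/orP[xy|/eqP->] ps] /andP[ay as_]; have [q [pq lq aq]] := IH _ ps as_.
  by exists (y :: q); rewrite /= xy pq ay aq.
by exists q.
Qed.

Lemma path_rcons_sym (T : eqType) (r : rel T) (a : pred T) (x y : T) (s : seq T) :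
  symmetric r -> path r x s -> last x s = y -> a x -> all a s ->
  exists q, [/\ path r y q, last y q = x & all a q].
Proof.
move=> rS; elim: s x => [|z s IH] x /=; first by move=> _ -> ax _; exists [::].
move=> /andP[xz ps] ls ax /andP[az as_].
have [q [pq lq aq]] := IH _ ps ls az as_.
exists (rcons q x); rewrite rcons_path pq lq last_rcons all_rcons ax aq /=.
by rewrite rS xz.
Qed.

Lemma grid4_sym : symmetric grid4.
Proof.
move=> [a b] [c d]; rewrite /grid4 /= [a == c]eq_sym [b == d]eq_sym.
by rewrite [(b == d.+1) || _]orbC [(a == c.+1) || _]orbC.
Qed.

Definition in_square (rho : nat) (c p : nat * nat) : bool :=
  [&& p.1 <= c.1 + rho, c.1 <= p.1 + rho, p.2 <= c.2 + rho & c.2 <= p.2 + rho].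

Lemma in_square_center rho c : in_square rho c c.
Proof. by rewrite /in_square !leq_addr. Qed.

Lemma in_square_connected rho (c p : nat * nat) : in_square rho c p ->
  exists s, [/\ path grid4 p s, last p s = c & all (in_square rho c) s].
Proof.
have [n] := ubnP ((p.1 - c.1) + (c.1 - p.1) + (p.2 - c.2) + (c.2 - p.2)).
elim: n p => // n IH [a b] /=; case: c IH => [x y] IH /=; rewrite ltnS => dn.
rewrite /in_square /= => /and4P[h1 h2 h3 h4].
have step a' b' : grid4 (a, b) (a', b') ->
    (a' - x) + (x - a') + (b' - y) + (y - b') < n ->
    in_square rho (x, y) (a', b') ->
    exists s, [/\ path grid4 (a, b) s, last (a, b) s = (x, y)
      & all (in_square rho (x, y)) s].
  move=> g d i; have [s [ps ls as_]] := IH (a', b') d i.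
  by exists ((a', b') :: s); rewrite /= g ps i.
case: (ltngtP a x) => [ax|xa|ax].
- apply: (step a.+1 b); rewrite /grid4 /in_square /=; lia.
- apply: (step a.-1 b); rewrite /grid4 /in_square /=; lia.
case: (ltngtP b y) => [bY|yb|bY].
- apply: (step a b.+1); rewrite /grid4 /in_square /=; lia.
- apply: (step a b.-1); rewrite /grid4 /in_square /=; lia.
by exists [::]; rewrite /= ax bY.
Qed.

Section DiscreteDrawing.
Variables (G : sgraph) (c : G -> nat * nat) (rho N : nat).
Variable chain : G -> G -> seq (nat * nat).
Let near w := in_square rho (c w).
Let dart (e : G * G) := sedge e.1 e.2 && (enum_rank e.1 < enum_rank e.2).
Let step (p q : nat * nat) := grid4 p q || (p == q).

Hypothesis square_disjoint : forall w w' p, near w p -> near w' p -> w = w'.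
Hypothesis square_box : forall w p, near w p -> (0 < p.1 < N) && (0 < p.2 < N).
Hypothesis chain_box : forall u v p, dart (u, v) -> p \in chain u v ->
  (0 < p.1 < N) && (0 < p.2 < N).
Hypothesis chain_path : forall u v, dart (u, v) ->
  path step (c u) (chain u v) /\ last (c u) (chain u v) = c v.
Hypothesis chain_near : forall u v w p, dart (u, v) -> p \in chain u v ->
  near w p -> w = u \/ w = v.
Hypothesis chain_disjoint : forall u v x y p, dart (u, v) -> dart (x, y) ->
  p \in chain u v -> p \in chain x y -> ~~ near u p -> ~~ near v p ->
  (u, v) = (x, y).

Lemma chain_segment : forall e : G * G, exists q : seq (nat * nat), dart e ->
  [/\ {subset q <= chain e.1 e.2},
      all (fun p => ~~ near e.1 p && ~~ near e.2 p) q
    & exists a b, [/\ near e.1 a, near e.2 b & path step a (rcons q b)]].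
Proof.
move=> [u v]; case: (boolP (dart (u, v))) => [d|_]; last by exists [::].
have [ps ls] := chain_path d.
have uv y : near u y -> ~~ near v y.
  move=> uy; apply/negP => vy; have E := square_disjoint uy vy.
  by move: d; rewrite /dart /= E sedge_irrefl.
have uu : near u (c u) by exact: in_square_center.
have vl : near v (last (c u) (chain u v)) by rewrite ls; exact: in_square_center.
have [s1 [a [q [b [s2 [E ua vb aq]]]]]] := walk_crossing uu vl (uv _ uu) uv.
have sub : {subset q <= chain u v}.
  case: s1 E => [|z s1] /= [_ ->] p pq; rewrite ?mem_cat ?pq //.
  by rewrite !(mem_cat, inE) pq !orbT.
exists q => _; split=> //; exists a, b; split=> //.
have : sorted step (s1 ++ a :: q ++ b :: s2) by rewrite -E.
move=> /cat_sorted2 [_]; rewrite -cat_rcons.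
by move=> /(@cat_sorted2 _ _ (a :: rcons q b)) [].
Qed.

Lemma discrete_drawing_grid_minor : grid_minor G.
Proof.
have [seg segP] := boolp.choice chain_segment.
pose inseg (e : G * G) p := dart e && (p \in seg e).
pose m p : option G :=
  if [pick w | near w p] is Some w then Some w
  else if [pick e | inseg e p] is Some e then Some e.1 else None.
have m_near w p : near w p -> m p = Some w.
  rewrite /m => wp; case: pickP => [w' w'p|/(_ w)]; last by rewrite wp.
  by rewrite (square_disjoint wp w'p).
have m_seg e p : inseg e p -> m p = Some e.1.
  move=> ep; move: (ep) => /andP[de pe]; have [sub aq _] := segP _ de.
  have /andP[ne1 ne2] := allP aq _ pe.
  rewrite /m; case: pickP => [w wp|_].
    by case: e de {ep pe aq sub} ne1 ne2 (chain_near de (sub _ pe) wp) => u v _ /= + + [] E; rewrite -?E wp.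
  case: pickP => [e' /andP[de' pe']|/(_ e)]; last by rewrite ep.
  have [sub' _ _] := segP _ de'.
  case: e e' {ep} de de' pe pe' sub sub' ne1 ne2 aq => u v [x y] de de' pe pe' sub sub' ne1 ne2 _.
  by case: (chain_disjoint de de' (sub _ pe) (sub' _ pe') ne1 ne2) => ->.
have m_inv u p : m p = Some u -> near u p \/ exists2 e, inseg e p & e.1 = u.
  rewrite /m; case: pickP => [w wp [<-]|_]; first by left.
  by case: pickP => [e ep [<-]|//]; right; exists e.
have to_center u p : m p = Some u ->
    exists s, [/\ path grid4 p s, last p s = c u & all (fun z => m z == Some u) s].
  have from_near z : near u z -> exists s, [/\ path grid4 z s, last z s = c u & all (fun z => m z == Some u) s].
    move=> /in_square_connected [s [ps ls as_]]; exists s; split=> //.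
    by apply/allP => y /(allP as_) /m_near ->.
  move=> /m_inv [|[e /andP[de pe] eu]]; first exact: from_near.
  have [_ _ [a [b [ea _ ps]]]] := segP _ de.
  have sm : all (fun z => m z == Some u) (seg e).
    by apply/allP => z ze; rewrite (m_seg e) ?eu // /inseg de.
  case/splitPr: pe ps sm => q1 q2; rewrite rcons_cat rcons_cons -cat_rcons cat_path.
  move=> /andP[ps _]; rewrite -cat_rcons all_cat => /andP[as_ _].
  have [s1 [ps1 ls1 as1]] := path_unstutter ps as_.
  rewrite last_rcons in ls1; rewrite eu in ea.
  have ma : m a == Some u by rewrite (m_near u).
  have [s2 [ps2 ls2 as2]] := path_rcons_sym grid4_sym ps1 ls1 ma as1.
  have [s3 [ps3 ls3 as3]] := from_near _ ea.
  by exists (s2 ++ s3); rewrite cat_path ps2 ls2 ps3 last_cat ls2 ls3 all_cat as2 as3.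
have dart_adj u v : dart (u, v) -> exists x y, [/\ m x = Some u, m y = Some v & grid4 x y].
  move=> de; have [_ _ [a [b [/= ea eb ps]]]] := segP _ de.
  exists (last a (seg (u, v))), b.
  have mb := m_near _ _ eb.
  have mz : m (last a (seg (u, v))) = Some u.
    have := mem_last a (seg (u, v)); rewrite inE => /orP[/eqP->|ze].
      exact: m_near.
    by rewrite (m_seg (u, v)) // /inseg de.
  split=> //; move: ps; rewrite rcons_path => /andP[_ /orP[//|/eqP zb]].
  by move: mb; rewrite -zb mz => -[E]; move: de; rewrite /dart /= E sedge_irrefl.
exists m, N; split; last first.
  move=> p; case mp: (m p) => [u|//] _.
  have [/square_box//|[[x y] /andP[de pe] _]] := m_inv _ _ mp.
  by have [sub _ _] := segP _ de; exact: (chain_box de (sub _ pe)).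
split.
- by move=> u; exists (c u); apply: m_near; exact: in_square_center.
- move=> u x y mx my; have [s [ps ls as_]] := to_center _ _ mx.
  have [s' [ps' ls' as']] := to_center _ _ my.
  have my' : m y == Some u by rewrite my.
  have [s2 [ps2 ls2 as2]] := path_rcons_sym grid4_sym ps' ls' my' as'.
  by exists (s ++ s2); rewrite cat_path ps ls ps2 last_cat ls ls2 all_cat as_ as2.
- move=> u v uv; have [|vu] := ltnP (enum_rank u) (enum_rank v).
    by move=> lt; apply: dart_adj; rewrite /dart /= uv.
  have [|x [y [mx my xy]]] := @dart_adj v u.
    rewrite /dart /= sedge_sym uv /= ltn_neqAle vu andbT.
    apply/eqP => /val_inj/enum_rank_inj E; move: uv; rewrite E sedge_irrefl //.
  by exists y, x; rewrite grid4_sym.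
Qed.
End DiscreteDrawing.

(** * Discretizing planar drawings *)

Section PlaneTopology.
Variable R : realType.
Local Open Scope ring_scope.
Local Open Scope classical_set_scope.

Lemma compact_positive_lower_bound (T : topologicalType) (C : set T) (f : T -> R) :
  compact C -> continuous f -> (forall x, C x -> 0 < f x) ->
  exists2 e, 0 < e & forall x, C x -> e <= f x.
Proof.
move=> cC cf f0; have [->|ne] := eqVneq C set0; first by exists 1.
have [||c] := @compact_EVT_min T R f C _ cC; first exact/set0P.
  exact: continuous_subspaceT.
by rewrite inE => Cc fc; exists (f c); [exact: f0|move=> x Cx; apply: fc; rewrite inE].
Qed.

Lemma finite_lower_bound (I : finType) (P : I -> R -> Prop) :
  (forall i e e', 0 < e' <= e -> P i e -> P i e') ->
  (forall i, exists2 e, 0 < e & P i e) ->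
  exists2 e, 0 < e & forall i, P i e.
Proof.
move=> dP eP.
have /boolp.choice [f fP] : forall i, exists e, 0 < e /\ P i e.
  by move=> i; have [e] := eP i; exists e.
exists (\big[Order.min/1]_i f i).
  by apply: lt_bigmin => // i _; case: (fP i).
move=> i; have [fi Pi] := fP i; apply: dP Pi; rewrite bigmin_le andbT.
by apply: lt_bigmin => // j _; case: (fP j).
Qed.

Lemma arc_parametrization (a b : R * R) (A : set (R * R)) : is_arc a b A ->
  exists g : R -> R * R,
    [/\ continuous g, g 0 = a, g 1 = b & forall s, 0 <= s <= 1 -> A (g s)].
Proof.
move=> [g [cg _ g0 g1 ->]].
pose k (s : R) : R := Num.max 0 (Num.min s 1).
have k01 s : 0 <= k s <= 1.
  by rewrite /k le_max lexx /= ge_max ler01 /= ge_min lexx orbT.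
have kid s : 0 <= s <= 1 -> k s = s.
  by move=> /andP[s0 s1]; rewrite /k min_l // max_r.
have ck : continuous k.
  move=> s; apply: (@continuous_max R R (cst 0) (fun s => Num.min s 1)).
    exact: cst_continuous.
  by apply: (@continuous_min R R id (cst 1)); [exact: id|exact: cst_continuous].
exists (g \o k); split=> //=.
- move=> s; move/subspace_continuousP: cg => /(_ (k s)) cg.
  have : (`[0, 1] : set R) (k s) by rewrite /= in_itv /= k01.
  move=> /cg {}cg V nV.
  have H : nbhs s (fun x => (`[0, 1] : set R) (k x) -> V (g (k x))) := ck s _ (cg V nV).
  by apply: (@filterS _ (nbhs s) _ _ _ _ H) => x; apply; rewrite /= in_itv; exact: (k01 x).
- by rewrite kid // lexx ler01.
- by rewrite kid // lexx ler01.
- by move=> s s01; exists s; [rewrite /= in_itv /= s01|rewrite kid].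
Qed.

Lemma square01_compact : compact (`[0, 1] `*` `[0, 1] : set (R * R)).
Proof. by apply: compact_setX; exact: segment_compact. Qed.

Lemma curve_uniformly_continuous (g : R -> R * R) : continuous g ->
  forall e, 0 < e -> exists2 d, 0 < d & forall s s', 0 <= s <= 1 -> 0 <= s' <= 1 ->
    `|s - s'| < d -> `|g s - g s'| < e.
Proof.
move=> cg e e0.
pose C : set (R * R) := [set p | e <= `|g p.1 - g p.2|] `&` (`[0, 1] `*` `[0, 1]).
have cd : continuous (fun p : R * R => `|g p.1 - g p.2|).
  move=> p; apply: cvg_norm; apply: cvgB.
    by apply: (@continuous_comp _ _ _ fst g); [exact: cvg_fst|exact: cg].
  by apply: (@continuous_comp _ _ _ snd g); [exact: cvg_snd|exact: cg].
have cC : compact C.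
  rewrite /C setIC; apply: compact_closedI; first exact: square01_compact.
  by apply: (@closed_comp _ _ _ [set x | e <= x]); [move=> p _; exact: cd|exact: closed_ge].
have [d d0 dP] : exists2 d, 0 < d & forall p, C p -> d <= `|p.1 - p.2|.
  apply: compact_positive_lower_bound => //.
    by move=> p; apply: cvg_norm; apply: cvgB; [exact: cvg_fst|exact: cvg_snd].
  move=> [s s'] [/= + _]; rewrite normr_gt0 subr_eq0; apply: contraTneq => ->.
  by rewrite subrr normr0 -ltNge.
exists d => // s s' s01 s'01 sd; rewrite ltNge; apply/negP => es.
have : C (s, s') by split=> //=; rewrite /= !in_itv /= s01 s'01.
by move=> /dP /=; rewrite leNgt sd.
Qed.
End PlaneTopology.

Section PlanarGrid.
Variables (R : realType) (G : sgraph).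
Local Open Scope ring_scope.
Local Open Scope classical_set_scope.

Let dart (e : G * G) := sedge e.1 e.2 && (enum_rank e.1 < enum_rank e.2)%N.

Lemma planar_curves : planar R G -> exists (pt : G -> R * R) (g : G * G -> R -> R * R),
  [/\ injective pt,
      forall e, dart e -> [/\ continuous (g e), g e 0 = pt e.1 & g e 1 = pt e.2],
      forall e w s, dart e -> 0 <= s <= 1 -> g e s = pt w -> w = e.1 \/ w = e.2
    & forall e e' s s', dart e -> dart e' -> e != e' -> 0 <= s <= 1 ->
        0 <= s' <= 1 -> g e s = g e' s' -> g e s = pt e.1 \/ g e s = pt e.2].
Proof.
move=> [pt [arc [ipt arcP arcV arcE]]].
have dset (e e' : G * G) : dart e -> dart e' -> e != e' ->
    [set e.1; e.2]%SET != [set e'.1; e'.2]%SET.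
  case: e e' => [u v] [x y]; rewrite /dart /= => /andP[_ uv] /andP[_ xy].
  apply: contraNneq => E.
  have /set2P ux : u \in [set x; y]%SET by rewrite -E set21.
  have /set2P vx : v \in [set x; y]%SET by rewrite -E set22.
  by case: ux vx uv xy => -> [] -> //; rewrite ?ltnn // => /ltn_trans /[apply]; rewrite ltnn.
have /boolp.choice [g gP] (e : G * G) : exists g : R -> R * R, dart e ->
    [/\ continuous g, g 0 = pt e.1, g 1 = pt e.2
      & forall s, 0 <= s <= 1 -> arc [set e.1; e.2]%SET (g s)].
  have [de|] := boolP (dart e); last by exists (fun=> pt e.1).
  by case/andP: de => /arcP /arc_parametrization [g gP] _; exists g.
exists pt, g; split=> //.
- by move=> e /gP [].
- move=> e w s de s01 E; have [_ _ _ /(_ s s01) A] := gP _ de.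
  apply: boolp.contrapT => N.
  have [/eqP w1 /eqP w2] : w <> e.1 /\ w <> e.2 by split=> ?; apply: N; [left|right].
  case/andP: de => de _; apply: (arcV _ _ w de); split; first by rewrite -E.
  by move=> [/ipt/eqP|/ipt/eqP]; rewrite ?(negPf w1) ?(negPf w2).
- move=> e e' s s' de de' ee s01 s'01 E.
  have [_ _ _ /(_ s s01) A] := gP _ de; have [_ _ _ /(_ s' s'01) A'] := gP _ de'.
  apply: boolp.contrapT => N.
  have := arcE _ _ _ _ (proj1 (andP de)) (proj1 (andP de')) (dset _ _ de de' ee).
  rewrite -subset0 => /(_ (g e s)); apply; split; last by rewrite E.
  by split=> // -[?|?]; apply: N; auto.
Qed.

Lemma planar_separated_curves : planar R G ->
  exists (pt : G -> R * R) (g : G * G -> R -> R * R) (r d : R),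
  [/\ 0 < r, 0 < d,
      forall e, dart e -> [/\ continuous (g e), g e 0 = pt e.1 & g e 1 = pt e.2]
    & [/\ forall u w, u != w -> 5 * r <= `|pt u - pt w|,
      forall e w s, dart e -> 0 <= s <= 1 -> w != e.1 -> w != e.2 ->
        5 * r <= `|g e s - pt w|
    & forall e e' s s', dart e -> dart e' -> e != e' -> 0 <= s <= 1 ->
        0 <= s' <= 1 -> r <= `|g e s - pt e.1| -> r <= `|g e s - pt e.2| ->
        d <= `|g e s - g e' s'|]].
Proof.
move=> /planar_curves [pt [g [ipt gP gV gE]]].
have [r1 r10 r1P] : exists2 r, 0 < r & forall i : G * G,
    i.1 != i.2 -> 5 * r <= `|pt i.1 - pt i.2|.
  apply: finite_lower_bound => [i e e' /andP[_ ee] H /H|i]; first by apply: le_trans; lra.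
  have [->|ne] := eqVneq i.1 i.2; first by exists 1.
  exists (`|pt i.1 - pt i.2| / 5).
    by rewrite divr_gt0 // normr_gt0 subr_eq0 (inj_eq ipt).
  by move=> _; lra.
have [r2 r20 r2P] : exists2 r, 0 < r & forall i : (G * G) * G, forall s,
    dart i.1 -> 0 <= s <= 1 -> i.2 != i.1.1 -> i.2 != i.1.2 -> 5 * r <= `|g i.1 s - pt i.2|.
  apply: finite_lower_bound => [i e e' /andP[_ ee] H s h1 h2 h3 h4|[e w] /=].
    by apply: le_trans (H s h1 h2 h3 h4); lra.
  have [/andP[/andP[de w1] w2]|H] := boolP (dart e && (w != e.1) && (w != e.2)); last first.
    by exists 1 => // s h1 h2 h3 h4; move: H; rewrite h1 h3 h4.
  have [cg g0 g1] := gP _ de.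
  have [|||c c0 cP] := @compact_positive_lower_bound R R `[0, 1] (fun s => `|g e s - pt w|).
  - exact: segment_compact.
  - move=> s; apply: cvg_norm; apply: cvgB; [exact: cg|exact: cvg_cst].
  - move=> s; rewrite /= in_itv /= normr_gt0 subr_eq0 => s01; apply/eqP => E.
    by have [/eqP|/eqP] := gV _ _ _ de s01 E; rewrite ?(negPf w1) ?(negPf w2).
  exists (c / 5); first by rewrite divr_gt0.
  move=> s _ s01 _ _; have : c <= `|g e s - pt w| by apply: cP; rewrite /= in_itv.
  lra.
have [r [r0 rr1 rr2]] : exists r, [/\ 0 < r, r <= r1 & r <= r2].
  by exists (Num.min r1 r2); rewrite lt_min r10 !ge_min !lexx orbT.
have [d d0 dP] : exists2 d, 0 < d & forall i : (G * G) * (G * G), forall s s',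
    dart i.1 -> dart i.2 -> i.1 != i.2 -> 0 <= s <= 1 ->
        0 <= s' <= 1 -> r <= `|g i.1 s - pt i.1.1| -> r <= `|g i.1 s - pt i.1.2| ->
        d <= `|g i.1 s - g i.2 s'|.
  apply: finite_lower_bound => [i e e' /andP[_ ee] H s s' h1 h2 h3 h4 h5 h6 h7|[e e'] /=].
    by apply: le_trans (H s s' h1 h2 h3 h4 h5 h6 h7); lra.
  have [/andP[/andP[de de'] ee]|H] := boolP (dart e && dart e' && (e != e')); last first.
    by exists 1 => // s s' h1 h2 h3; move: H; rewrite h1 h2 h3.
  have [cg g0 g1] := gP _ de; have [cg' g0' g1'] := gP _ de'.
  have c1 w : continuous (fun p : R * R => `|g e p.1 - pt w|).
    move=> p; apply: cvg_norm; apply: cvgB; last exact: cvg_cst.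
    by apply: (@continuous_comp _ _ _ fst (g e)); [exact: cvg_fst|exact: cg].
  pose A w : set (R * R) := [set p | r <= `|g e p.1 - pt w|].
  have cA w : closed (A w).
    by apply: (@closed_comp _ _ _ [set x | r <= x]); [move=> p _; exact: c1|exact: closed_ge].
  pose C := (`[0, 1] `*` `[0, 1] : set (R * R)) `&` (A e.1 `&` A e.2).
  have [|||c c0 cP] := @compact_positive_lower_bound R _ C (fun p => `|g e p.1 - g e' p.2|).
  - by apply: compact_closedI; [exact: square01_compact|exact: closedI].
  - move=> p; apply: cvg_norm; apply: cvgB.
      by apply: (@continuous_comp _ _ _ fst (g e)); [exact: cvg_fst|exact: cg].
    by apply: (@continuous_comp _ _ _ snd (g e')); [exact: cvg_snd|exact: cg'].
  - move=> [s s'] [/= [] /=]; rewrite !in_itv /= => s01 s'01 [A1 A2].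
    rewrite normr_gt0 subr_eq0; apply/eqP => E.
    move: A1 A2; rewrite /A /=.
    by have [->|->] := gE _ _ _ _ de de' ee s01 s'01 E;
      rewrite subrr normr0 => h1 h2; move: (h1) (h2); rewrite !leNgt r0.
  exists c => // s s' _ _ _ s01 s'01 h1 h2; apply: (cP (s, s')).
  by split; [split; rewrite /= in_itv|split].
exists pt, g, r, d; split=> //; split.
- by move=> u w uw; apply: le_trans (r1P (u, w) uw); rewrite ler_pM2l /= ?ltr0n.
- move=> e w s h1 h2 h3 h4; apply: le_trans (r2P (e, w) s h1 h2 h3 h4).
  by rewrite ler_pM2l // ltr0n.
- by move=> e e' s s'; exact: (dP (e, e')).
Qed.
End PlanarGrid.

Section PlanarSamples.
Variables (R : realType) (G : sgraph).
Local Open Scope ring_scope.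

Let dart (e : G * G) := sedge e.1 e.2 && (enum_rank e.1 < enum_rank e.2)%N.

Lemma planar_samples : planar R G ->
  exists (P : G -> R * R) (z : G * G -> nat -> R * R) (K : nat) (r B : R),
  [/\ 10 <= r,
      forall e, dart e -> z e 0%N = P e.1 /\ z e K = P e.2,
      forall e k, dart e -> (k < K)%N -> `|z e k - z e k.+1| < 1,
      forall u w, u != w -> 5 * r <= `|P u - P w|
    & [/\ forall e w k, dart e -> (k <= K)%N -> w != e.1 -> w != e.2 ->
        5 * r <= `|z e k - P w|,
      forall e e' k k', dart e -> dart e' -> e != e' -> (k <= K)%N -> (k' <= K)%N ->
        r <= `|z e k - P e.1| -> r <= `|z e k - P e.2| -> 10 <= `|z e k - z e' k'|,
      forall w, (r + 10 <= (P w).1 <= B) && (r + 10 <= (P w).2 <= B)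
    & forall e k, (k <= K)%N ->
        (r + 10 <= (z e k).1 <= B) && (r + 10 <= (z e k).2 <= B)]].
Proof.
move=> /planar_separated_curves [pt [g [r [d [r0 d0 gP [rP rV dP]]]]]].
have [h [h0 hr hd]] : exists h, [/\ 0 < h, 10 * h <= r & 10 * h <= d].
  exists (Num.min r d / 10); rewrite divr_gt0 ?lt_min ?r0 ?d0 ?ltr0n //.
  have := ge_min r r d; have := ge_min d r d; rewrite !lexx orbT /= => h1 h2.
  by split=> //; lra.
have [c c0 cP] : exists2 c, 0 < c & forall e s s', dart e -> 0 <= s <= 1 -> 0 <= s' <= 1 ->
    `|s - s'| < c -> `|g e s - g e s'| < h.
  apply: finite_lower_bound => [e c c' /andP[_ cc] H s s' h1 h2 h3 h4|e].
    by apply: H => //; apply: lt_le_trans cc.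
  have [de|] := boolP (dart e); last by exists 1.
  have [cg _ _] := gP _ de.
  have [c c0 cP] := curve_uniformly_continuous cg h0.
  by exists c => // s s' _; exact: cP.
pose K := (Num.truncn c^-1).+1.
have K0 : 0 < K%:R :> R by rewrite ltr0n.
have Kc : K%:R^-1 < c.
  rewrite -[c]invrK ltf_pV2 ?posrE ?invr_gt0 //.
  have /andP[_] : (Num.truncn c^-1)%:R <= c^-1 < K%:R by apply: truncn_itv; rewrite invr_ge0 ltW.
  by [].
have k01 k : (k <= K)%N -> 0 <= (k%:R / K%:R : R) <= 1.
  by move=> kK; rewrite divr_ge0 //= ler_pdivrMr // mul1r ler_nat.
pose x (i : G + (G * G) * 'I_K.+1) : R * R :=
  match i with inl w => pt w | inr p => g p.1 (p.2%:R / K%:R) end.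
have [m m0 mP] : exists2 m, 0 < m & forall i, `|x i| * m <= 1.
  apply: finite_lower_bound => [i e e' /andP[e'0 ee]|i].
    by apply: le_trans; rewrite ler_wpM2l.
  exists (`|x i| + 1)^-1; first by rewrite invr_gt0 ltr_wpDl.
  by rewrite ler_pdivrMr ?ltr_wpDl // mul1r lerDl.
have {mP} mP i : (- m^-1 <= (x i).1 <= m^-1) && (- m^-1 <= (x i).2 <= m^-1).
  have : `|x i| <= m^-1 by rewrite -[m^-1]mul1r ler_pdivlMr.
  by rewrite prod_normE ge_max !ler_norml.
pose S := m^-1 + h * (r / h + 10).
pose T (p : R * R) : R * R := ((p.1 + S) / h, (p.2 + S) / h).
have TB p q : `|T p - T q| = `|p - q| / h.
  have E a b : (a + S) / h - (b + S) / h = (a - b) / h by rewrite -mulrBl; congr (_ / _); ring.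
  rewrite !prod_normE /= !E !normrM [`|h^-1|]gtr0_norm ?invr_gt0 //.
  by rewrite maxr_pMl // ltW // invr_gt0.
have Tbd i : (r / h + 10 <= (T (x i)).1 <= (m^-1 + S) / h) &&
    (r / h + 10 <= (T (x i)).2 <= (m^-1 + S) / h).
  have /andP[/andP[a1 a2] /andP[b1 b2]] := mP i.
  rewrite /T /= !ler_pM2r ?invr_gt0 // !ler_pdivlMr //.
  by rewrite /S !lerD2r a2 b2 !andbT; apply/andP; split; lra.
exists (T \o pt), (fun e k => T (g e (k%:R / K%:R))), K, (r / h), ((m^-1 + S) / h).
split.
- by rewrite ler_pdivlMr.
- by move=> e /gP [_ g0 g1]; rewrite /= mul0r g0 divff ?g1 // gt_eqF.
- move=> e k de kK; rewrite TB ltr_pdivrMr // mul1r; apply: cP => //.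
  + by apply: k01; exact: ltnW.
  + exact: k01.
  + by rewrite distrC -mulrBl -natrB // subSnn mul1r ger0_norm // invr_ge0 ltW.
- by move=> u w uw /=; rewrite TB mulrA ler_pM2r ?invr_gt0 // rP.
split.
- by move=> e w k de kK w1 w2 /=; rewrite TB mulrA ler_pM2r ?invr_gt0 // rV // k01.
- move=> e e' k k' de de' ee kK k'K; rewrite /= !TB !ler_pM2r ?invr_gt0 // => h1 h2.
  by rewrite ler_pdivlMr //; apply: le_trans hd (dP _ _ _ _ de de' ee _ _ h1 h2); exact: k01.
- by move=> w; exact: (Tbd (inl w)).
- by move=> e k kK; have := Tbd (inr (e, inord k)); rewrite /x /= inordK.
Qed.
End PlanarSamples.

Section PlanarGridMinor.
Variables (R : realType) (G : sgraph).
Local Open Scope ring_scope.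

Let dart (e : G * G) := sedge e.1 e.2 && (enum_rank e.1 < enum_rank e.2)%N.

Lemma trunc_bounds (x : R) : 0 <= x -> (Num.truncn x)%:R <= x /\ x < (Num.truncn x)%:R + 1.
Proof. by move=> /truncn_itv /andP[h1 h2]; rewrite natr1. Qed.

Let close (p : nat * nat) (z : R * R) : Prop :=
  [/\ p.1%:R <= z.1 + 2, z.1 <= p.1%:R + 2, p.2%:R <= z.2 + 2 & z.2 <= p.2%:R + 2].

Let cell (z : R * R) : nat * nat := (Num.truncn z.1, Num.truncn z.2).

Lemma in_squareE rho c p : in_square rho c p =
  [&& p.1%:R <= c.1%:R + rho%:R :> R, c.1%:R <= p.1%:R + rho%:R :> R,
      p.2%:R <= c.2%:R + rho%:R :> R & c.2%:R <= p.2%:R + rho%:R :> R].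
Proof. by rewrite -!natrD !ler_nat. Qed.

Lemma close_in_square rho p z w : 0 <= w.1 -> 0 <= w.2 -> close p z ->
  in_square rho (cell w) p -> `|z - w| <= rho%:R + 3.
Proof.
move=> w1 w2 [h1 h2 h3 h4]; rewrite in_squareE => /and4P[/= i1 i2 i3 i4].
have [a1 a2] := trunc_bounds w1; have [b1 b2] := trunc_bounds w2.
by rewrite prod_normE ge_max !ler_norml /=; apply/andP; split; apply/andP; split; lra.
Qed.

Lemma close_notin_square rho p z w : 0 <= w.1 -> 0 <= w.2 -> close p z ->
  ~~ in_square rho (cell w) p -> rho%:R - 3 <= `|z - w|.
Proof.
move=> w1 w2 [h1 h2 h3 h4] + .
have [a1 a2] := trunc_bounds w1; have [b1 b2] := trunc_bounds w2.
apply: contraNT; rewrite -ltNge prod_normE gt_max !ltr_norml /= in_squareE.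
by move=> /andP[/andP[c1 c2] /andP[d1 d2]]; apply/and4P; split=> /=; lra.
Qed.

Lemma squares_meet rho p w w' : 0 <= w.1 -> 0 <= w.2 -> 0 <= w'.1 -> 0 <= w'.2 ->
  in_square rho (cell w) p -> in_square rho (cell w') p -> `|w - w'| < 2 * rho%:R + 2.
Proof.
move=> w1 w2 w'1 w'2.
rewrite !in_squareE /= => /and4P[i1 i2 i3 i4] /and4P[j1 j2 j3 j4].
have [a1 a2] := trunc_bounds w1; have [b1 b2] := trunc_bounds w2.
have [c1 c2] := trunc_bounds w'1; have [d1 d2] := trunc_bounds w'2.
by rewrite prod_normE gt_max !ltr_norml /=; apply/andP; split; apply/andP; split; lra.
Qed.

Lemma close_close p z z' : close p z -> close p z' -> `|z - z'| <= 4.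
Proof.
move=> [h1 h2 h3 h4] [i1 i2 i3 i4].
by rewrite prod_normE ge_max !ler_norml /=; apply/andP; split; apply/andP; split; lra.
Qed.

Lemma truncn_step (x y : R) : 0 <= x -> 0 <= y -> x < y + 1 ->
  (Num.truncn x <= (Num.truncn y).+1)%N.
Proof.
move=> x0 y0 xy; have [a1 a2] := trunc_bounds x0; have [b1 b2] := trunc_bounds y0.
by rewrite -ltnS -(ltr_nat R) -addn2 natrD; lra.
Qed.

Lemma corner_step (a a' b b' : nat) :
  (a <= a'.+1)%N -> (a' <= a.+1)%N -> (b <= b'.+1)%N -> (b' <= b.+1)%N ->
  (grid4 (a, b) (a', b) || ((a, b) == (a', b)))
  && (grid4 (a', b) (a', b') || ((a', b) == (a', b'))).
Proof. rewrite /grid4 /= !xpair_eqE; lia. Qed.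

Lemma close_box rho p x (r B : R) : 0 <= r -> r + 10 <= x.1 <= B -> r + 10 <= x.2 <= B ->
  rho%:R <= r + 4 ->
  p.1%:R <= x.1 + rho%:R + 1 -> x.1 <= p.1%:R + rho%:R + 1 ->
  p.2%:R <= x.2 + rho%:R + 1 -> x.2 <= p.2%:R + rho%:R + 1 ->
  ((0 < p.1 < Num.truncn B + rho + 4) && (0 < p.2 < Num.truncn B + rho + 4))%N.
Proof.
move=> r0 /andP[a1 a2] /andP[b1 b2] rr h1 h2 h3 h4.
have B0 : 0 <= B by lra.
have [B1 B2] := trunc_bounds B0.
by rewrite -!(ltr_nat R) !natrD; apply/andP; split; apply/andP; split; lra.
Qed.

Lemma square_box rho p x (r B : R) : 0 <= r -> r + 10 <= x.1 <= B -> r + 10 <= x.2 <= B ->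
  rho%:R <= r + 4 -> in_square rho (cell x) p ->
  ((0 < p.1 < Num.truncn B + rho + 4) && (0 < p.2 < Num.truncn B + rho + 4))%N.
Proof.
move=> r0 xB yB rr; rewrite in_squareE /= => /and4P[i1 i2 i3 i4].
have x0 : 0 <= x.1 by case/andP: xB => xB _; lra.
have y0 : 0 <= x.2 by case/andP: yB => yB _; lra.
have [a1 a2] := trunc_bounds x0; have [b1 b2] := trunc_bounds y0.
by apply: (close_box r0 xB yB) => //; lra.
Qed.

Lemma corner_close (z z' : R * R) : 0 <= z.1 -> 0 <= z.2 -> 0 <= z'.1 -> 0 <= z'.2 ->
  `|z - z'| < 1 -> close (Num.truncn z'.1, Num.truncn z.2) z' /\ close (cell z') z'.
Proof.
move=> w1 w2 w'1 w'2; rewrite prod_normE gt_max !ltr_norml /=.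
move=> /andP[/andP[e1 e2] /andP[f1 f2]].
have [a1 a2] := trunc_bounds w1; have [b1 b2] := trunc_bounds w2.
have [c1 c2] := trunc_bounds w'1; have [d1 d2] := trunc_bounds w'2.
by split; split=> /=; lra.
Qed.

Lemma cell_step (z z' : R * R) : 0 <= z.1 -> 0 <= z.2 -> 0 <= z'.1 -> 0 <= z'.2 ->
  `|z - z'| < 1 ->
  path (fun p q => grid4 p q || (p == q)) (cell z)
    [:: (Num.truncn z'.1, Num.truncn z.2); cell z'].
Proof.
move=> w1 w2 w'1 w'2; rewrite prod_normE gt_max !ltr_norml /=.
move=> /andP[/andP[e1 e2] /andP[f1 f2]]; rewrite andbT.
by apply: corner_step; apply: truncn_step => //; lra.
Qed.

Lemma planar_grid_minor : planar R G -> grid_minor G.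
Proof.
move=> /planar_samples [P [z [K [r [B [r10 zend zstep Psep [zP zsep Pbd zbd]]]]]]].
have r0 : 0 <= r by lra.
pose rho := (Num.truncn r + 4)%N.
have [rho1 rho2] : rho%:R <= r + 4 /\ r + 3 < rho%:R.
  by have [rr1 rr2] := trunc_bounds r0; rewrite natrD; split; lra.
pose N := (Num.truncn B + rho + 4)%N.
pose cells e k := [:: (Num.truncn (z e k.+1).1, Num.truncn (z e k).2); cell (z e k.+1)].
pose chain u v := flatten [seq cells (u, v) k | k <- iota 0 K].
have zpos e k : (k <= K)%N -> 0 <= (z e k).1 /\ 0 <= (z e k).2.
  by move=> kK; have /andP[/andP[h1 _] /andP[h2 _]] := zbd e k kK; split; lra.
have Ppos w : 0 <= (P w).1 /\ 0 <= (P w).2.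
  by have /andP[/andP[h1 _] /andP[h2 _]] := Pbd w; split; lra.
have chainP u v p : dart (u, v) -> p \in chain u v ->
    exists k, (k <= K)%N /\ close p (z (u, v) k).
  move=> de /flatten_mapP[k]; rewrite mem_iota add0n => /andP[_ kK] pk; exists k.+1; split=> //.
  have [x0 y0] := zpos (u, v) k (ltnW kK); have [x1 y1] := zpos (u, v) k.+1 kK.
  have [c1 c2] := corner_close x0 y0 x1 y1 (zstep _ _ de kK).
  by move: pk; rewrite !inE => /orP[] /eqP ->.
apply: (@discrete_drawing_grid_minor G (cell \o P) rho N chain).
- move=> w w' p wp w'p; have [w1 w2] := Ppos w; have [w'1 w'2] := Ppos w'.
  have H := squares_meet w1 w2 w'1 w'2 wp w'p.
  apply/eqP; rewrite -[_ == _]negbK; apply/negP => /Psep; lra.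
- by move=> w p wp; have /andP[h1 h2] := Pbd w; exact: (square_box r0 h1 h2 rho1 wp).
- move=> u v p de /(chainP _ _ _ de) [k [kK [h1 h2 h3 h4]]].
  have /andP[c1 c2] := zbd (u, v) k kK.
  by apply: (close_box r0 c1 c2 rho1); lra.
- move=> u v de; rewrite /chain; have [z0 zK] := zend (u, v) de.
  rewrite -[(cell \o P) u]/(cell (P (u, v).1)) -z0 -[(cell \o P) v]/(cell (P (u, v).2)) -zK.
  have : forall n k, (k + n <= K)%N ->
      path (fun p q => grid4 p q || (p == q)) (cell (z (u, v) k)) (flatten [seq cells (u, v) i | i <- iota k n])
      /\ last (cell (z (u, v) k)) (flatten [seq cells (u, v) i | i <- iota k n]) = cell (z (u, v) (k + n)%N).
    elim=> [|n IH] k kn; first by rewrite addn0.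
    have [|ih1 ih2] := IH k.+1; first by rewrite addSn -addnS.
    have kK : (k < K)%N by apply: leq_trans kn; rewrite addnS ltnS leq_addr.
    have [x0 y0] := zpos (u, v) k (ltnW kK); have [x1 y1] := zpos (u, v) k.+1 kK.
    have := cell_step x0 y0 x1 y1 (zstep _ _ de kK).
    by rewrite addnS -addSn -ih2 /= ih1 => /and3P[-> ->].
  by move=> /(_ K 0%N (leqnn _)).
- move=> u v w p de /(chainP u v _ de) [k [kK cl]] wp.
  have [w1 w2] := Ppos w.
  have H := close_in_square w1 w2 cl wp.
  case: (eqVneq w u) => [->|wu]; first by left.
  case: (eqVneq w v) => [->|wv]; first by right.
  have H' := zP (u, v) w k de kK wu wv; clear wu wv; exfalso; lra.
- move=> u v x y p de de' /(chainP u v _ de) [k [kK cl]] /(chainP x y _ de') [k' [k'K cl']] up vp.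
  have [u1 u2] := Ppos u; have [v1 v2] := Ppos v.
  have hu := close_notin_square u1 u2 cl up; have hv := close_notin_square v1 v2 cl vp.
  apply/eqP; rewrite -[_ == _]negbK; apply/negP => ne.
  have ru : r <= `|z (u, v) k - P u| by clear ne; lra.
  have rv : r <= `|z (u, v) k - P v| by clear ne; lra.
  have := zsep (u, v) (x, y) _ _ de de' ne kK k'K ru rv.
  have := close_close cl cl'; clear ne; lra.
Qed.
End PlanarGridMinor.

(** * Edge bound for grid minors *)

Section BoolSums.
Local Open Scope ring_scope.

Lemma boolDD (b : bool) : b + b = 0.
Proof. by case: b. Qed.

Lemma bool_addr_eq0 (a b : bool) : (a + b == 0) = (a == b).
Proof. by case: a; case: b. Qed.

Lemma sum_sym_eq0 (T : finType) (A : pred T) (g : T -> T -> bool) :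
  (forall x y, g x y = g y x) -> (forall x, g x x = 0) ->
  \sum_(x | A x) \sum_(y | A y) g x y = 0.
Proof.
move=> gS g0.
pose lt (x y : T) := (enum_rank x < enum_rank y)%N.
have E : \sum_(x | A x) \sum_(y | A y) g x y =
    \sum_(x | A x) \sum_(y | A y && lt x y) g x y +
    \sum_(x | A x) \sum_(y | A y && lt y x) g x y.
  rewrite -big_split /=; apply: eq_bigr => x Ax.
  rewrite (bigID (lt x)) /=; congr (_ + _).
  rewrite [LHS]big_mkcond [RHS]big_mkcond /=; apply: eq_bigr => y _.
  case: (A y) => //=; rewrite /lt; case: ltngtP => // /val_inj/enum_rank_inj ->.
  exact: g0.
rewrite {}E; set a := (X in X + _); set b := (X in _ + X).
suff -> : b = a by exact: boolDD.
rewrite {}/a {}/b (exchange_big_dep A) /=; last by move=> x y _ /andP[].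
apply: eq_bigr => x Ax; by apply: eq_big => [y|y _]; [rewrite Ax|exact: gS].
Qed.

Lemma card_leq_kernel (E V : finType) (d : {ffun E -> bool} -> {ffun V -> bool}) :
  (forall x y, d (x + y) = d x + d y) ->
  (2 ^ #|E| <= 2 ^ #|V| * #|[set x | d x == 0%R]|)%N.
Proof.
move=> dD.
have cE (T : finType) : (2 ^ #|T|)%N = #|{ffun T -> bool}| by rewrite card_ffun card_bool.
rewrite !cE -cardsT -(cardsT {ffun V -> bool}) -cardsX.
pose x0 y := odflt 0 [pick x | d x == y].
have x0P x : d (x0 (d x)) = d x.
  by rewrite /x0; case: pickP => [y /eqP//|/(_ x)]; rewrite eqxx.
pose f x := (d x, x + x0 (d x)).
have xx (T : finType) (x : {ffun T -> bool}) : x + x = 0.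
  by apply/ffunP => i; rewrite !ffunE boolDD.
have fI : injective f.
  by move=> x y [E1]; rewrite E1 => /addIr.
rewrite -(card_imset _ fI); apply/subset_leq_card/fintype.subsetP => _ /imsetP[x _ ->].
by rewrite !inE /= dD x0P xx.
Qed.
End BoolSums.

Section GridHomology.
Local Open Scope ring_scope.

Definition flip_faces (a b : nat * nat) : (nat * nat) * (nat * nat) :=
  let i := minn a.1 b.1 in let j := minn a.2 b.2 in
  if a.1 == b.1 then ((i.-1, j), (i, j)) else ((i, j.-1), (i, j)).

Definition coboundary (s : nat * nat -> bool) (a b : nat * nat) : bool :=
  s (flip_faces a b).1 + s (flip_faces a b).2.

Definition nbrs (a : nat * nat) : seq (nat * nat) :=
  [:: (a.1.+1, a.2); (a.1.-1, a.2); (a.1, a.2.+1); (a.1, a.2.-1)].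

Lemma flip_facesC a b : flip_faces a b = flip_faces b a.
Proof. by rewrite /flip_faces eq_sym minnC [minn a.2 _]minnC; case: eqP => // ->. Qed.

Lemma coboundaryC s a b : coboundary s a b = coboundary s b a.
Proof. by rewrite /coboundary flip_facesC. Qed.

Lemma coboundary_closed s a : (0 < a.1)%N -> (0 < a.2)%N ->
  \sum_(b <- nbrs a) coboundary s a b = 0.
Proof.
case: a => [[|x] [|y]] //= _ _.
rewrite /nbrs !big_cons big_nil /= /coboundary /flip_faces /= !minnn.
have -> : (x.+1 == x.+2) = false by lia.
have -> : (x.+1 == x) = false by lia.
rewrite !eqxx.
have -> : minn x.+1 x.+2 = x.+1 by lia.
have -> : minn x.+1 x = x by lia.
have -> : minn y.+1 y.+2 = y.+1 by lia.
have -> : minn y.+1 y = y by lia.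
rewrite /=.
by case: (s (x, y)); case: (s (x.+1, y)); case: (s (x, y.+1)); case: (s (x.+1, y.+1)).
Qed.

(* A mod 2 cycle of the grid is the boundary of the set of unit squares from which
   a leftward ray crosses it an odd number of times. *)
Lemma grid_cycle_coboundary (z : nat * nat -> nat * nat -> bool) :
  (forall a b, z a b = z b a) ->
  (forall a b, z a b -> (0 < a.1)%N && (0 < a.2)%N) ->
  (forall a, (0 < a.1)%N -> (0 < a.2)%N -> \sum_(b <- nbrs a) z a b = 0) ->
  exists s, forall a b, ((0 < a.1) && (0 < a.2) || (0 < b.1) && (0 < b.2))%N ->
    grid4 a b -> z a b = coboundary s a b.
Proof.
move=> zC zpos zcl.
pose s (f : nat * nat) := \sum_(i < f.1.+1) z (i : nat, f.2) (i : nat, f.2.+1).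
have sV i j : z (i.+1, j) (i.+1, j.+1) = s (i, j) + s (i.+1, j).
  by rewrite /s [X in _ + X]big_ord_recr /= addrA boolDD add0r.
have sH i j : z (i, j.+1) (i.+1, j.+1) = s (i, j) + s (i, j.+1).
  elim: i => [|i IH].
    rewrite /s !big_ord_recr !big_ord0 /= !add0r.
    have z0 b c : z (0%N, b) c = 0 by case E: (z _ _) => //; have := zpos _ _ E.
    by rewrite !z0.
  have := zcl (i.+1, j.+1) isT isT; rewrite /nbrs !big_cons big_nil /= addr0.
  rewrite [z (i.+1, j.+1) (i, _)]zC IH [z _ (i.+1, j)]zC sV sV.
  by case: (z _ _) (s (i, j)) (s (i, j.+1)) (s (i.+1, j)) (s (i.+1, j.+1)) => [] [] [] [] [].
exists s => [[a1 a2] [b1 b2]] /=.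
wlog : a1 a2 b1 b2 / (a1 <= b1)%N && (a2 <= b2)%N.
  move=> H h g; have [le|] := boolP ((a1 <= b1)%N && (a2 <= b2)%N).
    exact: H.
  rewrite zC coboundaryC => nle; apply: H; last by rewrite grid4_sym.
    by move: g nle; rewrite /grid4 /=; lia.
  by rewrite orbC.
move=> le h g; move: le g h; rewrite /grid4 /coboundary /flip_faces /=.
move=> /andP[l1 l2]; rewrite (minn_idPl l1) (minn_idPl l2).
case: eqP => [<-|ne] /=.
  move=> E h; have -> : b2 = a2.+1 by move: E; lia.
  have {h} : (0 < a1)%N by move: h; lia.
  by case: a1 l1 {E} => // i _ _; rewrite sV.
move=> E h; have [E1 E2] : b1 = a1.+1 /\ a2 = b2 by move: E ne; lia.
have {h} : (0 < b2)%N by move: h; rewrite E2; lia.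
by rewrite E1 E2; case: (b2) => // j _; rewrite sH.
Qed.
End GridHomology.

Section GridChains.
Local Open Scope ring_scope.

Definition gpos (a : nat * nat) := (0 < a.1)%N && (0 < a.2)%N.

Definition edge_chain (x y a b : nat * nat) : bool :=
  ((x, y) == (a, b)) || ((x, y) == (b, a)).

Fixpoint path_chain (x : nat * nat) (p : seq (nat * nat)) (a b : nat * nat) : bool :=
  if p is y :: p' then edge_chain x y a b + path_chain y p' a b else 0.

Lemma sum_pred1_uniq (T : eqType) (y : T) (s : seq T) : uniq s ->
  \sum_(b <- s) (y == b) = (y \in s) :> bool.
Proof.
elim: s => [|x s IH] /=; first by rewrite big_nil.
move=> /andP[xs us]; rewrite big_cons IH // inE.
by case: eqP => // ->; rewrite (negPf xs).
Qed.

Lemma nbrs_uniq a : gpos a -> uniq (nbrs a).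
Proof. by case: a => [[|x] [|y]] //= _; rewrite !inE !xpair_eqE; lia. Qed.

Lemma grid4_nbrs a b : gpos a -> gpos b -> grid4 a b = (b \in nbrs a).
Proof.
case: a b => [x y] [x' y']; rewrite /gpos /grid4 /= => /andP[x0 y0] /andP[x'0 y'0].
by rewrite !inE !xpair_eqE /=; lia.
Qed.

Lemma grid4_irr a : grid4 a a = false.
Proof. by case: a => x y; rewrite /grid4 /=; lia. Qed.

Lemma edge_chain_boundary x y a : gpos x -> gpos y -> gpos a -> grid4 x y ->
  \sum_(b <- nbrs a) edge_chain x y a b = (a == x) + (a == y).
Proof.
move=> x0 y0 a0 xy.
have nxy : x != y by apply: contraTneq xy => ->; rewrite grid4_irr.
have E b : edge_chain x y a b = (a == x) * (y == b) + (a == y) * (x == b).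
  rewrite /edge_chain !xpair_eqE [a == x]eq_sym [a == y]eq_sym.
  have [ax|ax] := eqVneq x a; have [ay|ay] := eqVneq y a; subst; rewrite ?eqxx in nxy *; do ?by [].
  - by rewrite andbF orbF mul1r mul0r addr0.
  - by rewrite /= andbT mul1r mul0r add0r.
  - by rewrite andbF mul0r mul0r addr0.
under eq_bigr do rewrite E.
rewrite big_split /= -!big_distrr /= !sum_pred1_uniq ?nbrs_uniq //.
congr (_ + _); case: eqP => [->|_]; rewrite ?mul0r // mul1r -grid4_nbrs //.
by rewrite grid4_sym.
Qed.

Lemma path_chain_boundary x p a : gpos a -> all gpos (x :: p) -> path grid4 x p ->
  \sum_(b <- nbrs a) path_chain x p a b = (a == x) + (a == last x p).
Proof.
move=> a0; elim: p x => [|y p IH] x /=; first by rewrite big1 ?boolDD.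
move=> /and3P[x0 y0 p0] /andP[xy pp]; rewrite big_split /= IH /= ?y0 //.
rewrite edge_chain_boundary //.
by case: (a == x) (a == y) (a == last y p) => [] [] [].
Qed.

Lemma edge_chainC x y a b : edge_chain x y a b = edge_chain x y b a.
Proof. by rewrite /edge_chain orbC. Qed.

Lemma path_chainC x p a b : path_chain x p a b = path_chain x p b a.
Proof. by elim: p x => //= y p IH x; rewrite IH edge_chainC. Qed.

Lemma path_chain_supp x p a b : path_chain x p a b ->
  (a \in x :: p) && (b \in x :: p).
Proof.
elim: p x => [|y p IH] x //=.
case E: (edge_chain x y a b).
  move=> _; move: E; rewrite /edge_chain !xpair_eqE.
  by move=> /orP[] /andP[/eqP<- /eqP<-]; rewrite !inE !eqxx !orbT.
by rewrite add0r => /IH /andP[]; rewrite !(inE, in_cons) => -> ->; rewrite !orbT.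
Qed.
End GridChains.

Section GridMinorEdges.
Local Open Scope ring_scope.
Variables (G : sgraph) (m : nat * nat -> option G) (N : nat).
Hypothesis mG : minor_model grid4 m.
Hypothesis mN : forall p, m p -> (0 < p.1 < N)%N && (0 < p.2 < N)%N.

Let E := {e : G * G | sedge e.1 e.2 && (enum_rank e.1 < enum_rank e.2)%N}.

Lemma model_gpos a : m a -> gpos a.
Proof. by move=> /mN /andP[/andP[h1 _] /andP[h2 _]]; rewrite /gpos h1 h2. Qed.

Definition kept_edge (rep : E -> (nat * nat) * (nat * nat)) (a b : nat * nat) : bool :=
  m a && (m a == m b) || [exists e, (rep e == (a, b)) || (rep e == (b, a))].

Definition is_rep (rep : E -> (nat * nat) * (nat * nat)) : Prop :=
  forall e, [/\ m (rep e).1 = Some (val e).1, m (rep e).2 = Some (val e).2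
    & grid4 (rep e).1 (rep e).2].

Definition degree (x : {ffun E -> bool}) : {ffun G -> bool} :=
  [ffun u => \sum_(e : E | ((val e).1 == u) || ((val e).2 == u)) x e].

Lemma E_ends (e : E) : (val e).1 != (val e).2.
Proof. by case: e => -[u v] /= /andP[_]; apply: contraTneq => ->; rewrite ltnn. Qed.

Lemma E_inj (e e' : E) u v : u != v ->
  ((val e).1 == u) || ((val e).2 == u) -> ((val e).1 == v) || ((val e).2 == v) ->
  ((val e').1 == u) || ((val e').2 == u) -> ((val e').1 == v) || ((val e').2 == v) ->
  e = e'.
Proof.
case: e e' => -[a b] /= p [[a' b'] /= p'] uv h1 h2 h3 h4; apply: val_inj => /=.
move: p p' => /andP[_ p] /andP[_ p'].
case/orP: h1 => /eqP h1; case/orP: h2 => /eqP h2; subst; rewrite ?eqxx // in uv.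
  case/orP: h3 => /eqP h1; case/orP: h4 => /eqP h2; subst; rewrite ?eqxx // in uv *.
  by have := ltn_trans p p'; rewrite ltnn.
case/orP: h3 => /eqP h1; case/orP: h4 => /eqP h2; subst; rewrite ?eqxx // in uv *.
by have := ltn_trans p p'; rewrite ltnn.
Qed.

Lemma rep_exists : exists rep, is_rep rep.
Proof.
have [_ _ mE] := mG.
have /boolp.choice [rep repP] (e : E) : exists p : (nat * nat) * (nat * nat),
    [/\ m p.1 = Some (val e).1, m p.2 = Some (val e).2 & grid4 p.1 p.2].
  by case: e => e /= /andP[/mE [x [y [h1 h2 h3]]] _]; exists (x, y).
by exists rep.
Qed.

Section WithRep.
Variable rep : E -> (nat * nat) * (nat * nat).
Hypothesis repP : is_rep rep.

Lemma edge_chain_rep e e' :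
  edge_chain (rep e).1 (rep e).2 (rep e').1 (rep e').2 = (e == e').
Proof.
have [h1 h2 _] := repP e; have [h1' h2' _] := repP e'.
have [->|ne] := eqVneq e e'; first by rewrite /edge_chain eqxx.
apply/negP; rewrite /edge_chain !xpair_eqE => H.
have {H} H : ((val e).1 = (val e').1 /\ (val e).2 = (val e').2) \/
    ((val e).1 = (val e').2 /\ (val e).2 = (val e').1).
  case/orP: H => /andP[/eqP H1 /eqP H2]; rewrite H1 in h1; rewrite H2 in h2.
    by left; split; apply: Some_inj; rewrite -?h1 -?h2.
  by right; split; apply: Some_inj; rewrite -?h1 -?h2.
have ends (x : E) : ((val x).1 == (val x).1) || ((val x).2 == (val x).1) by rewrite eqxx.
move/eqP: ne; apply; apply: (@E_inj e e' (val e).1 (val e).2); rewrite ?E_ends ?eqxx ?orbT //.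
  by case: H => -[-> _]; rewrite eqxx ?orbT.
by case: H => -[_ ->]; rewrite eqxx ?orbT.
Qed.

Lemma lifting_exists (r : G -> nat * nat) : (forall u, m (r u) = Some u) ->
  forall e : E, exists c : nat * nat -> nat * nat -> bool,
  [/\ forall a b, c a b = c b a,
      forall a, gpos a -> \sum_(b <- nbrs a) c a b = (a == r (val e).1) + (a == r (val e).2),
      forall a b, c a b -> gpos a && kept_edge rep a b
    & forall e', c (rep e').1 (rep e').2 = (e == e')].
Proof.
move=> rP e; have [_ con _] := mG; have [h1 h2 g12] := repP e.
have [s1 [p1 l1 a1]] := con _ _ _ (rP _) h1.
have [s2 [p2 l2 a2]] := con _ _ _ h2 (rP _).
set p := (rep e).1 in h1 g12 l1 *; set q := (rep e).2 in h2 g12 p2 l2 *.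
have pp : gpos p by apply: model_gpos; rewrite h1.
have pq : gpos q by apply: model_gpos; rewrite h2.
have a1' : all (fun z => m z == Some (val e).1) (r (val e).1 :: s1) by rewrite /= rP eqxx.
have a2' : all (fun z => m z == Some (val e).2) (q :: s2) by rewrite /= h2 eqxx.
have posall u s : all (fun z => m z == Some u) s -> all gpos s.
  by move=> /allP H; apply/allP => z /H /eqP mz; apply: model_gpos; rewrite mz.
have fib x s u a b : all (fun z => m z == Some u) (x :: s) -> path_chain x s a b ->
    m a = Some u /\ m b = Some u.
  by move=> /allP H /path_chain_supp /andP[/H/eqP-> /H/eqP->].
exists (fun a b => path_chain (r (val e).1) s1 a b + edge_chain p q a b + path_chain q s2 a b).
split.
- by move=> a b; rewrite path_chainC edge_chainC [path_chain q _ _ _]path_chainC.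
- move=> a a0; rewrite !big_split /= !path_chain_boundary ?edge_chain_boundary // ?(posall _ _ a1') ?(posall _ _ a2') //.
  by rewrite l1 l2; case: (a == _) (a == p) (a == q) (a == _) => [] [] [] [].
- move=> a b; case E1: (path_chain _ s1 a b).
    by have [ma mb] := fib _ _ _ _ _ a1' E1; rewrite /kept_edge model_gpos ma // mb eqxx.
  case E2: (path_chain _ s2 a b).
    by have [ma mb] := fib _ _ _ _ _ a2' E2; rewrite /kept_edge model_gpos ma // mb eqxx.
  rewrite addr0 add0r => E3; apply/andP; split.
    by move: E3; rewrite /edge_chain !xpair_eqE => /orP[] /andP[/eqP h /eqP h']; rewrite -?h -?h'.
  by apply/orP; right; apply/existsP; exists e; rewrite [rep e]surjective_pairing.
- move=> e'; rewrite edge_chain_rep.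
  have [h1' h2' _] := repP e'.
  have nf u : ~ (m (rep e').1 = Some u /\ m (rep e').2 = Some u).
    by rewrite h1' h2' => -[[<-] [/eqP]]; rewrite eq_sym (negPf (E_ends e')).
  case E1: (path_chain _ s1 _ _); first by case: (nf _ (fib _ _ _ _ _ a1' E1)).
  case E2: (path_chain _ s2 _ _); first by case: (nf _ (fib _ _ _ _ _ a2' E2)).
  by rewrite addr0 add0r.
Qed.

Lemma cycle_coboundary (z : {ffun E -> bool}) : degree z = 0 ->
  exists s : nat * nat -> bool,
    (forall e, z e = coboundary s (rep e).1 (rep e).2) /\
    (forall a b, m a -> grid4 a b -> ~~ kept_edge rep a b -> coboundary s a b = 0).
Proof.
move=> dz; have [ne _ _] := mG; have [r rP] := boolp.choice ne.
have [c cP] := boolp.choice (lifting_exists rP).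
pose zeta a b := \sum_e z e * c e a b.
have zk a b : zeta a b -> gpos a && kept_edge rep a b.
  move=> zab; have [e] : exists e, c e a b.
    apply/existsP; apply: contraTT zab => /existsPn H.
    by rewrite /zeta big1 // => e _; rewrite (negPf (H e)) mulr0.
  by have [_ _ H _] := cP e => /H.
have [| | |s sP] := @grid_cycle_coboundary zeta.
- by move=> a b; apply: eq_bigr => e _; congr (_ * _); case: (cP e).
- by move=> a b /zk /andP[].
- move=> a a1 a2; have a0 : gpos a by rewrite /gpos a1 a2.
  rewrite exchange_big /=.
  under eq_bigr => e _.
    rewrite -big_distrr /=; have [_ -> // _ _] := cP e.
    have -> : (a == r (val e).1) + (a == r (val e).2) =
        \sum_(u | ((val e).1 == u) || ((val e).2 == u)) (a == r u) :> bool.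
      rewrite (bigD1 (val e).1) ?eqxx //= (bigD1 (val e).2) ?eqxx ?orbT /=; last by rewrite eq_sym E_ends.
      rewrite big1 ?addr0 // => u /andP[/andP[]].
      by rewrite ![_ == u]eq_sym => /orP[] ->.
    rewrite big_distrr /=.
  over.
  rewrite (exchange_big_dep predT) //= big1 // => u _.
  rewrite -big_distrl /=; move/ffunP: dz => /(_ u); rewrite !ffunE => ->.
  by rewrite mul0r.
exists s; split.
  move=> e; have [h1 h2 g] := repP e.
  have /andP[p1 p2] : gpos (rep e).1 by apply: model_gpos; rewrite h1.
  rewrite -sP ?p1 ?p2 // /zeta (bigD1 e) //=; have [_ _ _ ->] := cP e; rewrite eqxx mulr1.
  rewrite big1 ?addr0 // => e' ne'; have [_ _ _ ->] := cP e'.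
  by rewrite (negPf ne') mulr0.
move=> a b /model_gpos /andP[a1 a2] g nk; rewrite -sP ?a1 ?a2 //.
by case H: (zeta a b) => //; move/zk: H; rewrite (negPf nk) andbF.
Qed.

Lemma coboundary_cycle (s : nat * nat -> bool) :
  (forall a b, m a -> grid4 a b -> ~~ kept_edge rep a b -> coboundary s a b = 0) ->
  degree [ffun e => coboundary s (rep e).1 (rep e).2] = 0.
Proof.
move=> sk; apply/ffunP => u; rewrite !ffunE.
pose C := ('I_N.+1 * 'I_N.+1)%type.
pose cv (p : C) : nat * nat := (p.1 : nat, p.2 : nat).
pose vc (a : nat * nat) : C := (inord a.1, inord a.2).
have vcK a : (a.1 < N.+1)%N -> (a.2 < N.+1)%N -> cv (vc a) = a.
  by move=> h1 h2; rewrite /cv /vc /= !inordK // -surjective_pairing.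
have cvI : injective cv by move=> [a b] [a' b'] [/val_inj -> /val_inj ->].
have mC a : m a -> cv (vc a) = a.
  by move=> /mN /andP[/andP[_ h1] /andP[_ h2]]; rewrite vcK // ltnW.
pose g p q := if grid4 (cv p) (cv q) then coboundary s (cv p) (cv q) else 0.
pose fib := fun p : C => m (cv p) == Some u.
have gC p q : g p q = g q p by rewrite /g grid4_sym coboundaryC.
have gpp p : g p p = 0 by rewrite /g grid4_irr.
have star p : fib p -> \sum_q g p q = 0.
  move=> /eqP mp; have mp' : m (cv p) by rewrite mp.
  have p0 := model_gpos mp'; have /andP[p1 p2] := p0.
  have /andP[/andP[_ pN1] /andP[_ pN2]] := mN mp'.
  rewrite -[RHS](coboundary_closed s p1 p2) /g -big_mkcond /=.
  have nb b : b \in nbrs (cv p) -> cv (vc b) = b.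
    rewrite !inE => H; apply: vcK; move: pN1 pN2 H; case: (cv p) b => [x y] [x' y'] /=;
      rewrite !xpair_eqE; lia.
  have gnb q : grid4 (cv p) (cv q) = (cv q \in nbrs (cv p)).
    move: p1 p2; case: (cv p) (cv q) => [x y] [x' y']; rewrite /grid4 !inE !xpair_eqE /=; lia.
  have -> : nbrs (cv p) = [seq cv q | q <- [seq vc b | b <- nbrs (cv p)]].
    by rewrite -map_comp map_id_in // => b /nb.
  have ut : uniq [seq vc b | b <- nbrs (cv p)].
    rewrite map_inj_in_uniq ?nbrs_uniq // => a b /nb h1 /nb h2 E1.
    by rewrite -h1 -h2 E1.
  rewrite big_map (big_uniq _ ut).
  apply: eq_bigl => q; rewrite gnb; apply/idP/mapP.
    by move=> H; exists (cv q) => //; apply: cvI; rewrite nb.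
  by move=> [b hb ->]; rewrite nb.
have : \sum_(p | fib p) \sum_q g p q = 0 by rewrite big1.
under eq_bigr do rewrite (bigID fib) /=.
rewrite big_split /= sum_sym_eq0 // add0r pair_big_dep /= => S0.
pose h (e : E) : C * C :=
  if (val e).1 == u then (vc (rep e).1, vc (rep e).2) else (vc (rep e).2, vc (rep e).1).
pose B := [set e : E | ((val e).1 == u) || ((val e).2 == u)].
have hP e : e \in B -> exists v, [/\ v != u, m (cv (h e).1) = Some u, m (cv (h e).2) = Some v
    & [/\ g (h e).1 (h e).2 = coboundary s (rep e).1 (rep e).2 &
       ((val e).1 == v) || ((val e).2 == v)]].
  have [h1 h2 gr] := repP e; rewrite inE /h.
  have c1 : cv (vc (rep e).1) = (rep e).1 by apply: mC; rewrite h1.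
  have c2 : cv (vc (rep e).2) = (rep e).2 by apply: mC; rewrite h2.
  case: (eqVneq (val e).1 u) => [E1 _|ne1 /= /eqP E2].
    exists (val e).2; rewrite /g /= c1 c2 gr h1 h2 E1; split=> //.
      by rewrite -E1 eq_sym E_ends.
    by rewrite eqxx orbT.
  exists (val e).1; rewrite /g /= c1 c2 grid4_sym gr coboundaryC h1 h2 E2; split=> //.
  by rewrite eqxx.
have hI : {in B &, injective h}.
  move=> e e' eB e'B E1; have [v [vu _ h2 [_ ev]]] := hP _ eB.
  have [v' [_ _ h2' [_ ev']]] := hP _ e'B.
  have vv : v' = v by apply: Some_inj; rewrite -h2 -h2' E1.
  rewrite vv in ev'; rewrite !inE in eB e'B.
  by apply: (@E_inj e e' u v) => //; rewrite eq_sym.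
under eq_bigr do rewrite ffunE.
rewrite -[RHS]S0.
transitivity (\sum_(x in h @: B) g x.1 x.2).
  rewrite big_imset //=; apply: eq_big => e; first by rewrite inE.
  by move=> eB; have [|v [_ _ _ [-> _]]] := hP e; rewrite ?inE.
rewrite [LHS]big_mkcond [RHS]big_mkcond; apply: eq_bigr => -[p q] _ /=.
case: imsetP => [[e eB E1]|nim].
  have [v [vu h1 h2 _]] := hP _ eB; move: h1 h2; rewrite -E1 /= /fib => -> ->.
  by rewrite eqxx /= (inj_eq Some_inj) (negPf vu).
case: ifP => // /andP[/eqP mp nq]; rewrite /g; case: ifP => // pq.
have mp' : m (cv p) by rewrite mp.
apply/esym; have [kk|nk] := boolP (kept_edge rep (cv p) (cv q)); last exact: sk.
have cvK x : vc (cv x) = x by rewrite /vc /cv /= !inord_val -surjective_pairing.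
case/orP: kk => [/andP[_ /eqP E1]|/existsP[e /orP[] /eqP E1]].
- by move: nq; rewrite /fib -E1 mp eqxx.
- have [h1 h2 _] := repP e; rewrite E1 /= mp in h1; case: h1 => h1.
  case: nim; exists e; first by rewrite inE -h1 eqxx.
  by rewrite /h -h1 eqxx E1 /= !cvK.
- have [h1 h2 _] := repP e; rewrite E1 /= mp in h2; case: h2 => h2.
  case: nim; exists e; first by rewrite inE -h2 eqxx orbT.
  by rewrite /h h2 (negPf (E_ends e)) E1 /= !cvK.
Qed.

Lemma cycle_card (x : {ffun E -> bool}) : degree x = 0 -> x != 0 ->
  (3 <= #|[set e | x e]|)%N.
Proof.
move=> dx nx.
have [e xe] : exists e, x e.
  apply/existsP; apply: contraR nx => /existsPn H; apply/eqP/ffunP => e.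
  by rewrite ffunE; apply/negbTE/H.
have other u : ((val e).1 == u) || ((val e).2 == u) ->
    exists e', [/\ x e', e' != e & ((val e').1 == u) || ((val e').2 == u)].
  move=> eu; move/ffunP: dx => /(_ u); rewrite !ffunE (bigD1 e) //= xe => H.
  suff /existsP[e' /and3P[h1 h2 h3]] : [exists e', [&& x e', e' != e & ((val e').1 == u) || ((val e').2 == u)]].
    by exists e'.
  apply: contraT => /existsPn nH; move: H; rewrite big1 // => e' /andP[h1 h2].
  by move: (nH e'); rewrite h1 h2 !andbT => /negbTE.
have [e1 [x1 n1 h1]] := other (val e).1 ltac:(by rewrite eqxx).
have [e2 [x2 n2 h2]] := other (val e).2 ltac:(by rewrite eqxx orbT).
have n12 : e1 != e2.
  apply: contraNneq n1 => E12; rewrite -E12 in h2; apply/eqP.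
  by apply: (@E_inj e1 e _ _ (E_ends e)); rewrite ?eqxx ?orbT.
have -> : 3%N = #|[set e; e1; e2]|.
  rewrite -finset.setUA cardsU1 cards2 !inE negb_or [e == e1]eq_sym [e == e2]eq_sym.
  by rewrite n1 n2 n12.
by apply/subset_leq_card/fintype.subsetP => y; rewrite !inE => /orP[/orP[]|] /eqP ->.
Qed.

Lemma degreeD x y : degree (x + y) = degree x + degree y.
Proof.
by apply/ffunP => u; rewrite !ffunE -big_split; apply: eq_bigr => e _; rewrite ffunE.
Qed.

Lemma model_edge_bound : (#|{: E}| <= 3 * #|G|)%N.
Proof.
pose FT := ('I_N.+1 * 'I_N.+1)%type.
pose vc (a : nat * nat) : FT := (inord a.1, inord a.2).
pose fv (f : FT) : nat * nat := (f.1 : nat, f.2 : nat).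
pose ind (S : {set FT}) f := vc f \in S.
have fvK a b : m a -> grid4 a b -> fv (vc (flip_faces a b).1) = (flip_faces a b).1 /\
    fv (vc (flip_faces a b).2) = (flip_faces a b).2.
  move=> /mN; rewrite /fv /vc /grid4 /flip_faces.
  case: a b => [x y] [x' y'] /= H g; case: eqP => /= E1; rewrite !inordK //; lia.
pose clo (S : {set FT}) := `[< forall a b, m a -> grid4 a b -> ~~ kept_edge rep a b ->
  coboundary (ind S) a b = 0 >].
pose cl f := [set g | [forall S : {set FT}, clo S ==> ((f \in S) == (g \in S))]].
have clP f g : reflect (forall S, clo S -> (f \in S) = (g \in S)) (g \in cl f).
  rewrite inE; apply: (iffP forallP) => H S; first by move=> cS; have /implyP/(_ cS)/eqP := H S.
  by apply/implyP => cS; apply/eqP/H.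
have cl_refl f : f \in cl f by apply/clP.
have cl_eq f g : g \in cl f -> cl f = cl g.
  move=> /clP fg; apply/setP => h; apply/clP/clP => H S cS.
    by rewrite -(fg S cS) H.
  by rewrite (fg S cS) H.
have cl_clo f : clo (cl f).
  apply/asboolP => a b ma g nk; apply/eqP; rewrite bool_addr_eq0 /ind; apply/eqP.
  have ab S : clo S -> (vc (flip_faces a b).1 \in S) = (vc (flip_faces a b).2 \in S).
    by move=> /asboolP /(_ a b ma g nk) /eqP; rewrite bool_addr_eq0 => /eqP.
  apply/clP/clP => H S cS; first by rewrite -ab // H.
  by rewrite ab // H.
have cl_sub f S : clo S -> (cl f \subset S) = (f \in S).
  move=> cS; apply/fintype.subsetP/idP => [/(_ f (cl_refl f))//|fS g /clP/(_ S cS) <- //].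
pose zK K := [ffun e => coboundary (ind K) (rep e).1 (rep e).2].
pose kap := [set K in [set cl f | f in [set: FT]] | zK K != 0].
have zK0 K : K \in kap -> degree (zK K) = 0.
  rewrite inE => /andP[/imsetP[f _ ->] _]; apply: coboundary_cycle.
  by move: (cl_clo f) => /asboolP.
have sum_cl f S : clo S ->
    \sum_(K in [set cl f | f in [set: FT]] | K \subset S) (f \in K) = (f \in S) :> bool.
  move=> cS; rewrite -(cl_sub f S cS); have [sub|nsub] := boolP (cl f \subset S).
    rewrite (bigD1 (cl f)) /=; last by rewrite imset_f // sub.
    rewrite cl_refl big1 // => K /andP[/andP[/imsetP[g _ ->] _] ne].
    by apply/negbTE; apply: contraNN ne => /cl_eq ->.
  rewrite big1 // => K /andP[/imsetP[g _ ->] sub].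
  by apply/negbTE; apply: contraNN nsub => /cl_eq <-.
pose sumK (T : {set {set FT}}) := \sum_(K in T) zK K.
have span z : degree z = 0 -> z \in sumK @: powerset kap.
  move=> dz; have [s [sz sk]] := cycle_coboundary dz.
  pose S := [set g | s (fv g)].
  have indS a b : m a -> grid4 a b -> coboundary (ind S) a b = coboundary s a b.
    by move=> ma g; have [e1 e2] := fvK a b ma g; rewrite /coboundary /ind !inE e1 e2.
  have cS : clo S by apply/asboolP => a b ma g nk; rewrite indS // sk.
  apply/imsetP; exists [set K in kap | K \subset S].
    by rewrite inE; apply/fintype.subsetP => K; rewrite inE => /andP[].
  apply/ffunP => e; rewrite /sumK sum_ffunE.
  have -> : \sum_(K in [set K in kap | K \subset S]) zK K e =
      \sum_(K in [set cl f | f in [set: FT]] | K \subset S) zK K e.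
    rewrite [LHS]big_mkcond [RHS]big_mkcond; apply: eq_bigr => K _.
    rewrite !inE; case: (K \in _) => //=; case: (K \subset S); rewrite ?andbF //=.
    by case: eqP => //= ->; rewrite ffunE.
  have [h1 h2 g] := repP e.
  rewrite sz -indS ?h1 //.
  under eq_bigr do rewrite ffunE.
  by rewrite big_split /= !sum_cl.
have cK : (#|[set z | degree z == 0%R]| <= 2 ^ #|kap|)%N.
  rewrite -card_powerset; apply: leq_trans (leq_imset_card _ _).
  by apply/subset_leq_card/fintype.subsetP => z; rewrite inE => /eqP; exact: span.
have E1 : (#|{: E}| <= #|G| + #|kap|)%N.
  rewrite -(leq_exp2l (m := 2)) // expnD.
  by apply: leq_trans (card_leq_kernel degreeD) _; rewrite leq_mul2l cK orbT.
have E2 : (3 * #|kap| <= 2 * #|{: E}|)%N.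
  have <- : (\sum_(K in kap) 3 = 3 * #|kap|)%N by rewrite sum_nat_const mulnC.
  have <- : (\sum_(e : E) 2 = 2 * #|{: E}|)%N by rewrite sum_nat_const mulnC.
  apply: (@leq_trans (\sum_(K in kap) \sum_(e | zK K e) 1)%N).
    apply: leq_sum => K Kk; rewrite sum1_card.
    have := cycle_card (zK0 _ Kk); rewrite cardsE; apply.
    by move: Kk; rewrite inE => /andP[].
  rewrite (exchange_big_dep predT) //=; apply: leq_sum => e _.
  rewrite sum1_card.
  pose f1 := vc (flip_faces (rep e).1 (rep e).2).1.
  pose f2 := vc (flip_faces (rep e).1 (rep e).2).2.
  apply: (@leq_trans #|[set cl f1; cl f2]|); last by rewrite cards2; case: eqP.
  apply/subset_leq_card/fintype.subsetP => K; rewrite unfold_in /= !inE.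
  move=> /andP[/andP[/imsetP[f _ ->] _]]; rewrite ffunE /coboundary /ind -/f1 -/f2.
  case I1: (f1 \in cl f); first by rewrite (cl_eq _ _ I1) eqxx.
  by rewrite add0r => I2; rewrite (cl_eq _ _ I2) eqxx orbT.
lia.
Qed.
End WithRep.
End GridMinorEdges.

Lemma grid_minor_edge_bound (G : sgraph) : grid_minor G ->
  #|[set p : G * G | sedge p.1 p.2]| <= 6 * #|G|.
Proof.
move=> [m [N [mG mN]]]; have [rep repP] := rep_exists mG.
have := model_edge_bound mG mN repP.
set P := fun e : G * G => sedge e.1 e.2 && (enum_rank e.1 < enum_rank e.2).
rewrite card_sig => H.
pose Q := [set e | P e]; have cQ : #|Q| <= 3 * #|G| by rewrite cardsE.
have sub : [set p : G * G | sedge p.1 p.2] \subset Q :|: [set (e.2, e.1) | e in Q].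
  apply/fintype.subsetP => -[u v]; rewrite !inE /P /= => uv; rewrite uv /=.
  case: ltngtP => // [vu|/val_inj/enum_rank_inj E]; last by rewrite E sedge_irrefl in uv.
  by apply/imsetP; exists (v, u) => //; rewrite inE /P /= sedge_sym uv.
apply: leq_trans (subset_leq_card sub) _; rewrite cardsU.
have := leq_imset_card (fun e => (e.2, e.1)) Q; lia.
Qed.

(** * Halving and encoding *)

Section Matching.
Variables (V : finType) (r : rel V).
Hypotheses (rS : symmetric r) (rI : irreflexive r).

Let matching (s : {ffun V -> V}) : bool :=
  [forall x, (s (s x) == x) && ((s x != x) ==> r x (s x))].

Lemma maximal_matching : exists s : V -> V,
  [/\ involutive s, forall x, s x != x -> r x (s x)
    & forall x y, s x = x -> s y = y -> ~~ r x y].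
Proof.
have m0 : matching [ffun x => x] by apply/forallP => x; rewrite !ffunE !eqxx.
case: (arg_maxnP (fun s : {ffun V -> V} => #|[set x | s x != x]|) m0) => s ms smax.
have sP x : s (s x) = x /\ (s x != x -> r x (s x)).
  by have /andP[/eqP h1 /implyP h2] := forallP ms x.
exists s; split=> [x|x|x y sx sy]; [by case: (sP x)|by case: (sP x)|].
apply/negP => xy.
have nxy : x != y by apply: contraTneq xy => ->; rewrite rI.
pose s' := [ffun z => if z == x then y else if z == y then x else s z].
have ms' : matching s'.
  apply/forallP => z; rewrite !ffunE.
  have [->|zx] := eqVneq z x; first by rewrite ?eqxx [y == x]eq_sym (negPf nxy) ?eqxx xy implybT.
  have [->|zy] := eqVneq z y; first by rewrite ?eqxx rS xy implybT.
  have szx : s z != x by apply: contraNneq zx => E; rewrite -(proj1 (sP z)) E sx.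
  have szy : s z != y by apply: contraNneq zy => E; rewrite -(proj1 (sP z)) E sy.
  rewrite (negPf szx) (negPf szy) (proj1 (sP z)) eqxx /=.
  by apply/implyP; case: (sP z).
suff lt : #|[set x | s x != x]| < #|[set x | s' x != x]|.
  by have := leq_trans lt (smax _ ms'); rewrite ltnn.
apply: proper_card.
apply/properP; split.
  apply/fintype.subsetP => z; rewrite !inE ffunE.
  have [->|zx] := eqVneq z x; first by rewrite [y == x]eq_sym nxy.
  by have [->|zy] := eqVneq z y; rewrite ?nxy.
by exists x; rewrite !inE; [rewrite ffunE eqxx eq_sym|rewrite sx eqxx].
Qed.
End Matching.

Section Halving.
Variables (G : sgraph) (s : G -> G).
Hypothesis sK : involutive s.

Let top (x : G) := enum_rank x <= enum_rank (s x).
Let HV := {x : G | top x}.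

Lemma top_or (x : G) : top x || top (s x).
Proof. by rewrite /top sK leq_total. Qed.

Let topP (x : G) : top (if top x then x else s x).
Proof. by have := top_or x; case: ifP. Qed.

Let p (x : G) : HV := exist (fun x => is_true (top x)) _ (topP x).

Let hedge (u v : HV) :=
  (u != v) && [exists x, exists y, [&& p x == u, p y == v & sedge x y]].

Lemma hedge_sym : symmetric hedge.
Proof.
move=> u v; rewrite /hedge eq_sym; congr (_ && _); apply/existsP/existsP => -[x /existsP[y /and3P[h1 h2 h3]]];
  by exists y; apply/existsP; exists x; rewrite h1 h2 sedge_sym.
Qed.

Lemma hedge_irr : irreflexive hedge.
Proof. by move=> u; rewrite /hedge eqxx. Qed.

Definition fold_graph : sgraph := SGraph hedge_sym hedge_irr.

Definition fold (x : G) : fold_graph := p x.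

Lemma fold_eq x y : fold x = fold y -> y = x \/ y = s x.
Proof.
move=> /(congr1 val) /=; case: ifP => _; case: ifP => _ E.
- by left.
- by right; rewrite E sK.
- by right.
- by left; rewrite -[y]sK -E sK.
Qed.

Lemma fold_edge x y : sedge x y -> fold x = fold y \/ sedge (fold x) (fold y).
Proof.
move=> xy; have [->|ne] := eqVneq (fold x) (fold y); [by left|right].
by apply/andP; split=> //; apply/existsP; exists x; apply/existsP; exists y; rewrite !eqxx.
Qed.

Lemma fold_top_inj x y : fold x = fold y -> top x = top y -> x = y.
Proof.
move=> xy t; have [//|E] := fold_eq xy; move: t (congr1 val xy) => /=.
by move=> ->; case: ifP => _ // /(can_inj sK).
Qed.

Lemma fold_top_surj u : exists x, fold x = u /\ top x.
Proof. by case: u => x tx; exists x; split=> //; apply: val_inj; rewrite /= tx. Qed.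

Lemma card_fold : 2 * #|fold_graph| + #|[set x | s x != x]| = 2 * #|G|.
Proof.
rewrite card_sig.
pose T := [set x | top x].
have -> : #|[pred x | top x]| = #|T| by rewrite cardsE.
have E1 : T :|: s @: T = [set: G].
  apply/setP => x; rewrite !inE; have /orP[->//|tx] := top_or x.
  by apply/orP; right; apply/imsetP; exists (s x); rewrite ?inE ?sK.
have E2 : T :&: s @: T = [set x | s x == x].
  apply/setP => x; rewrite !inE; apply/andP/eqP.
    move=> [tx /imsetP[y]]; rewrite inE /top => ty xy; move: tx; rewrite /top xy sK => tx.
    by apply/esym/enum_rank_inj/val_inj/eqP; rewrite eqn_leq tx ty.
  by move=> E; split; [rewrite /top E|apply/imsetP; exists x; rewrite ?inE /top E].
have := cardsUI T (s @: T); rewrite E1 E2 (card_imset _ (can_inj sK)) cardsT.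
have := cardsC [set x | s x != x].
have -> : ~: [set x | s x != x] = [set x | s x == x] by apply/setP => x; rewrite !inE negbK.
by set a := #|T|; set b := #|_|; set c := #|_|; set d := #|_|; lia.
Qed.

Lemma fold_contract : (forall x, s x != x -> sedge x (s x)) ->
  grid_minor G -> grid_minor fold_graph.
Proof.
move=> se gG; apply: (@grid_minor_trans G fold_graph (fun x => Some (fold x)) gG).
split.
- by move=> u; have [x [<- _]] := fold_top_surj u; exists x.
- move=> u x y [ux] [uy]; have [->|E] := fold_eq (etrans ux (esym uy)).
    by exists [::].
  have [sx|nsx] := eqVneq (s x) x; first by exists [::]; rewrite E sx.
  by exists [:: s x]; rewrite /= se // E -uy E !eqxx.
- move=> u v /andP[_ /existsP[x /existsP[y /and3P[/eqP xu /eqP yv xy]]]].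
  by exists x, y; rewrite -xu -yv.
Qed.

Lemma fold_twins : (forall x z, sedge (s x) z = sedge x z) ->
  grid_minor G -> grid_minor fold_graph.
Proof.
move=> tw gG.
have pE x z : sedge (val (fold x)) z = sedge x z by rewrite /=; case: ifP.
apply: (@grid_minor_trans G fold_graph (fun x => if top x then Some (fold x) else None)) => //.
have fI (x y : G) (u : fold_graph) : (if top x then Some (fold x) else None) = Some u ->
  (if top y then Some (fold y) else None) = Some u -> x = y.
  case: ifP => // tx [xu]; case: ifP => // ty [yu].
  by apply: fold_top_inj; rewrite ?tx ?ty // xu yu.
split.
- by move=> u; have [x [xu tx]] := fold_top_surj u; exists x; rewrite tx xu.
- by move=> u x y ux uy; rewrite (fI _ _ _ ux uy); exists [::]; rewrite /=.
- move=> u v /andP[_ /existsP[x /existsP[y /and3P[/eqP xu /eqP yv xy]]]].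
  have foldK (w : fold_graph) : fold (val w) = w.
    by apply: val_inj; case: w => w tw' /=; rewrite tw'.
  exists (val u), (val v); rewrite !foldK (valP u) (valP v); split=> //.
  by rewrite -xu -yv pE sedge_sym pE sedge_sym.
Qed.
End Halving.

Section InducedSubgraph.
Variables (G : sgraph) (S : {set G}).

Let iedge (u v : {x : G | x \in S}) := sedge (val u) (val v).

Lemma iedge_sym : symmetric iedge.
Proof. by move=> u v; rewrite /iedge sedge_sym. Qed.

Lemma iedge_irr : irreflexive iedge.
Proof. by move=> u; rewrite /iedge sedge_irrefl. Qed.

Definition induced : sgraph := SGraph iedge_sym iedge_irr.

Lemma induced_grid_minor : grid_minor G -> grid_minor induced.
Proof.
move=> gG; apply: (@grid_minor_trans G induced (fun x => insub x) gG); split.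
- by move=> u; exists (val u); rewrite valK.
- move=> u x y; case: insubP => // u' _ <- [->]; case: insubP => // v' _ <- [->].
  by exists [::].
- by move=> u v uv; exists (val u), (val v); rewrite !valK.
Qed.

Lemma grid_minor_sparse : grid_minor G ->
  #|[set p in finset.setX S S | sedge p.1 p.2]| <= 6 * #|S|.
Proof.
move=> /induced_grid_minor /grid_minor_edge_bound; rewrite card_sig /=.
have -> : #|[pred x | x \in S]| = #|S| by apply: eq_card.
apply: leq_trans.
rewrite -(card_imset _ (f := fun p : induced * induced => (val p.1, val p.2))); last first.
  by move=> [a b] [a' b'] [/val_inj -> /val_inj ->].
apply/subset_leq_card/fintype.subsetP => -[x y]; rewrite !inE /= => /andP[/andP[xS yS] xy].
by apply/imsetP; exists (exist _ x xS, exist _ y yS); rewrite // inE.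
Qed.
End InducedSubgraph.

Lemma induct_set (T : finType) (P : {set T} -> Prop) :
  P finset.set0 -> (forall S : {set T}, S != finset.set0 -> (forall S' : {set T}, S' \proper S -> P S') -> P S) ->
  forall S, P S.
Proof.
move=> P0 IH S; have [n] := ubnP #|S|; elim: n S => // n IHn S; rewrite ltnS => Sn.
have [->//|S0] := eqVneq S finset.set0; apply: IH => // S' /proper_card lt.
by apply: IHn; apply: leq_trans Sn.
Qed.

Definition is_clique (G : sgraph) (Q : {set G}) : bool :=
  [forall x in Q, forall y in Q, (x != y) ==> sedge x y].

Lemma card_cliques (G : sgraph) (S : {set G}) : grid_minor G ->
  #|[set Q in powerset S | is_clique Q]| <= 64 * #|S| + 1.
Proof.
move=> gG; move: S; apply: induct_set => [|S S0 IH].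
  rewrite cards0 muln0 powerset0.
  by apply: leq_trans (subset_leq_card (_ : _ \subset [set finset.set0])) _;
    [apply/fintype.subsetP => Q; rewrite inE => /andP[]|rewrite cards1].
have [x xS dx] : exists2 x, x \in S & #|[set y in S | sedge x y]| <= 6.
  apply/exists_inP; apply: contraT; rewrite negb_exists_in => /forall_inP H.
  have E : \sum_(x in S) #|[set y in S | sedge x y]| =
      #|[set p in finset.setX S S | sedge p.1 p.2]|.
    rewrite -[RHS]sum1_card (eq_bigl (fun p : G * G => (p.1 \in S) && ((p.2 \in S) && sedge p.1 p.2))).
      rewrite -(pair_big_dep (fun x => x \in S) (fun x y => (y \in S) && sedge x y) (fun _ _ => 1)) /=.
      by apply: eq_bigr => y _; rewrite sum1_card cardsE.
    by move=> [a b]; rewrite !inE /= andbA.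
  have := grid_minor_sparse S gG; rewrite -E.
  have : \sum_(x in S) 7 <= \sum_(x in S) #|[set y in S | sedge x y]|.
    by apply: leq_sum => x /H; rewrite -ltnNge.
  rewrite sum_nat_const; move: S0; rewrite -card_gt0; lia.
have := IH _ (finset.properD1 xS); set C' := [set Q in powerset (S :\ x) | _] => hC'.
set N := [set y in S | sedge x y] in dx.
have sub : [set Q in powerset S | is_clique Q] \subset C' :|: [set x |: Q | Q in powerset N].
  apply/fintype.subsetP => Q; rewrite !inE => /andP[QS Qc].
  have [xQ|xQ] := boolP (x \in Q); last first.
    by apply/orP; left; rewrite Qc andbT finset.subsetD1 QS xQ.
  apply/orP; right; apply/imsetP; exists (Q :\ x); last by rewrite finset.setD1K.
  rewrite inE; apply/fintype.subsetP => y; rewrite !inE => /andP[yx yQ].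
  rewrite (fintype.subsetP QS _ yQ) /=.
  by have /forall_inP/(_ _ xQ)/forall_inP/(_ _ yQ)/implyP := Qc; apply; rewrite eq_sym.
apply: leq_trans (subset_leq_card sub) _; rewrite cardsU.
apply: leq_trans (leq_subr _ _) _.
have h2 : #|[set x |: Q | Q in powerset N]| <= 2 ^ 6.
  apply: leq_trans (leq_imset_card _ _) _; rewrite card_powerset.
  by rewrite leq_exp2l.
rewrite (cardsD1 x S) xS; apply: leq_trans (leq_add hC' h2) _; lia.
Qed.

Section Neighbourhoods.
Variables (G : sgraph) (A : {set G}).
Hypothesis gG : grid_minor G.
Hypothesis indep : forall x y, x \notin A -> y \notin A -> ~~ sedge x y.

Let valid (p : {ffun G -> G}) : bool :=
  [forall x, if x \in A then p x == x else (p x == x) || (p x \in A) && sedge x (p x)].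

Let adj (p : {ffun G -> G}) (u v : G) : bool :=
  [exists x, exists y, [&& p x == u, p y == v & sedge x y]].

Let assigned (p : {ffun G -> G}) : {set G} := [set x | (x \notin A) && (p x \in A)].

Let edges (p : {ffun G -> G}) : {set G * G} :=
  [set e | [&& e.1 \in A, e.2 \in A, e.1 != e.2 & adj p e.1 e.2]].

Section Assigned.
Variable p : {ffun G -> G}.

Let aedge (u v : {x : G | x \in A}) := (u != v) && adj p (val u) (val v).

Lemma adjC u v : adj p u v = adj p v u.
Proof.
by apply/existsP/existsP => -[x /existsP[y /and3P[h1 h2 h3]]];
  exists y; apply/existsP; exists x; rewrite h1 h2 sedge_sym.
Qed.

Lemma aedge_sym : symmetric aedge.
Proof. by move=> u v; rewrite /aedge eq_sym adjC. Qed.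

Lemma aedge_irr : irreflexive aedge.
Proof. by move=> u; rewrite /aedge eqxx. Qed.

Definition assigned_graph : sgraph := SGraph aedge_sym aedge_irr.

Hypothesis vp : valid p.

Lemma valid_in x : x \in A -> p x = x.
Proof. by move=> xA; have := forallP vp x; rewrite xA => /eqP. Qed.

Lemma valid_out x : p x \in A -> p x != x -> sedge x (p x).
Proof.
move=> pA ne; have := forallP vp x; rewrite pA (negPf ne) /=.
by case: ifP => // xA; rewrite (valid_in xA) eqxx in ne.
Qed.

Lemma assigned_grid_minor : grid_minor assigned_graph.
Proof.
apply: (@grid_minor_trans G assigned_graph (fun x => insub (p x)) gG); split.
- by move=> u; exists (val u); rewrite valid_in ?valK // (valP u).
- have fib x (u : assigned_graph) : insub (p x) = Some u -> p x = val u /\ (x = val u \/ sedge x (val u)).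
    case: insubP => // v pA vE [<-]; rewrite vE; split=> //.
    have [E|ne] := eqVneq (p x) x; [by left|right].
    exact: valid_out.
  move=> u x y xu yu; have [_ hx] := fib _ _ xu; have [_ hy] := fib _ _ yu.
  have uu : insub (p (val u)) = Some u by rewrite valid_in ?valK // (valP u).
  have [q [pq lq aq]] : exists q, [/\ path (@sedge G) (val u) q, last (val u) q = y
      & all (fun z => insub (p z) == Some u) q].
    by case: hy => [->|yu']; [exists [::]|exists [:: y]; rewrite /= sedge_sym yu' yu eqxx].
  case: hx => [->|xu']; first by exists q.
  by exists (val u :: q); rewrite /= xu' pq lq uu eqxx aq.
- move=> u v /andP[_ /existsP[x /existsP[y /and3P[/eqP pu /eqP pv xy]]]].
  by exists x, y; rewrite pu pv !valK.
Qed.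

Lemma card_edges : #|edges p| <= 6 * #|A|.
Proof.
have := grid_minor_edge_bound assigned_grid_minor; rewrite card_sig /=.
have -> : #|[pred x | x \in A]| = #|A| by apply: eq_card.
apply: leq_trans.
rewrite -(card_imset _ (f := fun e : assigned_graph * assigned_graph => (val e.1, val e.2))); last first.
  by move=> [a b] [a' b'] [/val_inj -> /val_inj ->].
apply/subset_leq_card/fintype.subsetP => -[x y]; rewrite !inE /= => /and4P[xA yA xy a].
apply/imsetP; exists (exist (fun x => is_true (x \in A)) x xA, exist (fun x => is_true (x \in A)) y yA) => //.
by rewrite inE /= /aedge a andbT; apply: contra xy => /eqP [->].
Qed.
End Assigned.

Let N (b : G) := [set z | sedge b z].

Lemma card_neighbourhoods : #|[set N b | b in ~: A]| <= 67 * #|A| + 1.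
Proof.
pose good p := valid p && (2 * #|assigned p| <= #|edges p|).
have g0 : good [ffun x => x].
  apply/andP; split; first by apply/forallP => x; rewrite !ffunE eqxx; case: ifP.
  have -> : assigned [ffun x => x] = finset.set0.
    by apply/setP => x; rewrite !inE ffunE; case: (x \in A).
  by rewrite cards0.
case: (arg_maxnP (fun p => #|assigned p|) g0) => p /andP[vp gp] pmax.
have h1 : #|assigned p| <= 3 * #|A| by have := card_edges vp; lia.
have NA b : b \notin A -> N b \subset A.
  move=> bA; apply/fintype.subsetP => z; rewrite inE; apply: contraTT => zA.
  exact: indep.
have clique b u v : b \notin A -> p b \notin A -> u \in N b -> v \in N b -> u != v -> adj p u v.
  move=> bA pbA uN vN uv; apply: contraT => nadj.
  have uA := fintype.subsetP (NA _ bA) _ uN; have vA := fintype.subsetP (NA _ bA) _ vN.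
  rewrite !inE in uN vN.
  pose q := [ffun x => if x == b then u else p x].
  have bneq x : x \in A -> (x == b) = false by move=> xA; apply: contraNF bA => /eqP <-.
  have vq : valid q.
    apply/forallP => x; rewrite ffunE; have [->|xb] := eqVneq x b; last exact: (forallP vp x).
    by rewrite (negPf bA) uA uN orbT.
  have aq : assigned q = b |: assigned p.
    apply/setP => x; rewrite !inE ffunE; have [->|xb] := eqVneq x b; last by [].
    by rewrite bA uA.
  have adjq : adj q u v.
    by apply/existsP; exists b; apply/existsP; exists v; rewrite !ffunE eqxx bneq // valid_in // !eqxx.
  have eq_ : (u, v) |: ((v, u) |: edges p) \subset edges q.
    apply/fintype.subsetP => -[x y]; rewrite !inE => /or3P[/eqP[-> ->]|/eqP[-> ->]|].
    - by rewrite uA vA uv.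
    - by rewrite uA vA eq_sym uv adjC.
    - move=> /= /and4P[xA yA xy /existsP[x' /existsP[y' /and3P[/eqP px /eqP py xy']]]].
      rewrite xA yA xy; apply/existsP; exists x'; apply/existsP; exists y'.
      have x'b : (x' == b) = false by apply: contraNF pbA => /eqP <-; rewrite px.
      have y'b : (y' == b) = false by apply: contraNF pbA => /eqP <-; rewrite py.
      by rewrite !ffunE x'b y'b px py !eqxx.
  have nuv : (u, v) \notin (v, u) |: edges p.
    by rewrite !inE /= xpair_eqE negb_or (negPf uv) (negPf nadj) !andbF.
  have nvu : (v, u) \notin edges p by rewrite !inE /= adjC (negPf nadj) !andbF.
  have nb : b \notin assigned p by rewrite !inE (negPf pbA) andbF.
  have gq : good q.
    rewrite /good vq aq cardsU1 nb; apply: leq_trans (subset_leq_card eq_).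
    by rewrite cardsU1 nuv cardsU1 nvu /= !add1n mulnS add2n !ltnS.
  by have := pmax q gq; rewrite aq cardsU1 nb /= ltnn.
pose K := [set Q in powerset [set: assigned_graph p] | is_clique Q].
have hK : #|K| <= 64 * #|A| + 1.
  have := card_cliques [set: assigned_graph p] (assigned_grid_minor vp).
  rewrite cardsT card_sig /=.
  by have -> : #|[pred x | x \in A]| = #|A| by apply: eq_card.
have sub : [set N b | b in ~: A] \subset
    [set N b | b in assigned p] :|: [set [set val x | x in Q : {set assigned_graph p}] | Q in K].
  apply/fintype.subsetP => _ /imsetP[b + ->]; rewrite !inE => bA.
  have [pb|pb] := boolP (p b \in A); first by rewrite imset_f // inE bA pb.
  apply/orP; right; apply/imsetP; exists [set x : assigned_graph p | val x \in N b].
    rewrite !inE; apply/andP; split; first by apply/fintype.subsetP => x; rewrite inE.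
    apply/forall_inP => x; rewrite inE => xN; apply/forall_inP => y; rewrite inE => yN.
    by apply/implyP => xy; apply/andP; split=> //; exact: (clique b).
  apply/setP => z; apply/idP/imsetP => [zN|[x xN ->]]; last by rewrite inE in xN.
  have zA := fintype.subsetP (NA _ bA) _ zN.
  by exists (exist (fun x => is_true (x \in A)) z zA) => //; rewrite inE.
apply: leq_trans (subset_leq_card sub) _; rewrite cardsU.
apply: leq_trans (leq_subr _ _) _.
apply: leq_trans (leq_add (leq_imset_card _ _) (leq_imset_card _ _)) _.
by apply: leq_trans (leq_add h1 hK) _; rewrite addnA -mulnDl.
Qed.
End Neighbourhoods.

Lemma halving (G : sgraph) : grid_minor G -> 10 <= #|G| ->
  exists (H : sgraph) (p : G -> H) (top : pred G),
    [/\ grid_minor H, forall x y, p x = p y -> top x = top y -> x = y,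
        forall u, exists x, p x = u /\ top x,
        forall x y, sedge x y -> p x = p y \/ sedge (p x) (p y)
      & 2000 * #|H| <= 1999 * #|G|].
Proof.
move=> gG n10.
have fin (s : G -> G) (sK : involutive s) : grid_minor (fold_graph sK) ->
    2000 * #|fold_graph sK| <= 1999 * #|G| ->
  exists (H : sgraph) (p : G -> H) (top : pred G),
    [/\ grid_minor H, forall x y, p x = p y -> top x = top y -> x = y,
        forall u, exists x, p x = u /\ top x,
        forall x y, sedge x y -> p x = p y \/ sedge (p x) (p y)
      & 2000 * #|H| <= 1999 * #|G|].
  move=> gH cH; exists (fold_graph sK), (fold sK), (fun x => enum_rank x <= enum_rank (s x)).
  by split; [| exact: fold_top_inj | exact: fold_top_surj | exact: fold_edge |].
have [s [sK sM sF]] := maximal_matching (@sedge_sym G) (@sedge_irrefl G).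
pose A := [set x | s x != x].
have [big|small] := leqP #|G| (1000 * #|A|).
  refine (fin s sK (fold_contract sK sM gG) _).
  by have := card_fold sK; rewrite -/A; move: big; clear; lia.
have indep x y : x \notin A -> y \notin A -> ~~ sedge x y.
  by rewrite !inE !negbK => /eqP sx /eqP sy; exact: sF.
have hN := card_neighbourhoods gG indep.
pose N (b : G) := [set z | sedge b z].
pose r x y := [&& x != y, x \notin A, y \notin A & N x == N y].
have rS : symmetric r.
  move=> x y; rewrite /r eq_sym [N x == _]eq_sym; congr (_ && _).
  by case: (x \notin A); case: (y \notin A).
have rI : irreflexive r by move=> x; rewrite /r eqxx.
have [s2 [s2K s2M s2F]] := maximal_matching rS rI.
have tw x z : sedge (s2 x) z = sedge x z.
  have [->//|/s2M /and4P[_ _ _ /eqP/setP/(_ z)]] := eqVneq (s2 x) x.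
  by rewrite !inE.
refine (fin s2 s2K (fold_twins s2K tw gG) _).
have := card_fold s2K; set M := [set x | s2 x != x].
pose F := ~: A :\: M.
have hF : #|F| <= 67 * #|A| + 1.
  apply: leq_trans hN; rewrite -(card_in_imset (f := N) (D := F)).
    apply/subset_leq_card/fintype.subsetP => _ /imsetP[b bF ->].
    by apply: imset_f; move: bF; rewrite inE => /andP[].
  move=> x y; rewrite !inE !negbK => /andP[/eqP sx xA] /andP[/eqP sy yA] Nxy.
  apply/eqP; have := s2F x y sx sy; rewrite /r !inE !negbK xA yA Nxy eqxx !andbT negbK //.
have cov : #|G| <= #|M| + (#|A| + #|F|).
  rewrite -cardsT; have -> : [set: G] = M :|: (A :|: F).
    by apply/setP => x; rewrite !inE; case: (s2 x == x); case: (s x == x).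
  rewrite cardsU; apply: leq_trans (leq_subr _ _) _; rewrite leq_add2l.
  by rewrite cardsU; exact: leq_subr.
move: hF cov small n10; clear; lia.
Qed.

Fixpoint subs (T : Type) (s : seq T) : seq (seq T) :=
  if s is x :: s' then subs s' ++ map (cons x) (subs s') else [:: [::]].

Lemma size_subs (T : Type) (s : seq T) : size (subs s) = 2 ^ size s.
Proof. by elim: s => //= x s IH; rewrite size_cat size_map IH expnS mul2n addnn. Qed.

Lemma filter_subs (T : eqType) (a : pred T) (s : seq T) : seq.filter a s \in subs s.
Proof.
elim: s => //= x s IH; rewrite mem_cat; case: ifP => _; last by rewrite IH.
by rewrite map_f ?orbT.
Qed.

Definition is_code (G : sgraph) (n : nat) (e : seq (nat * nat)) : Prop :=
  exists f : G -> nat, [/\ injective f, forall x, f x < n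
    & forall x y, sedge x y = ((f x, f y) \in e)].

Definition clean (n : nat) (e : seq (nat * nat)) : seq (nat * nat) :=
  [seq p <- undup e | (p.1 < n) && (p.2 < n)].

Lemma code_surj (G : sgraph) (f : G -> nat) : injective f -> (forall x, f x < #|G|) ->
  forall a, a < #|G| -> exists x, f x = a.
Proof.
move=> fI fn a an; pose f' x := Ordinal (fn x).
have f'I : injective f' by move=> x y [/fI].
have [|g _ gK] := inj_card_bij f'I; first by rewrite card_ord.
by exists (g (Ordinal an)); have /(congr1 val) := gK (Ordinal an).
Qed.

Lemma clean_code (G : sgraph) (e : seq (nat * nat)) : grid_minor G ->
  is_code G #|G| e -> is_code G #|G| (clean #|G| e) /\ size (clean #|G| e) <= 6 * #|G|.
Proof.
move=> gG [f [fI fn fe]]; split.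
  by exists f; split=> // x y; rewrite mem_filter /= !fn mem_undup fe.
apply: leq_trans (grid_minor_edge_bound gG); rewrite cardE.
rewrite -(size_map (fun p : G * G => (f p.1, f p.2))); apply: uniq_leq_size.
  by rewrite filter_uniq // undup_uniq.
move=> [a b]; rewrite mem_filter mem_undup /= => /andP[/andP[an bn] abe].
have [x xa] := code_surj fI fn an; have [y yb] := code_surj fI fn bn.
by apply/mapP; exists (x, y); rewrite /= ?xa ?yb // mem_enum inE /= fe xa yb.
Qed.

Definition doubled (n : nat) (D : seq nat) (a : nat) (b : bool) : nat :=
  if b then a else n + index a D.

Definition decode (n : nat) (D : seq nat) (X : seq ((nat * nat) * (bool * bool))) :=
  [seq (doubled n D c.1.1 c.2.1, doubled n D c.1.2 c.2.2) | c <- X].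

Definition cands (n : nat) (e : seq (nat * nat)) :=
  [seq (ab, st) | ab <- e ++ [seq (i, i) | i <- iota 0 n],
     st <- [:: (true, true); (true, false); (false, true); (false, false)]].

Lemma size_cands n e : size (cands n e) = 4 * (size e + n).
Proof. by rewrite size_allpairs size_cat size_map size_iota mulnC. Qed.

Lemma decode_code (G H : sgraph) (p : G -> H) (top : pred G) (e : seq (nat * nat)) :
  (forall x y, p x = p y -> top x = top y -> x = y) ->
  (forall u, exists x, p x = u /\ top x) ->
  (forall x y, sedge x y -> p x = p y \/ sedge (p x) (p y)) ->
  is_code H #|H| e ->
  exists D, exists2 X, D \in subs (iota 0 #|H|) /\ X \in subs (cands #|H| e)
    & is_code G #|G| (decode #|H| D X).
Proof.
move=> inj sur edg [f [fI fn fe]]; set n := #|H| in fn *.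
pose D := [seq a <- iota 0 n | [exists x, ~~ top x && (f (p x) == a)]].
pose g x := doubled n D (f (p x)) (top x).
pose X := [seq c <- cands n e | [exists x, exists y, sedge x y &&
  (c == ((f (p x), f (p y)), (top x, top y)))]].
have inD x : ~~ top x -> f (p x) \in D.
  move=> tx; rewrite mem_filter mem_iota /= add0n fn andbT.
  by apply/existsP; exists x; rewrite tx eqxx.
have gI : injective g.
  move=> x y; rewrite /g /doubled; case tx: (top x); case ty: (top y) => E.
  - by apply: inj; rewrite ?tx ?ty //; exact: fI.
  - by have := fn (p x); rewrite E ltnNge leq_addr.
  - by have := fn (p y); rewrite -E ltnNge leq_addr.
  - move/addnI: E => E; apply: inj; rewrite ?tx ?ty //; apply: fI.
    rewrite -[LHS](nth_index 0 (inD x _)) ?tx // -[RHS](nth_index 0 (inD y _)) ?ty //.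
    by rewrite E.
exists D, X; first by split; exact: filter_subs.
exists g; split=> //.
- have h1 : n <= #|[pred x | top x]|.
    have <- : #|[set p x | x in [pred x | top x]]| = n.
      rewrite /n -cardsT; congr #|pred_of_set _|; apply/setP => u; rewrite inE.
      by apply/imsetP; have [x [xu tx]] := sur u; exists x.
    exact: leq_imset_card.
  have h2 : size D <= #|[predC top]|.
    rewrite cardE -(size_map (f \o p)); apply: uniq_leq_size.
      by rewrite filter_uniq // iota_uniq.
    move=> a; rewrite mem_filter => /andP[/existsP[x /andP[tx /eqP <-]] _].
    by apply/mapP; exists x => //; rewrite mem_enum.
  have h3 : n + size D <= #|G|.
    by rewrite -(cardC top); apply: leq_add.
  move=> x; apply: leq_trans h3; rewrite /g /doubled; case tx: (top x).
    exact: leq_trans (fn _) (leq_addr _ _).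
  by rewrite ltn_add2l index_mem inD ?tx.
- move=> x y; apply/idP/mapP => [xy|[c]].
    exists ((f (p x), f (p y)), (top x, top y)) => //.
    rewrite mem_filter; apply/andP; split.
      by apply/existsP; exists x; apply/existsP; exists y; rewrite xy eqxx.
    apply: allpairs_f; last by case: (top x); case: (top y).
    rewrite mem_cat; case: (edg _ _ xy) => [->|]; last by rewrite fe => ->.
    by apply/orP; right; apply/mapP; exists (f (p y)); rewrite // mem_iota add0n fn.
  rewrite mem_filter => /andP[/existsP[x' /existsP[y' /andP[xy' /eqP ->]]] _] /= [].
  by move=> /gI -> /gI ->.
Qed.

Lemma size_flatten_map (S : eqType) (T : Type) (F : S -> seq T) (s : seq S) (B : nat) :
  (forall x, x \in s -> size (F x) <= B) -> size (flatten [seq F x | x <- s]) <= size s * B.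
Proof.
elim: s => //= x s IH H; rewrite size_cat mulSn leq_add ?H ?inE ?eqxx //.
by apply: IH => y ys; apply: H; rewrite inE ys orbT.
Qed.

Lemma graph_code (G : sgraph) :
  exists2 e, e \in subs [seq (i, j) | i <- iota 0 #|G|, j <- iota 0 #|G|] & is_code G #|G| e.
Proof.
pose f (x : G) : nat := enum_rank x.
have fn x : f x < #|G| by exact: ltn_ord.
have fI : injective f by move=> x y /val_inj/enum_rank_inj.
exists [seq p <- [seq (i, j) | i <- iota 0 #|G|, j <- iota 0 #|G|]
  | [exists x, exists y, sedge x y && (p == (f x, f y))]]; first exact: filter_subs.
exists f; split=> // x y; rewrite mem_filter; apply/idP/andP => [xy|[]].
  split; last by rewrite allpairs_f // mem_iota add0n fn.
  by apply/existsP; exists x; apply/existsP; exists y; rewrite xy eqxx.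
by move=> /existsP[x' /existsP[y' /andP[xy' /eqP[/fI-> /fI->]]]].
Qed.

Lemma grid_minor_codes_aux (K : nat) : 60 * 1000 <= K -> forall n,
  exists L : seq (seq (nat * nat)), size L <= 2 ^ (K * n) /\
    forall G, grid_minor G -> #|G| = n -> exists2 e, e \in L & is_code G n e.
Proof.
move=> K60 n; have [m] := ubnP n; elim: m n => // m IH n; rewrite ltnS => nm.
have [n10|n10] := ltnP n 10.
  exists (subs [seq (i, j) | i <- iota 0 n, j <- iota 0 n]); split.
    rewrite size_subs size_allpairs !size_iota leq_exp2l // leq_mul2r.
    by apply/orP; right; apply: leq_trans K60; apply: leq_trans (ltnW n10) _.
  by move=> G _ <-; exact: graph_code.
have /boolp.choice [Lf LfP] (k : nat) : exists L : seq (seq (nat * nat)), k < n ->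
    size L <= 2 ^ (K * k) /\
    forall G, grid_minor G -> #|G| = k -> exists2 e, e \in L & is_code G k e.
  have [kn|_] := ltnP k n; last by exists [::].
  by have [L LP] := IH k (leq_trans kn nm); exists L.
pose ms := [seq k <- iota 0 n | 2000 * k <= 1999 * n].
pose Es k := [seq e <- [seq clean k e | e <- Lf k] | size e <= 6 * k].
pose Ds k e := [seq decode k D X | D <- subs (iota 0 k), X <- subs (cands k e)].
exists (flatten [seq flatten [seq Ds k e | e <- Es k] | k <- ms]); split.
  apply: (@leq_trans (n * 2 ^ (K * n - n))).
    apply: (@leq_trans (size ms * 2 ^ (K * n - n))); last first.
      rewrite leq_mul2r; apply/orP; right.
      by rewrite size_filter; apply: leq_trans (count_size _ _) _; rewrite size_iota.
    apply: size_flatten_map => k; rewrite mem_filter mem_iota add0n => /and3P[kn _ ltkn].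
    apply: (@leq_trans (size (Es k) * 2 ^ (29 * k))).
      apply: size_flatten_map => e; rewrite mem_filter => /andP[se _].
      rewrite size_allpairs !size_subs size_iota size_cands -expnD leq_exp2l //.
      by move: se; clear; lia.
    apply: (@leq_trans (2 ^ (K * k) * 2 ^ (29 * k))).
      rewrite leq_mul2r; apply/orP; right; rewrite size_filter.
      apply: leq_trans (count_size _ _) _; rewrite size_map.
      by case: (LfP k ltkn).
    rewrite -expnD leq_exp2l // leq_subRL; last first.
      by apply: leq_pmull; apply: leq_trans K60.
    rewrite -(leq_pmul2l (m := 2000)) //.
    have h : 2000 * k * (K + 29) <= 1999 * n * (K + 29) by rewrite leq_mul2r kn orbT.
    have h' : (60 * 1000) * n <= K * n by rewrite leq_mul2r K60 orbT.
    by move: h h'; clear; lia.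
  have nK : n <= K * n by apply: leq_pmull; apply: leq_trans K60.
  rewrite -{2}(subnK nK) expnD mulnC leq_mul2l; apply/orP; right.
  by apply/ltnW/ltn_expl.
move=> G gG Gn; rewrite -Gn in n10.
have [H [p [top [gH inj sur edg small]]]] := halving gG n10.
rewrite Gn in small n10.
have Hn : #|H| < n by move: small n10; clear; lia.
have [_ /(_ H gH erefl) [e eL ecode]] := LfP _ Hn.
have [ccode csize] := clean_code gH ecode.
have [D [X [DP XP] code]] := decode_code inj sur edg ccode.
rewrite Gn in code; exists (decode #|H| D X) => //.
apply/flatten_mapP; exists #|H|; first by rewrite mem_filter small mem_iota add0n.
apply/flatten_mapP; exists (clean #|H| e).
  by rewrite mem_filter csize map_f.
exact: allpairs_f.
Qed.

Lemma grid_minor_codes : exists K, forall n,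
  exists L : seq (seq (nat * nat)), size L <= 2 ^ (K * n) /\
    forall G, grid_minor G -> #|G| = n -> exists2 e, e \in L & is_code G n e.
Proof. by exists (60 * 1000); exact: grid_minor_codes_aux. Qed.

(** * Gluing and independent sets *)

Section GluedIndependentSets.
Variables (t : nat) (G F : bgraph t).
Local Open Scope quotient_scope.

Lemma independentP (K : sgraph) (S : {set K}) :
  reflect (forall x y, x \in S -> y \in S -> ~~ sedge x y) (independent S).
Proof.
apply: (iffP forall_inP) => H x; last by move=> xS; apply/forall_inP => y; exact: H.
by move=> y xS yS; have /forall_inP := H x xS; apply.
Qed.

Lemma leq_opt_IS (K : sgraph) (S : {set K}) : independent S -> #|S| <= opt_IS K.
Proof. by move=> iS; rewrite /opt_IS (bigD1 S) //= leq_maxl. Qed.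

Definition interior (J : {set F}) : {set F} := [set y in J | [forall i, y != bd F i]].

Definition compatible (I : {set G}) (J : {set F}) : Prop :=
  [/\ independent I, independent J & forall i, (bd G i \in I) = (bd F i \in J)].

Let pil (x : G) : gluing G F := \pi_(glue_vertex G F) (inl x).
Let pir (y : F) : gluing G F := \pi_(glue_vertex G F) (inr y).

Lemma pilP x x' : pil x = pil x' -> x = x'.
Proof. by move=> /eqmodP /eqP. Qed.

Lemma pirP y y' : pir y = pir y' -> y = y'.
Proof. by move=> /eqmodP /eqP. Qed.

Lemma pilrP x y : pil x = pir y -> exists i, x = bd G i /\ y = bd F i.
Proof. by move=> /eqmodP /existsP[i /andP[/eqP-> /eqP->]]; exists i. Qed.

Lemma pi_bd i : pil (bd G i) = pir (bd F i).
Proof. by apply/eqmodP/existsP; exists i; rewrite !eqxx. Qed.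

Lemma pi_cover (u : gluing G F) : (exists x, u = pil x) \/ (exists y, u = pir y).
Proof.
rewrite -[u](@reprK _ (glue_vertex G F)); case: (repr u) => [x|y]; first by left; exists x.
by right; exists y.
Qed.

Lemma opt_gluing_leq k :
  (forall I J, compatible I J -> #|I| + #|interior J| <= k) -> opt_IS (gluing G F) <= k.
Proof.
move=> H; apply/bigmax_leqP => S /independentP iS.
pose I := [set x | pil x \in S]; pose J := [set y | pir y \in S].
have cIJ : compatible I J.
  split.
  - apply/independentP => x y; rewrite !inE => xS yS; apply: contra (iS _ _ xS yS) => xy.
    by apply/existsP; exists (inl x); apply/existsP; exists (inl y); rewrite !eqxx.
  - apply/independentP => x y; rewrite !inE => xS yS; apply: contra (iS _ _ xS yS) => xy.
    by apply/existsP; exists (inr x); apply/existsP; exists (inr y); rewrite !eqxx.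
  - by move=> i; rewrite !inE pi_bd.
apply: leq_trans (H _ _ cIJ).
have sub : S \subset [set pil x | x in I] :|: [set pir y | y in interior J].
  apply/fintype.subsetP => u uS; rewrite inE; have [[x E]|[y E]] := pi_cover u.
    by rewrite E imset_f // inE -E.
  have [/forallP nb|] := boolP [forall i, y != bd F i].
    by rewrite orbC E imset_f // !inE -E uS; apply/forallP.
  rewrite negb_forall => /existsP[i]; rewrite negbK => /eqP yi.
  by rewrite E yi -pi_bd imset_f // inE pi_bd -yi -E.
apply: leq_trans (subset_leq_card sub) _; rewrite cardsU.
apply: leq_trans (leq_subr _ _) _.
by apply: leq_add; exact: leq_imset_card.
Qed.

Lemma leq_opt_gluing I J : compatible I J -> #|I| + #|interior J| <= opt_IS (gluing G F).
Proof.
move=> [/independentP iI /independentP iJ cIJ].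
pose S : {set gluing G F} := [set pil x | x in I] :|: [set pir y | y in interior J].
have nbd y : y \in interior J -> forall i, y <> bd F i.
  by rewrite inE => /andP[_ /forallP H] i E; move: (H i); rewrite E eqxx.
have SI x : pil x \in S -> x \in I.
  rewrite inE => /orP[/imsetP[x' x'I /pilP ->]//|/imsetP[y yJ /pilrP[i [_ E]]]].
  by case: (nbd _ yJ i).
have SJ y : pir y \in S -> y \in J.
  rewrite inE => /orP[/imsetP[x xI /esym/pilrP[i [E ->]]]|/imsetP[y' + /pirP ->]].
    by rewrite -cIJ -E.
  by rewrite inE => /andP[].
have -> : #|I| + #|interior J| = #|S|.
  rewrite cardsU !card_imset; [|exact: pirP|exact: pilP].
  have -> : [set pil x | x in I] :&: [set pir y | y in interior J] = finset.set0.
    apply/setP => u; rewrite !inE; apply/negP => /andP[/imsetP[x _ ->] /imsetP[y yJ /pilrP[i [_]]]].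
    exact: nbd.
  by rewrite cards0 subn0.
apply: leq_opt_IS; apply/independentP => u v uS vS; apply/negP.
move=> /existsP[x /existsP[y /and3P[/eqP xu /eqP yv]]].
case: x y xu yv => [x|x] [y|y] //= xu yv.
  by apply/negP/iI; apply: SI; rewrite /pil ?xu ?yv.
by apply/negP/iJ; apply: SJ; rewrite /pir ?xu ?yv.
Qed.

End GluedIndependentSets.

Section BoundariedIsomorphism.
Variables (t : nat).

Lemma opt_gluing_embedding (G H F : bgraph t) (f : G -> H) : injective f ->
  (forall x y, sedge (f x) (f y) = sedge x y) -> (forall i, f (bd G i) = bd H i) ->
  opt_IS (gluing G F) <= opt_IS (gluing H F).
Proof.
move=> fI fe fb; apply: opt_gluing_leq => I J [/independentP iI iJ c].
rewrite -(card_imset _ fI); apply: leq_opt_gluing; split=> //.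
  by apply/independentP => _ _ /imsetP[x xI ->] /imsetP[y yI ->]; rewrite fe; exact: iI.
by move=> i; rewrite -c -fb mem_imset.
Qed.

Lemma equiv_IS_sym (G H : bgraph t) : equiv_IS G H -> equiv_IS H G.
Proof. by move=> [D HD]; exists (- D)%R => F; rewrite HD; lia. Qed.

Lemma equiv_IS_trans (G H K : bgraph t) : equiv_IS G H -> equiv_IS H K -> equiv_IS G K.
Proof. by move=> [D HD] [D' HD']; exists (D' + D)%R => F; rewrite HD HD'; lia. Qed.

Lemma isomorphic_equiv_IS (G H : bgraph t) (f : G -> H) (g : H -> G) :
  cancel f g -> cancel g f ->
  (forall x y, sedge (f x) (f y) = sedge x y) -> (forall i, f (bd G i) = bd H i) ->
  equiv_IS G H.
Proof.
move=> fK gK fe fb; exists 0%R => F; rewrite addr0; congr Posz; apply/eqP.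
rewrite eqn_leq; apply/andP; split.
  exact: (opt_gluing_embedding F (can_inj fK) fe fb).
apply: (opt_gluing_embedding F (can_inj gK)) => [x y|i].
  by rewrite -fe !gK.
by rewrite -fb fK.
Qed.
End BoundariedIsomorphism.

Section PendantTest.
Variable t : nat.

Let PV := ('I_t + 'I_t * bool)%type.

Let pedge (S : {set 'I_t}) (x y : PV) : bool :=
  match x, y with
  | inl i, inr (j, _) => (i == j) && (i \notin S)
  | inr (j, _), inl i => (i == j) && (i \notin S)
  | _, _ => false
  end.

Lemma pedge_sym S : symmetric (pedge S).
Proof. by move=> [i|[i b]] [j|[j c]]. Qed.

Lemma pedge_irr S : irreflexive (pedge S).
Proof. by move=> [i|[i b]]. Qed.

Lemma inl_inj_ord : injective (inl : 'I_t -> PV).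
Proof. by move=> i j []. Qed.

Definition pendant_test (S : {set 'I_t}) : bgraph t :=
  @BGraph t (SGraph (pedge_sym S) (pedge_irr S)) inl inl_inj_ord.

Definition restricted (G : bgraph t) (S : {set 'I_t}) (I : {set G}) : bool :=
  independent I && [forall i, (bd G i \in I) ==> (i \in S)].

Definition opt_restricted (G : bgraph t) (S : {set 'I_t}) : nat :=
  \max_(I : {set G} | restricted S I) #|I|.

Lemma opt_pendant_test (G : bgraph t) (S : {set 'I_t}) :
  opt_IS (gluing G (pendant_test S)) = opt_restricted G S + 2 * t.
Proof.
have inrI : injective (inr : 'I_t * bool -> pendant_test S) by move=> x y [].
apply/eqP; rewrite eqn_leq; apply/andP; split.
- apply: opt_gluing_leq => I J [iI /independentP iJ c].
  pose T := [set i | (bd G i \in I) && (i \notin S)].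
  pose I' := I :\: [set bd G i | i in T].
  have rI' : restricted S I'.
    apply/andP; split.
      apply/independentP => x y; rewrite !inE => /andP[_ xI] /andP[_ yI].
      exact: (independentP _ iI).
    apply/forallP => i; apply/implyP; rewrite inE => /andP[niT iI'].
    by apply: contraR niT => iS; apply: imset_f; rewrite inE iI' iS.
  have h1 : #|I| <= #|I'| + #|T|.
    rewrite -(cardsID [set bd G i | i in T] I) addnC leq_add2l.
    apply: leq_trans (subset_leq_card (finset.subsetIr _ _)) _; exact: leq_imset_card.
  have h2 : #|interior J| + 2 * #|T| <= 2 * t.
    have -> : 2 * t = #|{: 'I_t * bool}| by rewrite card_prod card_ord card_bool mulnC.
    have -> : 2 * #|T| = #|[set p : 'I_t * bool | p.1 \in T]|.
      rewrite -[LHS]mulnC -[2]card_bool -[#|{: bool}|]cardsT -cardsX; apply: eq_card => p.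
      by rewrite !inE andbT.
    have -> : #|interior J| = #|[set p | (inr p : pendant_test S) \in interior J]|.
      rewrite -(card_imset [set p | (inr p : pendant_test S) \in interior J] inrI).
      apply: eq_card => y; apply/idP/imsetP => [yJ|[p + ->]]; last by rewrite inE.
      case: y yJ => [i|p] yJ; last by exists p; rewrite // inE.
      by move: yJ; rewrite inE => /andP[_ /forallP/(_ i)]; rewrite eqxx.
    rewrite -cardsUI; rewrite [X in _ + X](_ : _ = 0) ?addn0 ?max_card //.
    apply/eqP; rewrite cards_eq0; apply/eqP/setP => -[i b]; rewrite !inE /=.
    apply/negP => /andP[/andP[pJ _] /andP[iI1 iS]].
    have iJ1 : (inl i : pendant_test S) \in J by move: (c i); rewrite /= iI1 => <-.
    by have := iJ _ _ iJ1 pJ; rewrite /sedge /= eqxx iS.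
  have h3 : #|I'| <= opt_restricted G S by rewrite /opt_restricted (bigD1 I') //= leq_maxl.
  by move: h1 h2 h3; clear; lia.
- rewrite /opt_restricted; have [|I rI ->] := eq_bigmax_cond (fun I : {set G} => #|I|) (A := [pred I | restricted S I]).
    apply/card_gt0P; exists finset.set0; rewrite inE /restricted.
    apply/andP; split; first by apply/independentP => x y; rewrite inE.
    by apply/forallP => i; rewrite inE.
  move: rI; rewrite inE => /andP[iI /forallP bI].
  pose J : {set pendant_test S} := [set y | match y with inl i => bd G i \in I | inr _ => true end].
  apply: leq_trans (leq_opt_gluing (_ : compatible I J)); last first.
    split=> //; last by move=> i; rewrite inE.
    apply/independentP => -[i|[i b]] [j|[j b']]; rewrite !inE /sedge //=.
      by move=> iI' _; have /implyP/(_ iI') -> := bI i; rewrite andbF.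
    by move=> _ jI'; have /implyP/(_ jI') -> := bI j; rewrite andbF.
  rewrite leq_add2l.
  have -> : 2 * t = #|{: 'I_t * bool}| by rewrite card_prod card_ord card_bool mulnC.
  rewrite -cardsT -(card_imset [set: 'I_t * bool] inrI).
  apply/subset_leq_card/fintype.subsetP => _ /imsetP[p _ ->]; rewrite !inE /=.
  by apply/forallP.
Qed.

Lemma equiv_IS_opt_restricted (G H : bgraph t) : equiv_IS G H ->
  forall S S', opt_restricted G S + opt_restricted H S' =
               opt_restricted G S' + opt_restricted H S.
Proof.
move=> [D HD] S S'; have := HD (pendant_test S); have := HD (pendant_test S').
rewrite !opt_pendant_test; lia.
Qed.
End PendantTest.

(** * Straight-line drawings *)

Section StraightLineDrawing.
Variable R : realType.
Local Open Scope ring_scope.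
Local Open Scope classical_set_scope.

Definition seg (p q : R * R) (s : R) : R * R :=
  (p.1 + s * (q.1 - p.1), p.2 + s * (q.2 - p.2)).

Definition line_separated (p q r s : R * R) : Prop := exists a b c : R,
  [/\ a * p.1 + b * p.2 <= c, a * q.1 + b * q.2 <= c,
      c < a * r.1 + b * r.2 & c < a * s.1 + b * s.2].

Lemma separated_seg p q r s x y : line_separated p q r s ->
  0 <= x <= 1 -> 0 <= y <= 1 -> seg p q x <> seg r s y.
Proof.
move=> [a [b [c [h1 h2 h3 h4]]]] /andP[x0 x1] /andP[y0 y1] [E1 E2].
have u : (1 - x) * (a * p.1 + b * p.2) + x * (a * q.1 + b * q.2) <= c.
  have e1 : (1 - x) * (a * p.1 + b * p.2) <= (1 - x) * c by rewrite ler_wpM2l // subr_ge0.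
  have e2 : x * (a * q.1 + b * q.2) <= x * c by rewrite ler_wpM2l.
  by move: e1 e2; lra.
have v : c < (1 - y) * (a * r.1 + b * r.2) + y * (a * s.1 + b * s.2).
  have e1 : (1 - y) * c <= (1 - y) * (a * r.1 + b * r.2) by rewrite ler_wpM2l ?subr_ge0 // ltW.
  have e2 : y * c <= y * (a * s.1 + b * s.2) by rewrite ler_wpM2l // ltW.
  have [y00|y00] := eqVneq y 0; first by rewrite y00; lra.
  have e3 : y * c < y * (a * s.1 + b * s.2) by rewrite ltr_pM2l // lt_neqAle eq_sym y00.
  by move: e1 e3; lra.
have e : (1 - x) * (a * p.1 + b * p.2) + x * (a * q.1 + b * q.2) =
    a * (p.1 + x * (q.1 - p.1)) + b * (p.2 + x * (q.2 - p.2)) by ring.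
have e' : (1 - y) * (a * r.1 + b * r.2) + y * (a * s.1 + b * s.2) =
    a * (r.1 + y * (s.1 - r.1)) + b * (r.2 + y * (s.2 - r.2)) by ring.
by move: u v; rewrite e e' E1 E2; lra.
Qed.

Lemma seg_arc p q : p != q -> is_arc p q [set seg p q s | s in `[0, 1]].
Proof.
move=> pq; exists (seg p q); split=> //.
- have c (a b : R) : continuous (fun s : R => a + s * b).
    by move=> s; apply: cvgD; [exact: cvg_cst|apply: cvgM; [exact: cvg_id|exact: cvg_cst]].
  apply: continuous_subspaceT => s.
  exact: (cvg_pair (c p.1 (q.1 - p.1) s) (c p.2 (q.2 - p.2) s)).
- move=> s s' _ _ [/addrI e1 /addrI e2].
  have [E1|n1] := eqVneq q.1 p.1; last by rewrite -subr_eq0 in n1; exact: (mulIf n1 e1).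
  have [E2|n2] := eqVneq q.2 p.2; last by rewrite -subr_eq0 in n2; exact: (mulIf n2 e2).
  by move: pq; rewrite [p]surjective_pairing [q]surjective_pairing E1 E2 eqxx.
- by rewrite /seg !mul0r !addr0 -surjective_pairing.
- by rewrite /seg !mul1r !(addrC _ (_ - _)) !subrK -surjective_pairing.
Qed.

Lemma seg_rev p q s : seg p q s = seg q p (1 - s).
Proof. by rewrite /seg; congr pair; ring. Qed.

Lemma seg0 p q : seg p q 0 = p.
Proof. by rewrite /seg !mul0r !addr0 -surjective_pairing. Qed.

Lemma seg_common p q r x y : line_separated p q r r -> line_separated p r q q ->
  0 <= x <= 1 -> 0 <= y <= 1 -> seg p q x = seg p r y -> seg p q x = p.
Proof.
move=> s1 s2 /andP[x0 x1] /andP[y0 y1] E.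
have [->|xn] := eqVneq x 0; first exact: seg0.
have xp : 0 < x by rewrite lt_neqAle eq_sym xn.
have [y00|yn] := eqVneq y 0; first by rewrite E y00 seg0.
have yp : 0 < y by rewrite lt_neqAle eq_sym yn.
case: E => /addrI E1 /addrI E2.
have [yx|xy] := lerP y x.
  have b : 0 <= y / x <= 1 by rewrite divr_ge0 // ler_pdivrMr // mul1r.
  case: (separated_seg s2 b (y := 0)); rewrite ?lexx ?ler01 // seg0.
  rewrite [q in RHS]surjective_pairing /seg.
  have -> : y / x * (r.1 - p.1) = q.1 - p.1 by rewrite mulrAC -E1 mulrC mulKf.
  have -> : y / x * (r.2 - p.2) = q.2 - p.2 by rewrite mulrAC -E2 mulrC mulKf.
  by rewrite !(addrC _ (_ - _)) !subrK.
have b : 0 <= x / y <= 1 by rewrite divr_ge0 // ler_pdivrMr // mul1r ltW.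
case: (separated_seg s1 b (y := 0)); rewrite ?lexx ?ler01 // seg0.
rewrite [r in RHS]surjective_pairing /seg.
have -> : x / y * (q.1 - p.1) = r.1 - p.1 by rewrite mulrAC E1 mulrC mulKf.
have -> : x / y * (q.2 - p.2) = r.2 - p.2 by rewrite mulrAC E2 mulrC mulKf.
by rewrite !(addrC _ (_ - _)) !subrK.
Qed.

Lemma straight_line_planar (G : sgraph) (pt : G -> R * R) :
  injective pt ->
  (forall u v w, sedge u v -> w != u -> w != v -> line_separated (pt u) (pt v) (pt w) (pt w)) ->
  (forall u v x y, sedge u v -> sedge x y -> uniq [:: u; v; x; y] ->
     line_separated (pt u) (pt v) (pt x) (pt y)) ->
  planar R G.
Proof.
move=> pI sV sE.
have edge_neq u v : sedge u v -> u != v.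
  by apply: contraTneq => ->; rewrite sedge_irrefl.
pose arc (A : {set G}) : set (R * R) := [set z | exists u v s,
  [/\ A = [set u; v]%SET, 0 <= s <= 1 & z = seg (pt u) (pt v) s]].
have set2_eq (u v x y : G) : [set u; v]%SET = [set x; y]%SET ->
    (u = x /\ v = y) \/ (u = y /\ v = x).
  move=> E; have /set2P : u \in [set x; y]%SET by rewrite -E set21.
  have /set2P : v \in [set x; y]%SET by rewrite -E set22.
  have /set2P : x \in [set u; v]%SET by rewrite E set21.
  have /set2P : y \in [set u; v]%SET by rewrite E set22.
  by move=> [] h1 [] h2 [] h3 [] h4; subst; auto.
have arcE u v : arc [set u; v]%SET = [set seg (pt u) (pt v) s | s in `[0, 1]].
  apply/seteqP; split=> z /=.
    move=> [x [y [s [/set2_eq [[<- <-]|[<- <-]] s01 ->]]]].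
      by exists s => //; rewrite /= in_itv.
    exists (1 - s); last by rewrite -seg_rev.
    by rewrite /= in_itv /= subr_ge0 lerBlDr lerDl andbC.
  by move=> [s]; rewrite in_itv /= => s01 <-; exists u, v, s.
have arcP u v z : arc [set u; v]%SET z -> exists2 s, 0 <= s <= 1 & z = seg (pt u) (pt v) s.
  by rewrite arcE => -[s]; rewrite /= in_itv /= => s01 <-; exists s.
exists pt, arc; split=> //.
- move=> u v uv; rewrite arcE; apply: seg_arc.
  by rewrite (inj_eq pI) edge_neq.
- move=> u v w uv [/arcP [s s01 wE] nuv].
  have [wu|wu] := eqVneq w u; first by apply: nuv; left; rewrite wu.
  have [wv|wv] := eqVneq w v; first by apply: nuv; right; rewrite wv.
  apply: (separated_seg (sV u v w uv wu wv) s01 (y := 0)); first by rewrite lexx ler01.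
  by rewrite seg0.
- move=> u v x y uv xy ne; rewrite -subset0 => z [[/arcP [s s01 zE] nuv] zxy].
  have common a b c z' : sedge a b -> sedge a c -> b != c ->
      arc [set a; b]%SET z' -> arc [set a; c]%SET z' -> z' = pt a.
    move=> ab ac bc /arcP [s1 s101 ->] /arcP [s2 s201 E].
    have [ba ca] : b != a /\ c != a by split; rewrite eq_sym edge_neq.
    by apply: (seg_common _ _ s101 s201 E); apply: sV => //; rewrite // eq_sym.
  have zuv : arc [set u; v]%SET z by rewrite arcE; exists s; rewrite ?zE //= in_itv.
  have vu : sedge v u by rewrite sedge_sym.
  have yx : sedge y x by rewrite sedge_sym.
  have sC (a b : G) : [set a; b]%SET = [set b; a]%SET by exact: finset.setUC.
  have [E|ux] := eqVneq u x.
    subst x; apply: nuv; left; apply: (common u v y) => //.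
    by apply: contraNneq ne => ->.
  have [E|uy] := eqVneq u y.
    subst y; apply: nuv; left; apply: (common u v x) => //; last by rewrite sC.
    by apply: contraNneq ne => ->; rewrite sC.
  have [E|vx] := eqVneq v x.
    subst x; apply: nuv; right; apply: (common v u y) => //; last by rewrite sC.
  have [E|vy] := eqVneq v y.
    by subst y; apply: nuv; right; apply: (common v u x) => //; rewrite sC.
  have [s' s'01 zE'] := arcP _ _ _ zxy.
  apply: (separated_seg (sE u v x y uv xy _) s01 s'01); last by rewrite -zE -zE'.
  by rewrite /= !inE !negb_or edge_neq // ux uy vx vy edge_neq.
Qed.
End StraightLineDrawing.

(** * The crossing gadget and clause graphs *)

Local Delimit Scope Z_scope with BZ.

(* The crossing gadget.  Vertices 0-3 guard the ports 4-7 (north, east, south, west);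
   8-11 are the corners NE, SE, SW, NW, each blocking its two guards; the path of
   triangles on 12-17 forces a maximum independent set to use some corner.  The
   coupled gadget releases the southern guard from the corner SW. *)
Definition gadget_core : seq (nat * nat) :=
  [:: (0, 4); (1, 5); (2, 6); (3, 7); (0, 8); (8, 1); (1, 9); (9, 2); (10, 3);
      (3, 11); (11, 0); (8, 12); (12, 13); (9, 13); (9, 14); (13, 14); (14, 15);
      (10, 15); (10, 16); (15, 16); (16, 17); (17, 11)].

Definition gadget_edges (kind : option bool) : seq (nat * nat) :=
  match kind with
  | None => [::]
  | Some true => gadget_core
  | Some false => (2, 10) :: gadget_core
  end.

Section CellArrows.
Variables (kind : nat -> nat -> option bool) (hlink vlink : nat -> nat -> bool).

Definition cell_arrow (x y : nat * nat * nat) : bool :=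
  let: (j, i, k) := x in
  [|| (y.1 == (j, i)) && ((k, y.2) \in gadget_edges (kind j i)),
      [&& hlink j i, k == 5 & y == (j.+1, i, 7)]
    | [&& vlink j i, k == 6 & y == (j, i.+1, 4)]].

Definition cell_edge x y := cell_arrow x y || cell_arrow y x.

Lemma cell_edge_sym : symmetric cell_edge.
Proof. by move=> x y; rewrite /cell_edge orbC. Qed.

Lemma cell_arrow_irr x : cell_arrow x x = false.
Proof.
case: x => [[j i] k]; rewrite /cell_arrow /= !xpair_eqE eqxx /=.
have -> : ((k, k) \in gadget_edges (kind j i)) = false.
  have : all (fun e => e.1 != e.2) (gadget_edges (kind j i)) by case: (kind j i) => [[]|].
  by move=> /allP H; apply/negP => /H /=; rewrite eqxx.
have -> : (j == j.+1) = false by elim: (j).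
have -> : (i == i.+1) = false by elim: (i).
by rewrite !andbF.
Qed.

End CellArrows.

Section CellDrawing.

Definition cell_xs : seq Z := [:: 0; 4; 0; -4; 0; 6; 0; -6; 3; 3; -3; -3; 2; 2; 1; -1; -2; -2]%BZ.
Definition cell_ys : seq Z := [:: 4; 0; -4; 0; 6; 0; -6; 0; 3; -3; -3; 3; 2; -1; -2; -2; -1; 2]%BZ.

(* An item [(k, (k', (dj, di)))] joins vertex [k] of a cell to vertex [k'] of the cell
   [dj] columns to the right and [di] rows below; a single vertex is a degenerate item. *)
Definition cell_item : Type := nat * (nat * (nat * nat)).

Definition cell_items : seq cell_item :=
  [seq (e.1, (e.2, (0, 0))) | e <- gadget_edges (Some false)]
  ++ [:: (5, (7, (1, 0))); (6, (4, (0, 1)))]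
  ++ [seq (k, (k, (0, 0))) | k <- iota 0 18].

Definition zpos (v : Z * Z * nat) : Z * Z :=
  let: (j, i, k) := v in (14 * j + nth 0 cell_xs k, nth 0 cell_ys k - 14 * i)%BZ.

Definition zlin (a b : Z) (p : Z * Z) : Z := (a * p.1 + b * p.2)%BZ.

Definition zsep_by (a b : Z) (p q r s : Z * Z) : bool :=
  (Z.max (zlin a b p) (zlin a b q) <? Z.min (zlin a b r) (zlin a b s))%BZ.

Definition zsep (p q r s : Z * Z) : bool :=
  has (fun ab : Z * Z => zsep_by ab.1 ab.2 p q r s)
    [:: (1, 0); (-1, 0); (0, 1); (0, -1);
        (q.2 - p.2, p.1 - q.1); (p.2 - q.2, q.1 - p.1);
        (s.2 - r.2, r.1 - s.1); (r.2 - s.2, s.1 - r.1)]%BZ.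

Definition item_ends (d : Z * Z) (e : cell_item) : (Z * Z * nat) * (Z * Z * nat) :=
  ((d.1, d.2, e.1), (d.1 + Z.of_nat e.2.2.1, d.2 + Z.of_nat e.2.2.2, e.2.1))%BZ.

Definition zvertex_eqb (v w : Z * Z * nat) : bool :=
  [&& (v.1.1 =? w.1.1)%BZ, (v.1.2 =? w.1.2)%BZ & v.2 == w.2].

Definition items_ok (d : Z * Z) (e f : cell_item) : bool :=
  let: (u, v) := item_ends (0, 0)%BZ e in let: (x, y) := item_ends d f in
  [|| zvertex_eqb u x, zvertex_eqb u y, zvertex_eqb v x, zvertex_eqb v y
    | zsep (zpos u) (zpos v) (zpos x) (zpos y)].

Definition cell_offsets : seq (Z * Z) :=
  [seq (a, b) | a <- [:: -1; 0; 1]%BZ, b <- [:: -1; 0; 1]%BZ].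

Lemma cell_items_ok :
  all (fun d => all (fun e => all (items_ok d e) cell_items) cell_items) cell_offsets.
Proof. by vm_compute. Qed.

Definition item_box (e : cell_item) : bool :=
  let: (u, v) := item_ends (0, 0)%BZ e in
  all (fun p : Z * Z => [&& (-6 <=? p.1)%BZ, (p.1 <=? 8)%BZ, (-8 <=? p.2)%BZ & (p.2 <=? 6)%BZ])
    [:: zpos u; zpos v].

Lemma cell_items_box : all item_box cell_items.
Proof. by vm_compute. Qed.

End CellDrawing.

#[local] Arguments Z.mul : simpl never.
#[local] Arguments Z.add : simpl never.
#[local] Arguments Z.sub : simpl never.

Section CellPositions.
Variable R : realType.
Local Open Scope ring_scope.

Definition zr (z : Z) : R := (int_of_Z z)%:~R.

Lemma zrD a b : zr (a + b)%BZ = zr a + zr b.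
Proof. by rewrite /zr -intrD; congr (_%:~R); lia. Qed.

Lemma zrB a b : zr (a - b)%BZ = zr a - zr b.
Proof. by rewrite /zr -rmorphB; congr (_%:~R); lia. Qed.

Lemma zrM a b : zr (a * b)%BZ = zr a * zr b.
Proof. by rewrite /zr -intrM; congr (_%:~R); lia. Qed.

Lemma zr_lt a b : (a < b)%BZ -> zr a < zr b.
Proof. by rewrite /zr ltr_int; lia. Qed.

Lemma zr_le a b : (a <= b)%BZ -> zr a <= zr b.
Proof. by rewrite /zr ler_int; lia. Qed.

Lemma zr_nat n : zr (Z.of_nat n) = n%:R.
Proof. by rewrite /zr; have -> : int_of_Z (Z.of_nat n) = Posz n by lia. Qed.

Definition zshift (B : R * R) (p : Z * Z) : R * R := (B.1 + zr p.1, B.2 + zr p.2).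

Lemma zsep_by_separated (a b : Z) p q r s B : zsep_by a b p q r s ->
  line_separated (zshift B p) (zshift B q) (zshift B r) (zshift B s).
Proof.
have zl x : zr a * (B.1 + zr x.1) + zr b * (B.2 + zr x.2) =
    zr a * B.1 + zr b * B.2 + zr (zlin a b x) by rewrite /zlin zrD !zrM !mulrDr addrACA.
move=> /Z.ltb_spec0 H.
exists (zr a), (zr b), (zr a * B.1 + zr b * B.2 + zr (Z.max (zlin a b p) (zlin a b q))).
rewrite /zshift /= !zl; split; rewrite ?lerD2l ?ltrD2l.
- by apply: zr_le; lia.
- by apply: zr_le; lia.
- by apply: zr_lt; lia.
- by apply: zr_lt; lia.
Qed.

Lemma zsep_separated p q r s B : zsep p q r s ->
  line_separated (zshift B p) (zshift B q) (zshift B r) (zshift B s).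
Proof. by move=> /hasP[[a b] _]; exact: zsep_by_separated. Qed.

Lemma line_separated_sym (p q r s : R * R) : line_separated p q r s -> line_separated r s p q.
Proof.
move=> [a [b [c [h1 h2 h3 h4]]]].
have [m m1 m2] : exists2 m : R, c < m & m <= a * r.1 + b * r.2 /\ m <= a * s.1 + b * s.2.
  exists (Num.min (a * r.1 + b * r.2) (a * s.1 + b * s.2)); first by rewrite lt_min h3.
  by rewrite !ge_min !lexx orbT.
by exists (- a), (- b), (- m); split; lra.
Qed.

Lemma line_separated_swapl (p q r s : R * R) : line_separated p q r s -> line_separated q p r s.
Proof. by move=> [a [b [c [h1 h2 h3 h4]]]]; exists a, b, c. Qed.

Lemma line_separated_swapr (p q r s : R * R) : line_separated p q r s -> line_separated p q s r.
Proof. by move=> [a [b [c [h1 h2 h3 h4]]]]; exists a, b, c. Qed.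

Definition cell_pos (v : nat * nat * nat) : R * R :=
  let: (j, i, k) := v in (14 * j%:R + zr (nth 0%BZ cell_xs k), zr (nth 0%BZ cell_ys k) - 14 * i%:R).

Definition item_end1 (c : nat * nat) (e : cell_item) : nat * nat * nat := (c, e.1).
Definition item_end2 (c : nat * nat) (e : cell_item) : nat * nat * nat :=
  ((c.1 + e.2.2.1, c.2 + e.2.2.2)%N, e.2.1).

Lemma cell_pos_shift (j i : nat) (d : Z * Z) (j' i' k : nat) :
  Z.of_nat j' = (Z.of_nat j + d.1)%BZ -> Z.of_nat i' = (Z.of_nat i + d.2)%BZ ->
  cell_pos (j', i', k) = zshift (14 * j%:R, - (14 * i%:R)) (zpos (d, k)).
Proof.
move=> ej ei; rewrite /cell_pos /zshift /zpos; case: d ej ei => d1 d2 /= ej ei.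
rewrite -!zr_nat ej ei !zrB !zrD !zrM.
have -> : zr 14 = 14 by rewrite -[14%BZ]/(Z.of_nat 14) zr_nat.
by congr pair; ring.
Qed.

Lemma item_box_pos (j i : nat) e : e \in cell_items ->
  forall v, v = item_end1 (j, i) e \/ v = item_end2 (j, i) e ->
  [/\ 14 * j%:R - 6 <= (cell_pos v).1, (cell_pos v).1 <= 14 * j%:R + 8,
      - (14 * i%:R) - 8 <= (cell_pos v).2 & (cell_pos v).2 <= - (14 * i%:R) + 6].
Proof.
move=> /(allP cell_items_box); rewrite /item_box /item_ends /=.
have box p : [&& (-6 <=? p.1)%BZ, (p.1 <=? 8)%BZ, (-8 <=? p.2)%BZ & (p.2 <=? 6)%BZ] ->
    let z := zshift (14 * j%:R, - (14 * i%:R)) p in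
    [/\ 14 * j%:R - 6 <= z.1, z.1 <= 14 * j%:R + 8,
      - (14 * i%:R) - 8 <= z.2 & z.2 <= - (14 * i%:R) + 6].
  move=> /and4P[/Z.leb_spec0/zr_le h1 /Z.leb_spec0/zr_le h2 /Z.leb_spec0/zr_le h3 /Z.leb_spec0/zr_le h4].
  have z6 : zr 6 = 6 by rewrite -[6%BZ]/(Z.of_nat 6) zr_nat.
  have z8 : zr 8 = 8 by rewrite -[8%BZ]/(Z.of_nat 8) zr_nat.
  have z6' : zr (-6) = - 6 by rewrite -[(-6)%BZ]/(0 - 6)%BZ zrB z6 -[0%BZ]/(Z.of_nat 0) zr_nat sub0r.
  have z8' : zr (-8) = - 8 by rewrite -[(-8)%BZ]/(0 - 8)%BZ zrB z8 -[0%BZ]/(Z.of_nat 0) zr_nat sub0r.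
  rewrite z6 z8 z6' z8' in h1 h2 h3 h4.
  by rewrite /zshift /=; split; lra.
move=> /and3P[b1 b2 _] v [->|->].
  by rewrite /item_end1 (@cell_pos_shift j i (0, 0)%BZ) ?Z.add_0_r //; exact: box.
rewrite /item_end2 (@cell_pos_shift j i (Z.of_nat e.2.2.1, Z.of_nat e.2.2.2)).
- exact: box.
- by rewrite /=; lia.
- by rewrite /=; lia.
Qed.

Lemma offset_small (j j' : nat) : (j' < j.+2)%N -> (j < j'.+2)%N ->
  (Z.of_nat j' - Z.of_nat j)%BZ \in [:: -1; 0; 1]%BZ.
Proof. by rewrite !inE; lia. Qed.

Definition in_cell_box (j i : nat) (p : R * R) : Prop :=
  [/\ 14 * j%:R - 6 <= p.1, p.1 <= 14 * j%:R + 8,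
      - (14 * i%:R) - 8 <= p.2 & p.2 <= - (14 * i%:R) + 6].

Lemma far_boxes_separated (j i j' i' : nat) (p q r s : R * R) :
  in_cell_box j i p -> in_cell_box j i q -> in_cell_box j' i' r -> in_cell_box j' i' s ->
  (j.+2 <= j')%N || (i.+2 <= i')%N -> line_separated p q r s.
Proof.
move=> [a1 a2 a3 a4] [b1 b2 b3 b4] [c1 c2 c3 c4] [d1 d2 d3 d4].
have far (x y : nat) : (x.+2 <= y)%N -> 14 * x%:R + 28 <= 14 * y%:R :> R.
  move=> xy; have : x.+2%:R <= y%:R :> R by rewrite ler_nat.
  by clear; rewrite -!natr1; lra.
case/orP => /far h.
  exists 1, 0, (14 * j%:R + 8); rewrite !mul1r !mul0r !addr0.
  by move: a2 b2 c1 d1 h; clear; split; lra.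
exists 0, (-1), (14 * i%:R + 8); rewrite !mulN1r !mul0r !add0r.
by move: a3 b3 c4 d4 h; clear; split; lra.
Qed.

Lemma zvertex_neq (j i : nat) (c1 c2 : nat * nat) (d1 d2 : Z * Z) k1 k2 :
  (c1, k1) != (c2, k2) ->
  Z.of_nat c1.1 = (Z.of_nat j + d1.1)%BZ -> Z.of_nat c1.2 = (Z.of_nat i + d1.2)%BZ ->
  Z.of_nat c2.1 = (Z.of_nat j + d2.1)%BZ -> Z.of_nat c2.2 = (Z.of_nat i + d2.2)%BZ ->
  zvertex_eqb (d1, k1) (d2, k2) = false.
Proof.
move=> ne e1 e2 e3 e4; apply/negP => /and3P[/= /Z.eqb_spec g1 /Z.eqb_spec g2 /eqP g3].
move/eqP: ne; apply; rewrite g3; congr pair.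
rewrite [c1]surjective_pairing [c2]surjective_pairing.
have -> : c1.1 = c2.1 by apply: Nat2Z.inj; rewrite e1 e3 g1.
by have -> : c1.2 = c2.2 by apply: Nat2Z.inj; rewrite e2 e4 g2.
Qed.

Lemma items_separated (c c' : nat * nat) e f : e \in cell_items -> f \in cell_items ->
  item_end1 c e != item_end1 c' f -> item_end1 c e != item_end2 c' f ->
  item_end2 c e != item_end1 c' f -> item_end2 c e != item_end2 c' f ->
  line_separated (cell_pos (item_end1 c e)) (cell_pos (item_end2 c e))
            (cell_pos (item_end1 c' f)) (cell_pos (item_end2 c' f)).
Proof.
case: c c' => [j i] [j' i'] eI fI n1 n2 n3 n4.
have a := @item_box_pos j i e eI _ (or_introl erefl).
have b := @item_box_pos j i e eI _ (or_intror erefl).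
have a' := @item_box_pos j' i' f fI _ (or_introl erefl).
have b' := @item_box_pos j' i' f fI _ (or_intror erefl).
have [far|] := boolP ((j.+2 <= j')%N || (i.+2 <= i')%N).
  exact: far_boxes_separated far.
rewrite negb_or -!ltnNge => /andP[h1 h2].
have [far|] := boolP ((j'.+2 <= j)%N || (i'.+2 <= i)%N).
  by apply: line_separated_sym; exact: far_boxes_separated far.
rewrite negb_or -!ltnNge => /andP[h3 h4].
pose d := (Z.of_nat j' - Z.of_nat j, Z.of_nat i' - Z.of_nat i)%BZ.
have dI : d \in cell_offsets by apply: allpairs_f; exact: offset_small.
have := allP (allP (allP cell_items_ok _ dI) _ eI) _ fI.
rewrite /items_ok /item_ends.
have dj : Z.of_nat j' = (Z.of_nat j + d.1)%BZ by rewrite /d /=; clear; lia.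
have di : Z.of_nat i' = (Z.of_nat i + d.2)%BZ by rewrite /d /=; clear; lia.
have sumE (x y : nat) : Z.of_nat (x + y) = (Z.of_nat x + (0 + Z.of_nat y))%BZ by clear; lia.
have sumE' (x x' y : nat) z : Z.of_nat x' = (Z.of_nat x + z)%BZ ->
  Z.of_nat (x' + y) = (Z.of_nat x + (z + Z.of_nat y))%BZ by clear; lia.
have z0 (x : nat) : Z.of_nat x = (Z.of_nat x + 0)%BZ by rewrite Z.add_0_r.
rewrite (@zvertex_neq j i _ _ _ _ _ _ n1) //; try exact: sumE; try exact: sumE'; try exact: z0.
rewrite (@zvertex_neq j i _ _ _ _ _ _ n2) //; try exact: sumE; try exact: sumE'; try exact: z0.
rewrite (@zvertex_neq j i _ _ _ _ _ _ n3) //; try exact: sumE; try exact: sumE'; try exact: z0.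
rewrite (@zvertex_neq j i _ _ _ _ _ _ n4) //; try exact: sumE; try exact: sumE'; try exact: z0.
rewrite /item_end1 /item_end2.
rewrite (@cell_pos_shift j i (0, 0)%BZ); [|exact: z0|exact: z0].
rewrite (@cell_pos_shift j i (0 + Z.of_nat e.2.2.1, 0 + Z.of_nat e.2.2.2)%BZ);
  [|exact: sumE|exact: sumE].
rewrite (@cell_pos_shift j i d) //.
rewrite (@cell_pos_shift j i (d.1 + Z.of_nat f.2.2.1, d.2 + Z.of_nat f.2.2.2)%BZ);
  [|exact: sumE'|exact: sumE'].
exact: zsep_separated.
Qed.
End CellPositions.

Section CellGraph.
Variables (C Rw : nat) (kind : nat -> nat -> option bool) (hlink vlink : nat -> nat -> bool).

Definition cell_vertex : finType := ('I_C * 'I_Rw * 'I_18)%type.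

Definition cell_coord (v : cell_vertex) : nat * nat * nat :=
  ((v.1.1 : nat, v.1.2 : nat), v.2 : nat).

Lemma cell_coord_inj : injective cell_coord.
Proof. by move=> [[a b] c] [[a' b'] c'] [/val_inj -> /val_inj -> /val_inj ->]. Qed.

Definition cell_graph_edge (u v : cell_vertex) :=
  cell_edge kind hlink vlink (cell_coord u) (cell_coord v).

Lemma cell_graph_sym : symmetric cell_graph_edge.
Proof. by move=> u v; rewrite /cell_graph_edge cell_edge_sym. Qed.

Lemma cell_graph_irr : irreflexive cell_graph_edge.
Proof. by move=> u; rewrite /cell_graph_edge /cell_edge cell_arrow_irr. Qed.

Definition cell_graph : sgraph := SGraph cell_graph_sym cell_graph_irr.

Lemma cell_arrow_item x y : cell_arrow kind hlink vlink x y ->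
  exists c, exists2 e, e \in cell_items & x = item_end1 c e /\ y = item_end2 c e.
Proof.
case: x => [[j i] k]; case: y => [[j' i'] k'] /or3P[|/and3P[_ /eqP-> /eqP->]|/and3P[_ /eqP-> /eqP->]].
- move=> /= /andP[/eqP[-> ->] kk]; exists (j, i), (k, (k', (0, 0))).
    rewrite mem_cat; apply/orP; left; apply/mapP; exists (k, k') => //.
    move: kk; case: (kind j i) => [[]|]; [|by []|by []].
    by rewrite /gadget_edges => kk; rewrite in_cons kk orbT.
  by rewrite /item_end1 /item_end2 /= !addn0.
- by exists (j, i), (5, (7, (1, 0))); rewrite // /item_end1 /item_end2 /= addn0 addn1.
- by exists (j, i), (6, (4, (0, 1))); rewrite // /item_end1 /item_end2 /= addn0 addn1.
Qed.

Lemma cell_vertex_item (v : cell_vertex) : exists c, exists2 e, e \in cell_items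
  & cell_coord v = item_end1 c e /\ cell_coord v = item_end2 c e.
Proof.
exists (v.1.1 : nat, v.1.2 : nat), (v.2 : nat, (v.2 : nat, (0, 0))).
  rewrite mem_cat; apply/orP; right; rewrite mem_cat; apply/orP; right.
  by apply/mapP; exists (v.2 : nat); rewrite // mem_iota add0n ltn_ord.
by rewrite /item_end1 /item_end2 /= !addn0.
Qed.

Lemma cell_graph_planar (R : realType) : planar R cell_graph.
Proof.
pose pos (v : cell_graph) := cell_pos R (cell_coord v).
have edge_item (u v : cell_graph) : sedge u v -> exists c, exists2 e, e \in cell_items &
    (cell_coord u = item_end1 c e /\ cell_coord v = item_end2 c e) \/
    (cell_coord v = item_end1 c e /\ cell_coord u = item_end2 c e).
  by move=> /orP[|] /cell_arrow_item [c [e eI E]]; exists c, e; auto.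
have nc (u v : cell_graph) : u != v -> cell_coord u != cell_coord v.
  by apply: contraNneq => /cell_coord_inj ->.
have sep (u v x y : cell_graph) c c' e f : e \in cell_items -> f \in cell_items ->
    (cell_coord u = item_end1 c e /\ cell_coord v = item_end2 c e) ->
    (cell_coord x = item_end1 c' f /\ cell_coord y = item_end2 c' f) ->
    u != x -> u != y -> v != x -> v != y ->
    line_separated (pos u) (pos v) (pos x) (pos y).
  move=> eI fI [E1 E2] [F1 F2] /nc n1 /nc n2 /nc n3 /nc n4.
  have := @items_separated R c c' e f eI fI.
  by rewrite -E1 -E2 -F1 -F2 => /(_ n1 n2 n3 n4).
apply: (@straight_line_planar R cell_graph pos).
- move=> v w E; apply/eqP; apply: contraT => n.
  have [c [e eI Ee]] := cell_vertex_item v.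
  have [c' [f fI Ef]] := cell_vertex_item w.
  have [a [b [m [h1 _ h2 _]]]] := sep v v w w c c' e f eI fI Ee Ef n n n n.
  by move: h1 h2; rewrite E; clear; lra.
- move=> u v w /edge_item [c [e eI E]]; rewrite ![w == _]eq_sym => n1 n2.
  have [c' [f fI F]] := cell_vertex_item w.
  case: E => E; first exact: (sep _ _ _ _ _ _ _ _ eI fI E F).
  by apply: line_separated_swapl; exact: (sep _ _ _ _ _ _ _ _ eI fI E F).
- move=> u v x y /edge_item [c [e eI E]] /edge_item [c' [f fI F]] /=.
  rewrite !inE !negb_or andbT => /and3P[/and3P[_ n1 n2] /andP[n3 n4] _].
  case: E => E; last apply: line_separated_swapl;
    (case: F => F; last apply: line_separated_swapr); exact: (sep _ _ _ _ _ _ _ _ eI fI E F).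
Qed.
End CellGraph.

Section IntervalPathwidth.
Variables (G : sgraph) (a b : G -> nat) (M w : nat).

Lemma interval_pathwidth : (forall v, a v <= b v) -> (forall v, b v < M) ->
  (forall u v, sedge u v -> a u <= b v) ->
  (forall k, k < M -> #|[set v | a v <= k <= b v]| <= w.+1) ->
  pathwidth G <= w.
Proof.
move=> ab bM ed card.
pose bag k : {set G} := [set v | a v <= k <= b v].
pose X := mkseq bag M.
have bagX k : k < M -> bag k \in X by move=> kM; apply: map_f; rewrite mem_iota add0n.
have hX : has_path_decomposition G (decomposition_width X).
  apply/asboolP; exists X => //; split.
  - by move=> v; exists (bag (a v)); [apply: bagX; exact: leq_ltn_trans (ab v) (bM v)|rewrite inE leqnn ab].
  - move=> u v uv; exists (bag (maxn (a u) (a v))).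
      by apply: bagX; rewrite gtn_max !(leq_ltn_trans (ab _) (bM _)).
    have vu : sedge v u by rewrite sedge_sym.
    by rewrite !inE leq_maxl leq_maxr !geq_max !ab !ed.
  - move=> i j k ij jk; rewrite size_mkseq => kM.
    have jM := leq_ltn_trans jk kM; have iM := leq_ltn_trans ij jM.
    rewrite !nth_mkseq //.
    apply/fintype.subsetP => v; rewrite !inE => /andP[/andP[h1 _] /andP[_ h2]].
    by rewrite (leq_trans h1 ij) (leq_trans jk h2).
rewrite /pathwidth; case: ex_minnP => m _ /(_ _ hX) /leq_trans; apply.
rewrite /decomposition_width -ltnS.
have : \max_(B <- X) #|B| <= w.+1.
  by apply/bigmax_leqP_seq => _ /mapP[k + ->] _; rewrite mem_iota add0n => /andP[_]; exact: card.
by case: (\max_(B <- X) _).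
Qed.
End IntervalPathwidth.

Section CellGraphPathwidth.
Variables (C Rw : nat) (kind : nat -> nat -> option bool) (hlink vlink : nat -> nat -> bool).
Let G := cell_graph C Rw kind hlink vlink.

Let time (c : nat * nat) := c.1 * Rw + c.2.

Lemma time_inj (c c' : nat * nat) : c.2 < Rw -> c'.2 < Rw -> time c = time c' -> c = c'.
Proof.
case: c c' => [j i] [j' i'] /= iR i'R E; have R0 : 0 < Rw by exact: leq_ltn_trans iR.
have E1 : j = j' by have := congr1 (divn^~ Rw) E; rewrite /time /= !divnMDl // !divn_small // !addn0.
by move: E; rewrite /time E1 /= => /addnI ->.
Qed.

Lemma cell_graph_pathwidth : pathwidth G <= Rw + 18.
Proof.
pose ti (v : G) := time (cell_coord v).1.
pose dur (v : G) := if v.2 == 5 :> nat then Rw else if v.2 == 6 :> nat then 1 else 0.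
have tinj (u v : G) : ti u = ti v -> v.2 = u.2 -> u = v.
  move=> /time_inj E1 E2; apply: cell_coord_inj.
  by rewrite [LHS]surjective_pairing [RHS]surjective_pairing E1 ?ltn_ord //= E2.
apply: (@interval_pathwidth G ti (fun v => ti v + dur v) (C.+1 * Rw + 2)).
- by move=> v; exact: leq_addr.
- move=> v; have : ti v < C * Rw.
    rewrite /ti /time /=; apply: (@leq_trans (v.1.1.+1 * Rw)).
      by rewrite mulSn addnC ltn_add2r.
    by rewrite leq_mul2r ltn_ord orbT.
  have : dur v <= Rw + 1 by rewrite /dur; case: ifP => _; rewrite ?leq_addr //; case: ifP; rewrite ?leq_addl.
  by rewrite mulSn; clear; lia.
- have arr (u v : G) : cell_arrow kind hlink vlink (cell_coord u) (cell_coord v) ->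
      ti u <= ti v /\ ti v <= ti u + dur u.
    rewrite /ti /dur -[nat_of_ord u.2]/(cell_coord u).2; move: (cell_coord u) (cell_coord v).
    move=> [[j i] k] [[j' i'] k'] /= => /or3P[/andP[/eqP[-> ->] _]|/and3P[_ /eqP-> /eqP[-> -> _]]|/and3P[_ /eqP-> /eqP[-> -> _]]] /=.
    + by rewrite leqnn leq_addr.
    + by rewrite /time /= mulSn; clear; lia.
    + by rewrite /time /= addnS; clear; lia.
  by move=> u v /orP[] /arr [h1 h2] //; apply: leq_trans h1 (leq_addr _ _).
move=> k _.
pose A := [set v : G | ti v == k].
pose B := [set v : G | (v.2 == 5 :> nat) && (k <= ti v + Rw) && (ti v < k)].
pose D := [set v : G | (v.2 == 6 :> nat) && (ti v + 1 == k)].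
have sub : [set v | ti v <= k <= ti v + dur v] \subset A :|: (B :|: D).
  apply/fintype.subsetP => v; rewrite !inE /dur; move: (ti v) => x.
  by case: (v.2 == 5 :> nat); [|case: (v.2 == 6 :> nat)]; clear; lia.
have cA : #|A| <= 18.
  apply: (@leq_trans #|'I_18|); last by rewrite card_ord.
  rewrite -cardsT -(card_in_imset (f := fun v : G => v.2) (D := A)).
    by apply: subset_leq_card; exact: finset.subsetT.
  by move=> u v; rewrite !inE => /eqP E1 /eqP E2 E3; apply: tinj; rewrite ?E1 ?E2.
have cB : #|B| <= Rw.
  have [R0|R0] := posnP Rw.
    have -> : B = finset.set0.
      apply/setP => v; rewrite !inE; move: (ti v) (v.2 == 5 :> nat) R0 => x y; clear; lia.
    by rewrite cards0.
  pose f (v : G) : 'I_Rw.-1.+1 := inord (k - 1 - ti v).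
  have small v : v \in B -> k - 1 - ti v < Rw.-1.+1.
    by rewrite inE => /andP[/andP[_ h1] h2]; move: (ti v) h1 h2 R0; clear; lia.
  apply: (@leq_trans #|'I_Rw.-1.+1|); last by rewrite card_ord prednK.
  rewrite -cardsT -(card_in_imset (f := f) (D := B)).
    by apply: subset_leq_card; exact: finset.subsetT.
  move=> u v uB vB /(congr1 val); rewrite /= !inordK ?small //.
  move: uB vB; rewrite !inE => /andP[/andP[/eqP u5 ku] uk] /andP[/andP[/eqP v5 kv] vk] E.
  apply: tinj; first by move: uk vk E; clear; lia.
  by apply: val_inj; rewrite /= u5 v5.
have cD : #|D| <= 1.
  apply/card_le1_eqP => u v; rewrite !inE => /andP[/eqP u6 /eqP uk] /andP[/eqP v6 /eqP vk].
  by apply: tinj; [move: uk vk; clear; lia|apply: val_inj; rewrite /= u6 v6].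
apply: leq_trans (subset_leq_card sub) _.
rewrite cardsU; apply: leq_trans (leq_subr _ _) _.
have : #|B :|: D| <= #|B| + #|D| by rewrite cardsU leq_subr.
by move: cA cB cD; clear; lia.
Qed.
End CellGraphPathwidth.

(** * Optima of clause graphs *)

Section GadgetScan.

Fixpoint scan_independent (adj : rel nat) (P : pred (seq nat)) (n : nat) (ch : seq nat) : bool :=
  if n is m.+1 then
    scan_independent adj P m ch &&
    (if all (fun x => ~~ adj m x) ch then scan_independent adj P m (m :: ch) else true)
  else P ch.

Lemma scan_independentP adj P n ch (J : pred nat) : scan_independent adj P n ch ->
  (forall x y, J x -> J y -> ~~ adj x y) -> all J ch ->
  P ([seq k <- iota 0 n | J k] ++ ch).
Proof.
move=> + Ji; elim: n ch => [//|n IH] ch /andP[h1 h2] Jch.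
have E : iota 0 n.+1 = rcons (iota 0 n) n by rewrite -addn1 iotaD cats1.
rewrite E filter_rcons; case: ifP => Jn; last exact: IH.
rewrite cat_rcons; apply: IH; last by rewrite /= Jn.
have Jadj : all (fun x => ~~ adj n x) ch by apply/allP => x /(allP Jch); exact: Ji.
by rewrite Jadj in h2.
Qed.

Definition gadget_adj (b : bool) (x y : nat) : bool :=
  ((x, y) \in gadget_edges (Some b)) || ((y, x) \in gadget_edges (Some b)).

Definition gadget_spec (b : bool) (J : seq nat) : bool :=
  (size J <= 8) && ((size J == 8) ==>
    ((7 \in J) || (5 \in J)) && [|| 4 \in J, 6 \in J | b && (7 \in J)]).

Lemma gadget_scan b : scan_independent (gadget_adj b) (gadget_spec b) 18 [::].
Proof. by case: b; vm_compute. Qed.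

Lemma gadget_independent b (J : pred nat) : (forall x y, J x -> J y -> ~~ gadget_adj b x y) ->
  gadget_spec b [seq k <- iota 0 18 | J k].
Proof. by move=> Ji; rewrite -[X in gadget_spec b X]cats0; exact: scan_independentP (gadget_scan b) Ji _. Qed.

(* [x] is the truth value carried by the horizontal wire, [c] tells that the column
   has seen no false wire of its clause so far. *)
Definition gadget_choice (b x c : bool) : seq nat :=
  match x, c with
  | true, true => [:: 9; 0; 3; 5; 6; 12; 15; 17]
  | true, false => [:: 8; 2; 3; 4; 5; 13; 15; 17]
  | false, true => if b then [:: 10; 0; 1; 2; 7; 12; 14; 17] else [:: 10; 0; 1; 6; 7; 12; 14; 17]
  | false, false => [:: 11; 1; 2; 4; 7; 12; 14; 16]
  end.

Lemma gadget_choiceP b x c (J := gadget_choice b x c) :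
  [&& uniq J, size J == 8, all (fun k => k < 18) J,
      all (fun k => all (fun k' => ~~ gadget_adj b k k') J) J,
      (5 \in J) ==> x, (7 \in J) ==> ~~ x, (4 \in J) ==> ~~ c & (6 \in J) ==> c && (b ==> x)].
Proof. by rewrite {}/J; case: b; case: x; case: c; vm_compute. Qed.

Lemma gadget_choice_ports b x c (J := gadget_choice b x c) :
  [/\ 5 \in J -> x, 7 \in J -> ~~ x, 4 \in J -> ~~ c & 6 \in J -> c && (b ==> x)].
Proof.
by have /and5P[_ _ _ _ /and4P[/implyP ? /implyP ? /implyP ? /implyP ?]] := gadget_choiceP b x c.
Qed.

End GadgetScan.

Section ClauseGraph.
Variables (t : nat) (phi : pred {set 'I_t}).

Let C := #|{set 'I_t}|.+1.

Definition column_set (j : nat) : {set 'I_t} := nth finset.set0 (enum {set 'I_t}) j.-1.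

Definition row_in (S : {set 'I_t}) (i : nat) : bool := [exists i' in S, i' == i.-1 :> nat].

Definition clause_kind (j i : nat) : option bool :=
  if [&& 0 < j, 0 < i & i <= t] then Some (row_in (column_set j) i) else None.

Definition clause_hlink (j i : nat) : bool := 0 < i <= t.

Definition clause_vlink (j i : nat) : bool :=
  (0 < j) && ((i < t) || (i == t) && phi (column_set j)).

Definition clause_sgraph : sgraph := cell_graph C t.+2 clause_kind clause_hlink clause_vlink.

Definition clause_vertex (j i k : nat) : clause_sgraph :=
  ((inord j : 'I_C, inord i : 'I_t.+2), inord k : 'I_18).

Lemma clause_vertexK j i k : j < C -> i < t.+2 -> k < 18 ->
  cell_coord (clause_vertex j i k) = (j, i, k).
Proof. by move=> h1 h2 h3; rewrite /cell_coord /= !inordK. Qed.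

Definition clause_bd (i : 'I_t) : clause_sgraph := clause_vertex 0 i.+1 5.

Lemma clause_bd_inj : injective clause_bd.
Proof.
have lt (i : 'I_t) : i.+1 < t.+2 by rewrite ltnS ltnS ltnW.
move=> i i' /(congr1 (@cell_coord _ _)).
by rewrite !clause_vertexK ?lt // => -[] /val_inj.
Qed.

Definition clause_graph : bgraph t := @BGraph t clause_sgraph clause_bd clause_bd_inj.

Definition cell_cap (c : 'I_C * 'I_t.+2) : nat :=
  if clause_kind c.1 c.2 is Some _ then 8
  else if (c.1 == 0 :> nat) && (0 < c.2 <= t) then 17 else 18.

Definition total_cap : nat := \sum_c cell_cap c.

Definition cell_bd (I : {set clause_graph}) (c : 'I_C * 'I_t.+2) : bool :=
  [exists i : 'I_t, [&& c.1 == 0 :> nat, c.2 == i.+1 :> nat & bd clause_graph i \in I]].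

Definition content (I : {set clause_graph}) (c : 'I_C * 'I_t.+2) : seq nat :=
  [seq k <- iota 0 18 | ((c, inord k : 'I_18) : clause_graph) \in I].

Lemma card_content (I : {set clause_graph}) : #|I| = \sum_c size (content I c).
Proof.
rewrite -sum1_card (eq_bigl (fun v : clause_graph => (true && ((v.1, v.2) \in I)))); last first.
  by move=> [a b].
rewrite -(pair_big_dep (fun _ => true) (fun (c : 'I_C * 'I_t.+2) (k : 'I_18) => ((c, k) : clause_graph) \in I) (fun _ _ => 1)) /=.
apply: eq_bigr => c _; rewrite sum1_card /content -val_enum_ord filter_map size_map.
rewrite enumT size_filter cardE /enum_mem size_filter; apply: eq_count => k /=.
by rewrite inord_val.
Qed.

Lemma contentP I c k : (k \in content I c) = (k < 18) && (((c, inord k : 'I_18) : clause_graph) \in I).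
Proof. by rewrite mem_filter mem_iota add0n andbC. Qed.

Lemma content_vertex (I : {set clause_graph}) j i k : k < 18 ->
  (k \in content I (inord j, inord i)) = (clause_vertex j i k \in I).
Proof. by move=> k18; rewrite contentP k18. Qed.

Lemma size_content18 I c : size (content I c) <= 18.
Proof. by rewrite size_filter; apply: leq_trans (count_size _ _) _; rewrite size_iota. Qed.

Lemma clause_arrow_independent (I : {set clause_graph}) (u v : clause_graph) : independent I ->
  cell_arrow clause_kind clause_hlink clause_vlink (cell_coord u) (cell_coord v) ->
  u \in I -> v \notin I.
Proof.
move=> /independentP iI uv uI; apply/negP => vI; have := iI _ _ uI vI.
by rewrite /sedge /= /cell_graph_edge /cell_edge uv.
Qed.

Lemma content_kind (I : {set clause_graph}) (c : 'I_C * 'I_t.+2) b : independent I ->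
  clause_kind c.1 c.2 = Some b -> gadget_spec b (content I c).
Proof.
move=> iI kc.
have -> : content I c = [seq k <- iota 0 18 | (k < 18) && (((c, inord k : 'I_18) : clause_graph) \in I)].
  by apply: eq_in_filter => k; rewrite mem_iota add0n => /andP[_ ->].
apply: gadget_independent => x y /andP[x18 xI] /andP[y18 yI].
have E (k : nat) : k < 18 -> cell_coord ((c, inord k : 'I_18) : clause_graph) = ((c.1 : nat, c.2 : nat), k).
  by move=> k18; rewrite /cell_coord /= inordK.
apply/negP => /orP[] xy.
  have : ((c, inord y : 'I_18) : clause_graph) \notin I.
    by apply: clause_arrow_independent iI _ xI; rewrite !E //= eqxx kc xy.
  by rewrite yI.
have : ((c, inord x : 'I_18) : clause_graph) \notin I.
  by apply: clause_arrow_independent iI _ yI; rewrite !E //= eqxx kc xy.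
by rewrite xI.
Qed.

Lemma content_leq (I : {set clause_graph}) c : independent I ->
  size (content I c) <= cell_cap c + cell_bd I c.
Proof.
move=> iI; rewrite /cell_cap; case kc: (clause_kind _ _) => [b|].
  by have /andP[h _] := content_kind iI kc; apply: leq_trans h (leq_addr _ _).
case: ifP => [/andP[/eqP c0 /andP[ci ct]]|_]; last by apply: leq_trans (size_content18 _ _) (leq_addr _ _).
have [cb|ncb] := boolP (cell_bd I c); first exact: size_content18.
rewrite addn0 /content.
have n5 : 5 \notin content I c.
  rewrite contentP /=; apply: contra ncb => cI.
  have it : c.2.-1 < t by rewrite prednK.
  apply/existsP; exists (Ordinal it); rewrite c0 /= prednK ?eqxx //=.
  suff -> : clause_bd (Ordinal it) = ((c, inord 5 : 'I_18) : clause_graph) by [].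
  rewrite /clause_bd /clause_vertex /= prednK //; congr (_, _).
  by case: c c0 {ci ct cI it kc} => a b /= a0; rewrite inord_val; congr pair; apply: val_inj; rewrite /= inordK.
apply: (@leq_trans (size [seq k <- iota 0 18 | k != 5])); last by [].
  apply: uniq_leq_size; first by rewrite filter_uniq // iota_uniq.
move=> k kI; rewrite mem_filter; apply/andP; split; last by move: kI; rewrite mem_filter => /andP[].
by apply: contraNneq n5 => <-.
Qed.

Lemma sum_cell_bd (I : {set clause_graph}) :
  \sum_c cell_bd I c = #|[set i | bd clause_graph i \in I]|.
Proof.
pose f (i : 'I_t) : 'I_C * 'I_t.+2 := (ord0, inord i.+1).
have fI : injective f.
  move=> i i' /(congr1 (fun x => val x.2)); rewrite /= !inordK ?ltnS 1?ltnW // => -[].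
  by move=> /val_inj.
rewrite -(card_imset _ fI) -sum1_card [RHS]big_mkcond /=; apply: eq_bigr => c _.
rewrite /cell_bd; case: existsP => [[i /and3P[/eqP c0 /eqP ci iI]]|nE]; case: imsetP => // nI.
  case: nI; exists i; first by rewrite inE.
  case: c c0 ci => a b /= a0 bi; rewrite /f; congr pair; apply: val_inj => //=.
  by rewrite inordK // -bi.
case: nE; have [i] := nI; rewrite inE => iI ->; exists i.
by rewrite /= inordK ?ltnS 1?ltnW // iI !eqxx.
Qed.

Lemma card_independent_leq (I : {set clause_graph}) : independent I ->
  #|I| <= total_cap + #|[set i | bd clause_graph i \in I]|.
Proof.
move=> iI; rewrite card_content -sum_cell_bd -big_split /=.
by apply: leq_sum => c _; exact: content_leq.
Qed.

Lemma clause_opt_leq S : opt_restricted clause_graph S <= total_cap + #|S|.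
Proof.
apply/bigmax_leqP => I /andP[iI /forallP bI]; apply: leq_trans (card_independent_leq iI) _.
rewrite leq_add2l; apply/subset_leq_card/fintype.subsetP => i; rewrite inE => iI'.
by have /implyP := bI i; apply.
Qed.

Lemma column_set_surj S : exists2 j, 0 < j < C & column_set j = S.
Proof.
exists (index S (enum {set 'I_t})).+1; last by rewrite /column_set /= nth_index // mem_enum.
by rewrite /= ltnS cardE index_mem mem_enum.
Qed.

(* If equality held, every cell would be saturated, so the wires of [S] would carry
   true through every column, and the column of [S] would find no false wire. *)
Lemma clause_opt_lt S : phi S -> opt_restricted clause_graph S < total_cap + #|S|.
Proof.
move=> pS; rewrite ltnNge; apply/negP => big.
have [I /andP[iI /forallP bI] cI] : exists2 I : {set clause_graph}, restricted S I & total_cap + #|S| <= #|I|.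
  have [|I rI E] := eq_bigmax_cond (fun I : {set clause_graph} => #|I|) (A := [pred I | restricted S I]).
    apply/card_gt0P; exists finset.set0; rewrite inE /restricted.
    apply/andP; split; first by apply/independentP => x y; rewrite inE.
    by apply/forallP => i; rewrite inE.
  by exists I; [move: rI; rewrite inE|rewrite -E].
have sub : [set i | bd clause_graph i \in I] \subset S.
  by apply/fintype.subsetP => i; rewrite inE => iI'; have /implyP := bI i; apply.
have bdE : [set i | bd clause_graph i \in I] = S.
  apply/eqP; rewrite finset.eqEcard sub -(leq_add2l total_cap).
  exact: leq_trans cI (card_independent_leq iI).
have sat c : size (content I c) = cell_cap c + cell_bd I c.
  apply/eqP; rewrite eqn_leq content_leq //= leqNgt; apply/negP => lt.
  move: cI; rewrite -bdE -sum_cell_bd -big_split card_content /= leqNgt => /negP; apply.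
  rewrite (bigD1 c) // [X in _ < X](bigD1 c) //= -addSn leq_add //.
  by apply: leq_sum => c' _; exact: content_leq.
have cellE j i : j < C -> i < t.+2 ->
    (inord j : 'I_C) = j :> nat /\ (inord i : 'I_t.+2) = i :> nat by move=> jC iR; rewrite !inordK.
have arrow j i k j' i' k' : j < C -> i < t.+2 -> k < 18 -> j' < C -> i' < t.+2 -> k' < 18 ->
    cell_arrow clause_kind clause_hlink clause_vlink (j, i, k) (j', i', k') ->
    k \in content I (inord j, inord i) -> k' \notin content I (inord j', inord i').
  move=> h1 h2 h3 h4 h5 h6 ar; rewrite !content_vertex //.
  by apply: clause_arrow_independent iI _; rewrite !clause_vertexK.
have satk j i b (J := content I (inord j, inord i)) : j < C -> i < t.+2 ->
    clause_kind j i = Some b -> ((7 \in J) || (5 \in J)) && [|| 4 \in J, 6 \in J | b && (7 \in J)].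
  move=> jC iR kc; have [e1 e2] := cellE j i jC iR.
  have kc' : clause_kind (inord j : 'I_C) (inord i : 'I_t.+2) = Some b by rewrite e1 e2.
  have /andP[h1 /implyP h2] := content_kind (c := (inord j, inord i)) iI kc'; apply: h2.
  rewrite eqn_leq h1 /= sat /cell_cap /= kc'; exact: leq_addr.
have full j i k : 0 < j < C -> i < t.+2 -> clause_kind j i = None -> k < 18 ->
    k \in content I (inord j, inord i).
  move=> /andP[j0 jC] iR kc k18; have [e1 e2] := cellE j i jC iR.
  have : size (content I (inord j, inord i)) == 18.
    rewrite eqn_leq size_content18 sat /cell_cap /= e1 e2 kc; case: eqP => [E|_] /=; last exact: leq_addr.
    by rewrite E in j0.
  rewrite size_filter -[X in _ == X](size_iota 0 18) -all_count => /allP H.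
  by rewrite contentP k18; apply: H; rewrite mem_iota add0n.
have wire j (i : 'I_t) : i \in S -> j < C -> 5 \in content I (inord j, inord i.+1).
  move=> iS; have iR : i.+1 < t.+2 by rewrite ltnS ltnS ltnW.
  elim: j => [|j IH] jC.
    have : i \in [set i | bd clause_graph i \in I] by rewrite bdE.
    by rewrite inE content_vertex.
  have n7 := arrow j i.+1 5 j.+1 i.+1 7 (ltnW jC) iR isT jC iR isT _ (IH (ltnW jC)).
  have kc : clause_kind j.+1 i.+1 = Some (row_in (column_set j.+1) i.+1).
    by rewrite /clause_kind /= ltn_ord.
  have /andP[+ _] := satk _ _ _ jC iR kc.
  by rewrite (negPf (n7 _)) //= !eqxx /clause_hlink /= ltn_ord orbT.
have [j /andP[j0 jC] jS] := column_set_surj S.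
have col i : i <= t -> 6 \in content I (inord j, inord i).
  elim: i => [|i IH] it.
    by apply: full; rewrite ?j0 // /clause_kind andbF.
  have iR : i.+1 < t.+2 by rewrite ltnS ltnW.
  have n4 := arrow j i 6 j i.+1 4 jC (ltnW iR) isT jC iR isT _ (IH (ltnW it)).
  have kc : clause_kind j i.+1 = Some (row_in (column_set j) i.+1).
    by rewrite /clause_kind j0 /= it.
  have /andP[h1 h2] := satk _ _ _ jC iR kc; move: h2.
  rewrite (negPf (n4 _)) /=; last by rewrite !eqxx /clause_vlink j0 it !orbT.
  case/orP => // /andP[/existsP[i' /andP[i'B /eqP /= ei]] h7].
  rewrite jS in i'B.
  have j1 : j.-1.+1 = j by exact: prednK.
  have jC' : j.-1 < C by rewrite -ltnS j1 ltnW.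
  have := wire j.-1 i' i'B jC'; rewrite ei => h5.
  have ar : cell_arrow clause_kind clause_hlink clause_vlink (j.-1, i.+1, 5) (j, i.+1, 7).
    by apply/or3P/Or32; rewrite /clause_hlink it j1 !eqxx.
  by have := arrow j.-1 i.+1 5 j i.+1 7 jC' iR isT jC iR isT ar h5; rewrite h7.
have last4 : 4 \in content I (inord j, inord t.+1).
  by apply: full; rewrite ?j0 // /clause_kind ltnn !andbF.
have := arrow j t 6 j t.+1 4 jC (ltnW (ltnSn _)) isT jC (ltnSn _) isT _ (col t (leqnn t)).
by rewrite last4 /= !eqxx /clause_vlink j0 jS pS eqxx !orbT => /(_ isT).
Qed.

Lemma row_in_ord (S : {set 'I_t}) (i : 'I_t) : row_in S i.+1 = (i \in S).
Proof.
apply/exists_inP/idP => [[i' i'S /eqP /= /val_inj <-] //|iS].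
by exists i => //=; rewrite eqxx.
Qed.

Definition no_false_above (S : {set 'I_t}) (j i : nat) : bool :=
  [forall i' : 'I_t, (i' < i.-1) && (i' \in column_set j) ==> (i' \in S)].

Lemma no_false_aboveS S j (i : 'I_t) :
  no_false_above S j i.+1 && ((i \in column_set j) ==> (i \in S)) -> no_false_above S j i.+2.
Proof.
move=> /andP[/forallP H Hi]; apply/forallP => i'; apply/implyP => /andP[/= ].
rewrite ltnS leq_eqVlt => /orP[/eqP/val_inj ->|lt] i'B; first by move: Hi; rewrite i'B.
by have := H i'; rewrite /= lt i'B.
Qed.

Definition chosen (S : {set 'I_t}) (j i k : nat) : bool :=
  if clause_kind j i is Some b then k \in gadget_choice b (row_in S i) (no_false_above S j i)
  else if (j == 0) && (0 < i <= t) && (k == 5) then row_in S i else true.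

Definition chosen_set (S : {set 'I_t}) : {set clause_graph} :=
  [set v : clause_graph | chosen S v.1.1 v.1.2 v.2].

Lemma clause_bdE (i : 'I_t) : cell_coord (clause_bd i) = (0, i.+1, 5).
Proof. by rewrite clause_vertexK // ltnS ltnS ltnW. Qed.

Lemma chosen_bd S (i : 'I_t) : (bd clause_graph i \in chosen_set S) = (i \in S).
Proof.
rewrite inE; have [-> -> ->] := clause_bdE i.
by rewrite /chosen /clause_kind /= ltn_ord /= row_in_ord.
Qed.

Hypothesis phi_mono : forall S S' : {set 'I_t}, S \subset S' -> phi S -> phi S'.

Lemma chosen_arrow S (x y : nat * nat * nat) : ~~ phi S ->
  x.2 < 18 -> y.2 < 18 -> cell_arrow clause_kind clause_hlink clause_vlink x y ->
  chosen S x.1.1 x.1.2 x.2 -> ~~ chosen S y.1.1 y.1.2 y.2.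
Proof.
case: x y => [[j i] k] [[j' i'] k'] nS /= k18 k'18 /or3P[/andP[/eqP[-> ->]]|/and3P[hl /eqP-> /eqP[-> -> ->]]|/and3P[vl /eqP-> /eqP[-> -> ->]]] /=.
- rewrite /chosen; case: (clause_kind j i) => [b|//] kk.
  have /and5P[_ _ _ /allP H _] := gadget_choiceP b (row_in S i) (no_false_above S j i).
  move=> kc; apply/negP => k'c; have /allP/(_ _ k'c) := H _ kc.
  by rewrite /gadget_adj kk.
- move: hl => /andP[i0 it]; rewrite /chosen [clause_kind j.+1 i]/clause_kind /= i0 it /= => c5.
  have xS : row_in S i.
    move: c5; rewrite /clause_kind i0 it /= andbT; case: posnP => [_ //|j0].
    by have [H _ _ _] := gadget_choice_ports (row_in (column_set j) i) (row_in S i) (no_false_above S j i).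
  have [_ H _ _] := gadget_choice_ports (row_in (column_set j.+1) i) (row_in S i) (no_false_above S j.+1 i).
  by apply/negP => /H; rewrite xS.
- move: vl => /andP[j0 vt] c6.
  have it : i <= t by case/orP: vt => [/ltnW //|/andP[/eqP-> _]].
  have nf : no_false_above S j i.+1.
    case: i it c6 {vt} => [|i] it; first by move=> _; apply/forallP => p; rewrite ltn0.
    rewrite /chosen /clause_kind j0 it /= => c6.
    have [_ _ _ /(_ c6) /andP[nf]] := gadget_choice_ports (row_in (column_set j) i.+1) (row_in S i.+1) (no_false_above S j i.+1).
    rewrite -[i]/(nat_of_ord (Ordinal it)) !row_in_ord => imp.
    by apply: no_false_aboveS; rewrite nf.
  case/orP: vt => [lt|/andP[/eqP iT pj]].
    rewrite /chosen /clause_kind j0 lt /=.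
    have [_ _ H _] := gadget_choice_ports (row_in (column_set j) i.+1) (row_in S i.+1) (no_false_above S j i.+1).
    by apply/negP => /H; rewrite nf.
  case/negP: nS; apply: phi_mono pj; apply/fintype.subsetP => p pB.
  by have /implyP := forallP nf p; apply; rewrite /= iT ltn_ord.
Qed.

Lemma chosen_independent S : ~~ phi S -> independent (chosen_set S).
Proof.
move=> nS; apply/independentP => u v; rewrite !inE => uI vI; apply/negP => /orP[] ar.
  by have := @chosen_arrow S (cell_coord u) (cell_coord v) nS (ltn_ord u.2) (ltn_ord v.2) ar uI; rewrite /= vI.
by have := @chosen_arrow S (cell_coord v) (cell_coord u) nS (ltn_ord v.2) (ltn_ord u.2) ar vI; rewrite /= uI.
Qed.

Lemma content_chosen S c :
  cell_cap c + cell_bd (chosen_set S) c <= size (content (chosen_set S) c).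
Proof.
have -> : content (chosen_set S) c = [seq k <- iota 0 18 | chosen S c.1 c.2 k].
  apply: eq_in_filter => k; rewrite mem_iota add0n => /andP[_ k18].
  by rewrite inE /= inordK.
rewrite /cell_cap /chosen; case kc: (clause_kind _ _) => [b|].
  have -> : cell_bd (chosen_set S) c = false.
    rewrite /cell_bd; apply/negbTE/negP => /existsP[i /and3P[/eqP c0 _ _]].
    by move: kc; rewrite /clause_kind c0.
  rewrite addn0.
  have /and5P[uJ /eqP <- /allP J18 _ _] := gadget_choiceP b (row_in S c.2) (no_false_above S c.1 c.2).
  apply: uniq_leq_size => // k kJ; rewrite mem_filter kJ mem_iota add0n.
  exact: J18.
have bd_le : cell_bd (chosen_set S) c -> [&& c.1 == 0 :> nat, 0 < c.2 <= t & row_in S c.2].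
  rewrite /cell_bd => /existsP[i /and3P[/eqP c0 /eqP ci]]; rewrite chosen_bd => iS.
  by rewrite c0 ci ltn_ord row_in_ord.
case: ifP => [h|nh].
  rewrite /=; case rS: (row_in S c.2).
    apply: (@leq_trans 18); last by rewrite /=.
    by case: (cell_bd _ _).
  by have -> : cell_bd (chosen_set S) c = false by apply/negbTE/negP => /bd_le; rewrite rS !andbF.
have -> : cell_bd (chosen_set S) c = false.
  by apply/negbTE/negP => /bd_le; rewrite andbA nh.
by [].
Qed.

Lemma leq_clause_opt S : ~~ phi S -> total_cap + #|S| <= opt_restricted clause_graph S.
Proof.
move=> nS; have rI : restricted S (chosen_set S).
  apply/andP; split; first exact: chosen_independent.
  by apply/forallP => i; rewrite chosen_bd implybb.
apply: (@leq_trans #|chosen_set S|); last by rewrite /opt_restricted (bigD1 (chosen_set S)) //= leq_maxl.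
have -> : #|S| = #|[set i | bd clause_graph i \in chosen_set S]|.
  by apply: eq_card => i; rewrite inE chosen_bd.
rewrite -sum_cell_bd -big_split card_content /=.
by apply: leq_sum => c _; exact: content_chosen.
Qed.

End ClauseGraph.

Lemma clause_graph_inj (t : nat) (phi psi : pred {set 'I_t}) :
  (forall S S' : {set 'I_t}, S \subset S' -> phi S -> phi S') ->
  (forall S S' : {set 'I_t}, S \subset S' -> psi S -> psi S') ->
  ~~ phi finset.set0 -> ~~ psi finset.set0 ->
  equiv_IS (clause_graph phi) (clause_graph psi) -> phi =1 psi.
Proof.
have half (f g : pred {set 'I_t}) : (forall S S' : {set 'I_t}, S \subset S' -> f S -> f S') ->
    (forall S S' : {set 'I_t}, S \subset S' -> g S -> g S') ->
    ~~ f finset.set0 -> ~~ g finset.set0 ->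
    equiv_IS (clause_graph f) (clause_graph g) -> forall S, g S -> f S.
  move=> fm gm f0 g0 E S gS; apply: contraT => nfS.
  have := equiv_IS_opt_restricted E S finset.set0.
  have := leq_clause_opt fm nfS; have := leq_clause_opt gm g0.
  have := clause_opt_leq f finset.set0; have := clause_opt_lt gS; rewrite cards0.
  by clear; lia.
move=> pm qm p0 q0 E S; apply/idP/idP; last exact: (half phi psi).
by apply: (half psi phi) => //; exact: equiv_IS_sym.
Qed.

(** * Dedekind numbers and counting *)

Section DedekindBounds.

Lemma central_binomial_step s : s.+1 * 'C(s.+1.*2, s.+1) = 2 * s.*2.+1 * 'C(s.*2, s).
Proof.
have e1 := mul_bin_diag s.*2.+1 s; have e2 := mul_bin_left s.*2.+1 s.
have e3 := mul_bin_left s.*2 s.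
have -> : 'C(s.+1.*2, s.+1) = 2 * 'C(s.*2.+1, s).
  rewrite doubleS binS; have -> : 'C(s.*2.+1, s.+1) = 'C(s.*2.+1, s).
    rewrite -bin_sub; last by rewrite -addnn; clear; lia.
    by congr 'C(_, _); rewrite -addnn; clear; lia.
  by rewrite addnn mul2n.
have -> : s.+1 * (2 * 'C(s.*2.+1, s)) = 2 * (s.+1 * 'C(s.*2.+1, s)) by rewrite mulnCA.
have -> : s.+1 * 'C(s.*2.+1, s) = s.*2.+1 * 'C(s.*2, s).
  rewrite mul_bin_down; congr (_ * _); rewrite -addnn; clear; lia.
by rewrite mulnA.
Qed.

Lemma central_binomial_lower s : 0 < s -> 16 ^ s <= 4 * s * 'C(s.*2, s) ^ 2.
Proof.
case: s => // s _; elim: s => [|s IH]; first by [].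
have e := central_binomial_step s.+1.
set c := 'C(s.+1.*2, s.+1) in IH e; set c' := 'C(_, _) in e *.
rewrite -(leq_pmul2l (m := s.+2)) //.
have -> : s.+2 * (4 * s.+2 * c' ^ 2) = 4 * (s.+2 * c') ^ 2 by rewrite expnMn; ring.
rewrite e; have -> : 4 * (2 * s.+1.*2.+1 * c) ^ 2 = 16 * (s.+1.*2.+1 ^ 2 * c ^ 2) by rewrite !expnMn; ring.
rewrite expnS mulnCA leq_mul2l /=.
have h : s.+2 * (4 * s.+1) <= s.+1.*2.+1 ^ 2 by rewrite -addnn -mulnn; clear; nia.
apply: leq_trans (leq_mul h (leqnn _)).
by rewrite -mulnA leq_mul2l IH orbT.
Qed.

Lemma middle_binomial_lower t : 0 < t -> 4 ^ t <= 4 * t * 'C(t, t./2) ^ 2.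
Proof.
move=> t0; have := odd_double_half t; case: (odd t) => /=; last first.
  rewrite add0n => te; set s := t./2 in te *.
  have s0 : 0 < s by move: t0; rewrite -te; case: (s).
  rewrite -te -{1}muln2 mulnC expnM; apply: leq_trans (central_binomial_lower s0) _.
  by rewrite leq_mul2r; apply/orP; right; rewrite -addnn; clear; lia.
rewrite add1n => te; set s := t./2 in te *.
have := central_binomial_lower (ltn0Sn s).
have -> : 'C(s.+1.*2, s.+1) = 2 * 'C(t, s).
  rewrite -te doubleS binS; have -> : 'C(s.*2.+1, s.+1) = 'C(s.*2.+1, s).
    rewrite -bin_sub; last by rewrite -addnn; clear; lia.
    by congr 'C(_, _); rewrite -addnn; clear; lia.
  by rewrite addnn mul2n.
have E : 4 ^ t = 4 * 16 ^ s by rewrite -te expnS -muln2 [s * 2]mulnC expnM.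
have E' : t = (s + s).+1 by rewrite -te addnn.
rewrite E expnS expnMn; move: (16 ^ s) ('C(t, s) ^ 2) => p d.
by rewrite E'; clear; nia.
Qed.

Definition upset (t : nat) (P : {set {set 'I_t}}) : bool :=
  [forall S : {set 'I_t}, forall S' : {set 'I_t}, (S \subset S') ==> (S \in P) ==> (S' \in P)].

Lemma dedekindE t : dedekind t = #|[set P | @upset t P]|.
Proof.
pose s2f (S : {set 'I_t}) : {ffun 'I_t -> bool} := [ffun i => i \in S].
pose f2s (x : {ffun 'I_t -> bool}) : {set 'I_t} := [set i | x i].
have fsK : cancel f2s s2f by move=> x; apply/ffunP => i; rewrite !ffunE inE.
have sfK : cancel s2f f2s by move=> S; apply/setP => i; rewrite inE ffunE.
pose h (f : {ffun {ffun 'I_t -> bool} -> bool}) : {set {set 'I_t}} := [set S | f (s2f S)].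
have hI : injective h.
  move=> f g /setP E; apply/ffunP => x; have := E (f2s x); by rewrite !inE fsK.
rewrite /dedekind -(card_imset _ hI); apply: eq_card => P; apply/imsetP/idP.
  move=> [f + ->]; rewrite !inE => /forallP mf.
  apply/forallP => S; apply/forallP => S'; apply/implyP => SS; rewrite !inE.
  have /implyP := forallP (mf (s2f S)) (s2f S'); apply.
  by apply/forallP => i; rewrite !ffunE; apply/implyP; exact: (fintype.subsetP SS).
rewrite inE => /forallP uP; exists [ffun x => f2s x \in P].
  rewrite inE; apply/forallP => x; apply/forallP => y; apply/implyP => /forallP xy.
  rewrite !ffunE; have /implyP := forallP (uP (f2s x)) (f2s y); apply.
  by apply/fintype.subsetP => i; rewrite !inE; exact/implyP.
by apply/setP => S; rewrite inE ffunE sfK.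
Qed.

Lemma dedekind_lower t : 2 ^ 'C(t, t./2) <= dedekind t.
Proof.
pose m := t./2; pose A := [set S : {set 'I_t} | #|S| == m].
have <- : #|A| = 'C(t, m) by rewrite -[t in RHS]card_ord -card_draws.
rewrite -card_powerset dedekindE.
pose g (B : {set {set 'I_t}}) := B :|: [set S : {set 'I_t} | m < #|S|].
rewrite -(card_in_imset (f := g) (D := powerset A)).
  apply/subset_leq_card/fintype.subsetP => _ /imsetP[B + ->]; rewrite !inE => /fintype.subsetP BA.
  apply/forallP => S; apply/forallP => S'; apply/implyP => SS; apply/implyP; rewrite !inE.
  case/orP => [SB|lt]; last by rewrite (leq_trans lt (subset_leq_card SS)) orbT.
  have := BA _ SB; rewrite inE => /eqP Sm; have := subset_leq_card SS; rewrite Sm.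
  rewrite leq_eqVlt => /orP[/eqP E|->]; last by rewrite orbT.
  have -> : S' = S by apply/esym/eqP; rewrite finset.eqEcard SS Sm E leqnn.
  by rewrite SB.
move=> B B'; rewrite !inE => /fintype.subsetP BA /fintype.subsetP BA' /setP E.
apply/setP => S; have := E S; rewrite !inE.
have [/eqP Sm|nA] := boolP (#|S| == m); first by rewrite Sm ltnn !orbF.
have nB (D : {set {set 'I_t}}) : (forall x, x \in D -> x \in A) -> (S \in D) = false.
  by move=> DA; apply/negP => /DA; rewrite inE (negPf nA).
by rewrite !nB.
Qed.

Lemma dedekind_upper t : dedekind t <= 2 ^ 2 ^ t.
Proof.
rewrite dedekindE; apply: leq_trans (max_card _) _.
by rewrite -cardsT -powersetT card_powerset cardsT -cardsT -powersetT card_powerset cardsT card_ord.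
Qed.

Lemma card_upset_nonempty t : dedekind t <= #|[set P | @upset t P & finset.set0 \notin P]| + 1.
Proof.
rewrite dedekindE -(cards1 [set: {set 'I_t}]) -cardsUI; apply: leq_trans (leq_addr _ _).
apply/subset_leq_card/fintype.subsetP => P; rewrite !inE => uP; rewrite uP /=.
have [P0|//] := boolP (finset.set0 \in P); apply/eqP/setP => S; rewrite inE.
have /implyP/(_ (finset.sub0set _))/implyP := forallP (forallP uP finset.set0) S.
by apply.
Qed.
End DedekindBounds.

Section Pigeonhole.
Variables (R : realType) (t : nat) (Rt : bgraph t -> Prop) (K : nat).
Hypothesis codesK : forall n, exists L : seq (seq (nat * nat)), size L <= 2 ^ (K * n) /\
  forall G, grid_minor G -> #|G| = n -> exists2 e, e \in L & is_code G n e.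
Hypothesis Rt_planar : forall G, Rt G -> planar R G.
Hypothesis Rt_cover : forall C : bgraph t -> Prop, is_equiv_IS_class C ->
  (exists G : bgraph t, [/\ C G, planar R G & pathwidth G <= t + 20]) ->
  exists H, C H /\ Rt H.

Lemma Rt_clause_graph (phi : pred {set 'I_t}) :
  exists H, equiv_IS (clause_graph phi) H /\ Rt H.
Proof.
apply: (Rt_cover (C := equiv_IS (clause_graph phi))); first by exists (clause_graph phi).
exists (clause_graph phi); split.
- by exists 0%R => F; rewrite addr0.
- exact: cell_graph_planar.
- apply: leq_trans (cell_graph_pathwidth _ _ _ _ _) _; by clear; lia.
Qed.

Definition boundaried_code (n : nat) (e : seq (nat * nat)) (b : 'I_t -> nat) (H : bgraph t) : Prop :=
  #|H| = n /\ exists f : H -> nat, [/\ injective f, forall x, f x < n,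
    forall x y, sedge x y = ((f x, f y) \in e) & forall i, f (bd H i) = b i].

Lemma boundaried_code_equiv n e b (H H' : bgraph t) :
  boundaried_code n e b H -> boundaried_code n e b H' -> equiv_IS H H'.
Proof.
move=> [Hn [f [fI fn fe fb]]] [H'n [f' [f'I f'n f'e f'b]]].
have sur (J : bgraph t) (h : J -> nat) : #|J| = n -> injective h -> (forall x, h x < n) ->
    forall a, a < n -> exists x, h x = a.
  by move=> Jn hI hn a an; apply: code_surj => //; rewrite Jn.
have [g gP] := boolp.choice (fun x => sur _ _ H'n f'I f'n _ (fn x)).
have [g' g'P] := boolp.choice (fun x => sur _ _ Hn fI fn _ (f'n x)).
apply: (@isomorphic_equiv_IS t H H' g g').
- by move=> x; apply: fI; rewrite g'P gP.
- by move=> x; apply: f'I; rewrite gP g'P.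
- by move=> x y; rewrite f'e fe !gP.
- by move=> i; apply: f'I; rewrite gP fb f'b.
Qed.

Lemma dedekind_leq_codes (N : nat) : (forall G, Rt G -> #|G| < N) ->
  dedekind t <= N * 2 ^ (K * N) * N ^ t + 1.
Proof.
move=> small; apply: leq_trans (card_upset_nonempty t) _; rewrite leq_add2r.
have /boolp.choice [L LP] := codesK.
set U := [set P | _].
pose CT := ('I_N * 'I_(2 ^ (K * N)) * {ffun 'I_t -> 'I_N})%type.
pose codes (P : {set {set 'I_t}}) (c : CT) := exists H : bgraph t,
  equiv_IS (clause_graph (mem P)) H /\
  boundaried_code c.1.1 (nth [::] (L c.1.1) c.1.2) (fun i => c.2 i) H.
have code_ex (P : {set {set 'I_t}}) : exists c, codes P c.
  have [H [eH RH]] := Rt_clause_graph (mem P).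
  have lt := small _ RH.
  have [sL /(_ H (planar_grid_minor (Rt_planar RH)) erefl) [e eL [f [fI fn fe]]]] := LP #|H|.
  have ie : index e (L #|H|) < 2 ^ (K * N).
    apply: (@leq_trans (2 ^ (K * #|H|))); first by apply: leq_trans sL; rewrite index_mem.
    by rewrite leq_exp2l // leq_mul2l ltnW ?orbT.
  have fN x : f x < N by exact: ltn_trans (fn x) lt.
  exists (Ordinal lt, Ordinal ie, [ffun i => Ordinal (fN (bd H i))]), H; split=> //; split=> //.
  exists f; split=> //= [x y|i]; first by rewrite nth_index.
  by rewrite ffunE.
have [c cP] := boolp.choice code_ex.
have cI : {in U &, injective c}.
  move=> P Q; rewrite !inE => /andP[uP P0] /andP[uQ Q0] E.
  have [H [eH cH]] := cP P; have [H' [eH' cH']] := cP Q; rewrite -E in cH'.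
  have eq : equiv_IS (clause_graph (mem P)) (clause_graph (mem Q)).
    apply: equiv_IS_trans eH _; apply: equiv_IS_trans (boundaried_code_equiv cH cH') _.
    exact: equiv_IS_sym.
  have mono (W : {set {set 'I_t}}) : upset W ->
      forall S S' : {set 'I_t}, S \subset S' -> mem W S -> mem W S'.
    move=> uW S S' SS SW; have /implyP/(_ SS)/implyP := forallP (forallP uW S) S'; exact.
  by apply/setP => S; exact: (clause_graph_inj (mono _ uP) (mono _ uQ) P0 Q0 eq S).
rewrite -(card_in_imset cI); apply: leq_trans (max_card _) _.
by rewrite !card_prod !card_ord card_ffun !card_ord.
Qed.
End Pigeonhole.

Section Asymptotics.

Lemma exp2_beats_quartic t : 20 <= t -> t.+1 ^ 4 <= 2 ^ t.
Proof.
move=> t20; rewrite -(subnK t20); elim: (t - 20) => [|n IH].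
  by rewrite add0n -[20]/(5 * 4)%N expnM leq_exp2r.
rewrite addSn [2 ^ _]expnS; apply: (leq_trans _ (leq_mul (leqnn 2) IH)).
set s := (n + 20).+1; have s6 : 17 <= s by rewrite /s; clear; lia.
clearbody s.
have e2 : s * s = s ^ 2 by rewrite mulnn.
have e3 : s * s ^ 2 = s ^ 3 by rewrite -expnS.
have h1 : 17 * s ^ 3 <= s * s ^ 3 by rewrite leq_mul2r s6 orbT.
have h2 : 17 * s ^ 2 <= s ^ 3 by rewrite -e3 leq_mul2r s6 orbT.
have h3 : 17 * s <= s ^ 2 by rewrite -e2 leq_mul2r s6 orbT.
have -> : s.+1 ^ 4 = s * s ^ 3 + 4 * s ^ 3 + 6 * s ^ 2 + 4 * s + 1 by ring.
have -> : 2 * s ^ 4 = s * s ^ 3 + s * s ^ 3 by ring.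
move: s6 h1 h2 h3; move: (s * s ^ 3) (s ^ 3) (s ^ 2) => a b c.
by clear; lia.
Qed.

Lemma middle_binomial_cubic t : 20 <= t -> t.+1 ^ 3 <= 'C(t, t./2).
Proof.
move=> t20; have t0 : 0 < t by apply: leq_trans t20.
have h := middle_binomial_lower t0; set m := 'C(_, _) in h *.
have h2 : 2 ^ t <= t.+1 * m.
  rewrite -leq_sqr -expnM [(t * 2)%N]mulnC expnM expnMn -[2 ^ 2]/4.
  apply: leq_trans h _; rewrite leq_mul2r; apply/orP; right.
  by rewrite -mulnn; clear; nia.
have := leq_trans (exp2_beats_quartic t20) h2.
by rewrite expnS leq_pmul2l.
Qed.
End Asymptotics.

Lemma code_count_small (K t l : nat) (N := (l %/ (4 * K.+1)).+1) :
  K + 20 <= t -> 'C(t, t./2) <= l <= 2 ^ t ->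
  N * 2 ^ (K * N) * N ^ t + 1 < 2 ^ l.
Proof.
move=> Kt /andP[ml lt].
have t20 : 20 <= t by apply: leq_trans Kt; rewrite leq_addl.
have cub := leq_trans (middle_binomial_cubic t20) ml.
have Nt : N <= 2 ^ t.
  have l0 : 0 < l by apply: leq_trans cub; rewrite expn_gt0.
  by apply: leq_trans lt; apply: ltn_Pdiv l0; rewrite mulnS.
have qN : 4 * (K * N) <= l + 4 * K.
  have h := leq_trunc_div l (4 * K.+1); rewrite /N mulnS.
  move: (l %/ _) h => q h; have : 4 * (K * q) <= q * (4 * K.+1) by clear; nia.
  by move: h; clear; lia.
have E : N * 2 ^ (K * N) * N ^ t <= 2 ^ (t.+1 * t + K * N).
  rewrite -mulnA mulnCA mulnC -expnS expnD leq_mul2r; apply/orP; right.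
  by rewrite mulnC expnM leq_exp2r.
have small : t.+1 * t + K * N < l.-1.
  have h1 : 21 * t.+1 ^ 2 <= t.+1 ^ 3 by rewrite [in X in _ <= X]expnS leq_mul2r; apply/orP; right; move: Kt; clear; lia.
  have h2 : 21 * t.+1 <= t.+1 ^ 2 by rewrite -mulnn leq_mul2r; apply/orP; right; move: Kt; clear; lia.
  have h3 : t.+1 * t <= t.+1 ^ 2 by rewrite -mulnn leq_mul2l leqnSn orbT.
  by move: (t.+1 * t) (t.+1 ^ 2) (t.+1 ^ 3) (K * N) h1 h2 h3 qN cub Kt => a b c d; clear; lia.
apply: (@leq_ltn_trans (2 ^ (t.+1 * t + K * N) + 1)); first by rewrite leq_add2r.
rewrite addn1 (@leq_ltn_trans (2 ^ l.-1)) ?ltn_exp2l //.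
by move: small; case: (l).
Qed.

Local Open Scope ring_scope.

Theorem theorem27 (R : realType) :
  exists (c : nat) (alpha : R) (t0 : nat), 0 < alpha /\
    forall t : nat, (t0 <= t)%N ->
      (forall Rt : bgraph t -> Prop,
         (forall G : bgraph t, Rt G -> planar R G) ->
         (forall C : bgraph t -> Prop, is_equiv_IS_class C ->
            (exists G : bgraph t,
               [/\ C G, planar R G & (pathwidth G <= t + c)%N]) ->
            exists H : bgraph t, C H /\ Rt H) ->
         exists G : bgraph t,
           Rt G /\ alpha * log2 (dedekind t)%:R <= #|G|%:R) /\
      2 ^+ t / Num.sqrt (4 * t)%:R <= log2 (dedekind t)%:R :> R.
Proof.
have [K codesK] := grid_minor_codes.
exists 20, (4 * K.+1)%:R^-1, (K + 20)%N; split; first by rewrite invr_gt0 ltr0n.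
move=> t Kt; have t0 : (0 < t)%N by apply: leq_trans Kt; rewrite addnC.
have ln2 : 0 < ln 2 :> R by rewrite ln_gt0 // ltr1n.
have D0 : (0 < dedekind t)%N by apply: leq_trans (dedekind_lower t); rewrite expn_gt0.
split.
- move=> Rt planarRt cover; apply: boolp.contrapT => none.
  pose l := trunc_log 2 (dedekind t).
  have lu : log2 (dedekind t)%:R < l.+1%:R :> R.
    rewrite /log2 ltr_pdivrMr //.
    have -> : l.+1%:R * ln 2 = ln (2 ^+ l.+1) :> R by rewrite lnXn // mulr_natl.
    rewrite ltr_ln ?posrE ?exprn_gt0 ?ltr0n //.
    by rewrite -natrX ltr_nat; have /andP[] := trunc_log_bounds (isT : (1 < 2)%N) D0.
  pose N := (l %/ (4 * K.+1)).+1.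
  have small G : Rt G -> (#|G| < N)%N.
    move=> RG; rewrite ltnS leq_divRL // -ltnS -(ltr_nat R) natrM.
    rewrite -ltr_pdivlMr ?ltr0n //; rewrite ltNge; apply/negP => big; apply: none; exists G; split=> //.
    apply: le_trans big; rewrite mulrC ler_pM2r ?invr_gt0 ?ltr0n //; exact: ltW.
  have ml : ('C(t, t./2) <= l <= 2 ^ t)%N.
    rewrite trunc_log_max ?dedekind_lower //=.
    rewrite -(@leq_exp2l 2) //; apply: leq_trans (dedekind_upper t).
    exact: trunc_logP.
  have := dedekind_leq_codes codesK planarRt cover small.
  have := code_count_small Kt ml; rewrite -/N => h1 h2.
  have := leq_ltn_trans h2 h1; rewrite ltnNge; apply/negP/negPn.
  by have /andP[] := trunc_log_bounds (isT : (1 < 2)%N) D0.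
- set m := 'C(t, t./2).
  have ml : m%:R <= log2 (dedekind t)%:R :> R.
    rewrite /log2 ler_pdivlMr //.
    have -> : m%:R * ln 2 = ln (2 ^+ m) :> R by rewrite lnXn // mulr_natl.
    by rewrite ler_ln ?posrE ?exprn_gt0 ?ltr0n // -natrX ler_nat dedekind_lower.
  apply: le_trans ml; rewrite ler_pdivrMr; last by rewrite sqrtr_gt0 ltr0n muln_gt0.
  rewrite -(@ler_pXn2r _ 2) ?nnegrE ?exprn_ge0 ?mulr_ge0 ?sqrtr_ge0 ?ler0n //.
  rewrite exprMn sqr_sqrtr ?ler0n // -!natrX -natrM ler_nat mulnC.
  by rewrite -expnM mulnC expnM middle_binomial_lower.
Qed.
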